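(* Consider the $\beta$-model with true parameter $\boldsymbol\beta\in\mathbb R^n$. Let $r=r_n\in\{2,\dots,n\}$ with $r\to\infty$, and assume the homogeneous null $H_0:\beta_1=\cdots=\beta_r$ holds. Let $\Theta_0=\{\boldsymbol\gamma\in\mathbb R^n:\gamma_1=\cdots=\gamma_r\}$ and $\hat{\boldsymbol\beta}^0=\arg\max_{\boldsymbol\gamma\in\Theta_0}\ell(\boldsymbol\gamma)$. If $b_n^{15}/c_n^9=o\big(r^{1/2}/(\log n)^3\big)$, then with probability tending to one $\hat{\boldsymbol\beta}$ and $\hat{\boldsymbol\beta}^0$ exist, and $$\frac{2\{\ell(\hat{\boldsymbol\beta})-\ell(\hat{\boldsymbol\beta}^0)\}-r}{\sqrt{2r}}\xrightarrow{d}N(0,1)\quad\text{as } r\to\infty .$$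
   Context: All quantities may depend on $n$; asymptotics are as $n\to\infty$. $\beta$-model: for $\boldsymbol\beta=(\beta_1,\dots,\beta_n)^\top\in\mathbb R^n$, the symmetric adjacency matrix $A=(a_{ij})$ of an undirected graph on nodes $\{1,\dots,n\}$ has $a_{ii}=0$, $a_{ji}=a_{ij}$, and $a_{ij}$ ($1\le i<j\le n$) mutually independent Bernoulli with $P(a_{ij}=1)=\mu(\beta_i+\beta_j)$, where $\mu(x)=e^x/(1+e^x)$. Degrees: $d_i=\sum_{j\ne i}a_{ij}$. Log-likelihood: $\ell(\boldsymbol\gamma)=\sum_{i=1}^n\gamma_id_i-\sum_{1\le i<j\le n}\log(1+e^{\gamma_i+\gamma_j})$, $\boldsymbol\gamma\in\mathbb R^n$; $\hat{\boldsymbol\beta}$ denotes its maximizer over $\mathbb R^n$ (the MLE). $b_n=\max_{i\ne j}(1+e^{\beta_i+\beta_j})^2/e^{\beta_i+\beta_j}$ and $c_n=\min_{i\ne j}(1+e^{\beta_i+\beta_j})^2/e^{\beta_i+\beta_j}$, computed at the true $\boldsymbol\beta$ (so $b_n\ge c_n\ge4$). *)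

(* Defs.v *)
From HB Require Import structures.
From mathcomp Require Import all_boot all_order all_algebra.
From mathcomp Require Import all_classical all_reals all_analysis.
Set Implicit Arguments. Unset Strict Implicit. Unset Printing Implicit Defensive.
Import Order.TTheory GRing.Theory Num.Theory.
Import numFieldNormedType.Exports.
Local Open Scope ring_scope.

Definition logistic {R : realType} (x : R) : R := expR x / (1 + expR x).

Definition adj (n : nat) := {ffun 'I_n * 'I_n -> bool}.

Definition valid_adj {n : nat} (A : adj n) : bool :=
  [forall i, forall j, A (i, j) == A (j, i)] && [forall i, ~~ A (i, i)].

Definition bmodel_pmf {R : realType} {n : nat} (beta : 'I_n -> R) (A : adj n) : R :=
  if valid_adj A then
    \prod_(i : 'I_n) \prod_(j : 'I_n | (i < j)%N)
       (if A (i, j) then logistic (beta i + beta j)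
        else 1 - logistic (beta i + beta j))
  else 0.

Definition bmodel_prob {R : realType} {n : nat} (beta : 'I_n -> R) (E : adj n -> Prop) : R :=
  \sum_(A : adj n | `[< E A >]) bmodel_pmf beta A.

Definition degree {R : realType} {n : nat} (A : adj n) (i : 'I_n) : R :=
  \sum_(j : 'I_n | j != i) (A (i, j))%:R.

Definition loglik {R : realType} {n : nat} (A : adj n) (g : 'I_n -> R) : R :=
  \sum_(i : 'I_n) g i * @degree R n A i
  - \sum_(i : 'I_n) \sum_(j : 'I_n | (i < j)%N) ln (1 + expR (g i + g j)).

(* Theta_0 = { gamma : gamma_1 = ... = gamma_r } (indices 0..r-1) *)
Definition Theta0 {R : realType} {n : nat} (r : nat) (g : 'I_n -> R) : Prop :=
  forall i j : 'I_n, (i < r)%N -> (j < r)%N -> g i = g j.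

Definition is_max_on {R : realType} {n : nat} (A : adj n) (S : ('I_n -> R) -> Prop)
  (g : 'I_n -> R) : Prop :=
  S g /\ forall g', S g' -> loglik A g' <= loglik A g.

Definition bc_fun {R : realType} (x : R) : R := (1 + expR x) ^+ 2 / expR x.

Definition b_n {R : realType} {n : nat} (beta : 'I_n -> R) : R :=
  \big[Num.max/0]_(p : 'I_n * 'I_n | p.1 != p.2) bc_fun (beta p.1 + beta p.2).

(* min over i != j; the initial value b_n is >= every term, so for n >= 2
   this is exactly the minimum *)
Definition c_n {R : realType} {n : nat} (beta : 'I_n -> R) : R :=
  \big[Num.min/b_n beta]_(p : 'I_n * 'I_n | p.1 != p.2) bc_fun (beta p.1 + beta p.2).

Definition Phi {R : realType} (x : R) : R :=
  fine (normal_prob (0 : R) 1 `]-oo, x]).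

(* Main.v *)
(** With [d] the score at the restricted maximizer [z], the Newton step [d / lam]
    is explicit: under the null [d] is supported on the first [r] nodes and sums to
    zero there, and on such vectors the Hessian at [z] acts as the scalar [lam].
    Strong concavity turns this step into a proof that the global maximizer exists and
    gives [2 (l gh - l z) = |d|^2 / lam] up to cubic and quartic sums, which are
    controlled by the symmetry of the block and by moment bounds. Replacing [z] by the
    true parameter changes [lam] only by a linear functional of the score, obtained by
    solving the Fisher system. What remains is the sum over the block of
    [eps_i ^ 2 / lam] with [eps_i = d_i - E d_i]; its off-diagonal part is a quadratic
    form in independent centred edge variables, and its diagonal part concentrates
    around [r]. The quadratic form is a martingale; comparing it with the heat flow of an
    indicator function, stopped when its conditional variance exceeds the remaining time,
    gives asymptotic normality once [tr A^4] tends to [0]. *)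

Require Import Defs.
From HB Require Import structures.
From mathcomp Require Import all_boot all_order all_algebra.
From mathcomp Require Import all_classical all_reals all_analysis.
From mathcomp Require Import ring lra zify.
Import Order.TTheory GRing.Theory Num.Theory.
Import numFieldNormedType.Exports.
Local Open Scope classical_set_scope.
Local Open Scope ring_scope.

(** * Taylor expansions *)

(** The maximizers are too far from the truth for a direct expansion: the squared error of the
    restricted one is only bounded by [64 * b ^+ 2 * M], spread over all [n] nodes. Expanding at [z]
    avoids this, since the nuisance components of the score vanish there exactly. What survives is
    [lam]. Up to powers of [b] and [M], Cauchy-Schwarz alone would let it move by [n / sqrt r],
    which shifts the statistic by [sqrt r], the very scale of the limit; the Fisher system, solved
    with a right-hand side independent of the graph, reduces the move to [n / r]. The same threshold
    forces sums of cubes of scores to be estimated with their signs. Exceptional events are bounded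
    by Markov's inequality at a level [M], later [ln n], so they have probability [O(1 / M)], and
    the logarithms in the hypothesis pay for [M ^+ 3]. All errors are measured by
    [b ^+ 6 * M ^+ 3 / sqrt r], which tends to 0 under the hypothesis because [c_n <= b_n]. *)

Section Taylor.
Context {R : realType}.

Lemma is_derive_onemX (k : nat) (s : R) :
  is_derive s 1 ((cst 1 - id : R -> R) ^+ k.+1) (k.+1%:R * (1 - s) ^+ k * -1).
Proof.
have H3 : is_derive s 1 (cst 1 - id : R -> R) (0 - 1) by exact: is_deriveB.
apply: (is_derive_eq (is_deriveX k.+1 H3)).
by rewrite !fctE /= /GRing.scale /= sub0r.
Qed.

(** With the base point [y] moving and the end point 1 fixed, the derivative telescopes:
    differentiating a coefficient cancels differentiating the next power, and only the top term
    survives. *)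
Lemma is_derive_taylor_sum (f : nat -> R -> R) (k : nat) (s : R) :
  (forall j, (j <= k)%N -> is_derive s 1 (f j) (f j.+1 s)) ->
  is_derive s 1 (fun y => \sum_(j < k.+1) f j y * (1 - y) ^+ j / j`!%:R)
    (f k.+1 s * (1 - s) ^+ k / k`!%:R).
Proof.
elim: k => [|k IHk] df.
  have -> : (fun y => \sum_(j < 1) f j y * (1 - y) ^+ j / j`!%:R) = f 0%N.
    by apply/funext => y; rewrite big_ord1 expr0 mulr1 fact0 divr1.
  by rewrite expr0 mulr1 fact0 divr1; exact: df.
have H1 := IHk (fun j jk => df j (leqW jk)).
have H2 := df k.+1 (leqnn _).
have -> : (fun y => \sum_(j < k.+2) f j y * (1 - y) ^+ j / j`!%:R) =
  (fun y => \sum_(j < k.+1) f j y * (1 - y) ^+ j / j`!%:R) +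
  f k.+1 * ((k.+1)`!%:R^-1 *: (cst 1 - id) ^+ k.+1).
  apply/funext => y; rewrite big_ord_recr /= !fctE /=.
  by congr (_ + _); rewrite -mulrA; congr (_ * _); rewrite mulrC.
move: H1 H2; move: (fun y => \sum_(j < _) _) (f k.+2 s) (f k.+1) => g b h H1 H2.
have dZ (c : R) : is_derive s 1 (g + h * (c *: (cst 1 - id) ^+ k.+1))
    (h s * (1 - s) ^+ k / k`!%:R + (h s * (c * (k.+1%:R * (1 - s) ^+ k * -1)) +
     c * (1 - s) ^+ k.+1 * b)).
  apply: (is_derive_eq (is_deriveD H1 (is_deriveM H2 (is_deriveZ c (is_derive_onemX k s))))).
  rewrite !fctE /= /GRing.scale /=; ring.
apply: (is_derive_eq (dZ _)).
have f0 : (k`!%:R : R) != 0 by rewrite pnatr_eq0 -lt0n fact_gt0.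
rewrite factS natrM.
have k0 : (k.+1%:R : R) != 0 by rewrite pnatr_eq0.
field.
by rewrite f0 nat1r k0.
Qed.

(** Rolle's theorem for the Taylor sum with moving base point plus a multiple [C] of
    [(1 - s) ^+ k.+1], where [C] makes the values at 0 and 1 agree. Derivatives are supplied as a
    family [f], so that closed forms replace iterated derivatives. *)
Lemma taylor_lagrange01 (f : nat -> R -> R) (k : nat) :
  (forall j (s : R), (j <= k)%N -> 0 <= s <= 1 -> is_derive s 1 (f j) (f j.+1 s)) ->
  exists2 s : R, 0 <= s <= 1 &
    f 0%N 1 = \sum_(j < k.+1) f j 0 / j`!%:R + f k.+1 s / (k.+1)`!%:R.
Proof.
move=> df.
pose S y := \sum_(j < k.+1) f j y * (1 - y) ^+ j / j`!%:R.
pose C := f 0%N 1 - \sum_(j < k.+1) f j 0 / j`!%:R.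
pose G := S + C *: (cst 1 - id) ^+ k.+1.
have dG (s : R) : 0 <= s <= 1 -> is_derive s 1 G
    ((1 - s) ^+ k * (f k.+1 s / k`!%:R - C * k.+1%:R)).
  move=> s01; have H := is_derive_taylor_sum f k s (fun j jk => df j s jk s01).
  apply: (is_derive_eq (is_deriveD H (is_deriveZ C (is_derive_onemX k s)))).
  rewrite /GRing.scale /=; ring.
have [] := @Rolle R G 0 1 ltr01.
- move=> x; rewrite in_itv /= => /andP[x0 x1].
  by have [] := dG x (introT andP (conj (ltW x0) (ltW x1))).
- apply: derivable_within_continuous => x; rewrite in_itv /= => x01.
  by have [] := dG x x01.
- rewrite /G !fctE /= /S /GRing.scale /= subr0 subrr expr0n mulr0 addr0 expr1n mulr1.
  have -> : \sum_(j < k.+1) f j 1 * 0 ^+ j / j`!%:R = f 0%N 1.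
    rewrite big_ord_recl /= expr0 mulr1 fact0 divr1 big1 ?addr0 // => i _.
    by rewrite expr0n /= mulr0 mul0r.
  rewrite /C addrC -[RHS](subrK (\sum_(j < k.+1) f j 0 / j`!%:R)).
  by congr (_ + _); apply: eq_bigr => i _; rewrite expr1n mulr1.
move=> s; rewrite in_itv /= => /andP[s0 s1] dG0.
have s01 : 0 <= s <= 1 by rewrite !ltW.
exists s => //.
have [_ e1] := dG s s01; have [_ e2] := dG0.
have : (1 - s) ^+ k * (f k.+1 s / k`!%:R - C * k.+1%:R) = 0 by rewrite -e1 e2.
move/eqP; rewrite mulf_eq0 expf_eq0 subr_eq0 (gt_eqF s1) andbF /= subr_eq0 => /eqP e.
have k0 : (k.+1%:R : R) != 0 by rewrite pnatr_eq0.
have f0 : (k`!%:R : R) != 0 by rewrite pnatr_eq0 -lt0n fact_gt0.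
suff -> : f k.+1 s / (k.+1)`!%:R = C by rewrite /C addrC subrK.
by rewrite factS natrM invfM mulrCA e mulrC mulfK.
Qed.

Lemma taylor_lagrange (g : nat -> R -> R) (k : nat) (x t : R) :
  (forall j (s : R), (j <= k)%N -> 0 <= s <= 1 ->
     is_derive (x + s * t) 1 (g j) (g j.+1 (x + s * t))) ->
  exists2 s : R, 0 <= s <= 1 &
    g 0%N (x + t) = \sum_(j < k.+1) g j x * t ^+ j / j`!%:R
                    + g k.+1 (x + s * t) * t ^+ k.+1 / (k.+1)`!%:R.
Proof.
move=> dg.
pose f j s := g j (x + s * t) * t ^+ j.
have [j s jk s01|s s01] := taylor_lagrange01 f k.
  have H := dg j s jk s01.
  have -> : f j = t ^+ j *: (g j \o (cst x + t *: id)).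
    by apply/funext => y; rewrite /f !fctE /= /GRing.scale /= mulrC [t * y]mulrC.
  have H' : is_derive ((cst x + t *: id) s) 1 (g j) (g j.+1 (x + s * t)).
    by rewrite !fctE /= /GRing.scale /= [t * s]mulrC.
  have Ha : is_derive s 1 (cst x + t *: id : R -> R) (0 + t *: 1).
    exact: (is_deriveD (is_derive_cst x s 1) (is_deriveZ t (is_derive_id s 1))).
  apply: (is_derive_eq (is_deriveZ (t ^+ j) (is_derive1_comp H' Ha))).
  by rewrite /f /GRing.scale /= exprS; ring.
rewrite /f mul1r expr0 mulr1 => ->; exists s => //.
by congr (_ + _); apply: eq_bigr => i _; rewrite mul0r addr0.
Qed.

End Taylor.

(** * The logistic function *)

Section LogisticCalculus.
Context {R : realType}.
Implicit Types x t s : R.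

Definition softplus x : R := ln (1 + expR x).
Definition dlogistic x : R := logistic x * (1 - logistic x).
Definition d2logistic x : R := dlogistic x * (1 - 2 * logistic x).
Definition d3logistic x : R := dlogistic x * (1 - 6 * dlogistic x).

Lemma logistic_gt0 x : 0 < logistic x.
Proof. by rewrite /logistic divr_gt0 ?expR_gt0 // addr_gt0 ?expR_gt0. Qed.

Lemma logistic_lt1 x : logistic x < 1.
Proof.
by rewrite /logistic ltr_pdivrMr ?mul1r ?ltrDr // addr_gt0 ?expR_gt0.
Qed.

Lemma dlogistic_gt0 x : 0 < dlogistic x.
Proof. by rewrite mulr_gt0 ?logistic_gt0 // subr_gt0 logistic_lt1. Qed.

Lemma dlogistic_le x : dlogistic x <= 1 / 4.
Proof. rewrite /dlogistic; have := sqr_ge0 (logistic x - 1 / 2); lra. Qed.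

(** The link between the model constants and the curvature: [bc_fun] is the inverse variance of an
    edge, so [b_n] is used throughout as the lower bound [1 / b] on [dlogistic]. *)
Lemma bc_funV x : (bc_fun x)^-1 = dlogistic x.
Proof.
have e0 := expR_gt0 x.
rewrite /bc_fun /dlogistic /logistic; field.
by rewrite !gt_eqF // ?addr_gt0.
Qed.

Lemma d2logistic_bound x : `|d2logistic x| <= 1 / 4.
Proof.
have m0 := logistic_gt0 x; have m1 := logistic_lt1 x.
have n0 := dlogistic_gt0 x; have n1 := dlogistic_le x.
rewrite /d2logistic normrM (ger0_norm (ltW n0)).
apply: le_trans n1; rewrite -[leRHS]mulr1; apply: (ler_wpM2l (ltW n0)).
by rewrite ler_norml; apply/andP; split; lra.
Qed.

Lemma d3logistic_bound x : `|d3logistic x| <= 1 / 4.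
Proof.
have n0 := dlogistic_gt0 x; have n1 := dlogistic_le x.
rewrite /d3logistic normrM (ger0_norm (ltW n0)).
apply: (le_trans _ n1); rewrite -[leRHS]mulr1; apply: (ler_wpM2l (ltW n0)).
by rewrite ler_norml; apply/andP; split; lra.
Qed.

Lemma is_derive_softplus x : is_derive x 1 softplus (logistic x).
Proof.
have e0 := expR_gt0 x.
have p0 : 0 < (cst 1 + expR) x by rewrite /= !fctE; lra.
have H : is_derive x 1 (cst 1 + expR : R -> R) (0 + expR x).
  exact: (is_deriveD (is_derive_cst (1 : R) x (1 : R)) (is_derive_expR x)).
apply: (is_derive_eq (is_derive1_comp (is_derive1_ln p0) H)).
by rewrite /logistic add0r mulrC !fctE.
Qed.

Lemma logisticE x : logistic x = expR (x - softplus x).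
Proof. by rewrite expRB lnK // posrE addr_gt0 ?expR_gt0. Qed.

Lemma is_derive_logistic x : is_derive x 1 (@logistic R) (dlogistic x).
Proof.
have -> : @logistic R = expR \o (id - softplus).
  by apply/funext => y; rewrite logisticE.
have H : is_derive x 1 (id - softplus : R -> R) (1 - logistic x).
  exact: (is_deriveB (is_derive_id x (1 : R)) (is_derive_softplus x)).
apply: (is_derive_eq (is_derive1_comp (is_derive_expR _) H)).
by rewrite !fctE -logisticE.
Qed.

Lemma is_derive_dlogistic x : is_derive x 1 dlogistic (d2logistic x).
Proof.
have H := is_derive_logistic x.
have -> : dlogistic = @logistic R * (cst 1 - @logistic R) by [].
apply: (is_derive_eq (is_deriveM H (is_deriveB (is_derive_cst (1 : R) x (1 : R)) H))).
rewrite !fctE /GRing.scale /= /d2logistic /dlogistic; ring.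
Qed.

Lemma is_derive_d2logistic x : is_derive x 1 d2logistic (d3logistic x).
Proof.
have H := is_derive_logistic x; have H2 := is_derive_dlogistic x.
have -> : d2logistic = dlogistic * (cst 1 - 2 *: @logistic R) by [].
apply: (is_derive_eq (is_deriveM H2
  (is_deriveB (is_derive_cst (1 : R) x (1 : R)) (is_deriveZ 2 H)))).
rewrite -[(cst 1 - _) x]/(1 - 2 * logistic x).
rewrite /GRing.scale /= /d2logistic /d3logistic /dlogistic; ring.
Qed.

(** Since [bc_fun x = e^x + 2 + e^(-x)], a shift by [s] multiplies it by at most [e^|s|]. The
    comparison is multiplicative, so curvature at nearby parameters stays within a constant factor
    of the true one, however small that is. *)
Lemma dlogistic_shift x s : (1 - `|s|) * dlogistic x <= dlogistic (x + s).
Proof.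
have le_bc : bc_fun (x + s) <= expR `|s| * bc_fun x.
  have bcE z : bc_fun z = expR z + 2 + expR (- z) :> R.
    rewrite /bc_fun expRN; field; exact: lt0r_neq0 (expR_gt0 _).
  rewrite !bcE !mulrDr -!expRD !lerD // ?ler_expR.
  - by rewrite addrC lerD2r ler_norm.
  - by rewrite mulr1 -expR0 ler_expR.
  - by rewrite mulr1 -expR0 ler_expR.
  - by rewrite opprD addrC lerD2r ler_normr lexx orbT.
have bc0 z : 0 < bc_fun z :> R.
  by rewrite -invr_gt0 bc_funV dlogistic_gt0.
rewrite -!bc_funV; apply: (@le_trans _ _ ((expR `|s| * bc_fun x)^-1)).
  rewrite [leRHS]invfM; apply: ler_wpM2r; first by rewrite invr_ge0 ltW.
  rewrite -expRN; exact: expR_ge1Dx.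
have e0 : 0 < expR `|s| * bc_fun x by exact: mulr_gt0 (expR_gt0 _) (bc0 _).
by rewrite lef_pV2 // posrE; exact: bc0.
Qed.

Lemma dlogistic_half x s : `|s| <= 1 / 2 -> dlogistic x / 2 <= dlogistic (x + s).
Proof.
move=> s2; apply: le_trans (dlogistic_shift x s).
by have := dlogistic_gt0 x; nra.
Qed.

Let chain (j : nat) : R -> R :=
  match j with
  | 0 => softplus | 1 => @logistic R | 2 => dlogistic | 3 => d2logistic
  | _ => d3logistic end%N.

Let is_derive_chain j x : (j <= 3)%N -> is_derive x 1 (chain j) (chain j.+1 x).
Proof.
case: j => [|[|[|[|//]]]] _ /=.
- exact: is_derive_softplus.
- exact: is_derive_logistic.
- exact: is_derive_dlogistic.
- exact: is_derive_d2logistic.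
Qed.

Lemma softplus_taylor2 x t : exists2 s : R, 0 <= s <= 1 &
  softplus (x + t) = softplus x + logistic x * t + dlogistic (x + s * t) * t ^+ 2 / 2.
Proof.
have [j s j1 _|s s01 e] := @taylor_lagrange R chain 1 x t.
  by apply: is_derive_chain; lia.
exists s => //; rewrite [LHS]e !big_ord_recl big_ord0 /= /bump !leq0n /= !addn0.
rewrite !factS !fact0 expr0 expr1; by field.
Qed.

Lemma softplus_tangent x t : softplus x + logistic x * t <= softplus (x + t).
Proof.
have [s _ ->] := softplus_taylor2 x t.
by rewrite lerDl divr_ge0 // mulr_ge0 ?sqr_ge0 // ltW // dlogistic_gt0.
Qed.

Lemma softplus_strong x t : `|t| <= 1 / 2 ->
  softplus x + logistic x * t + dlogistic x * t ^+ 2 / 4 <= softplus (x + t).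
Proof.
move=> t2; have [s /andP[s0 s1] ->] := softplus_taylor2 x t.
rewrite lerD2l.
have : dlogistic x / 2 <= dlogistic (x + s * t).
  apply: dlogistic_half; rewrite normrM (ger0_norm s0).
  by apply: le_trans t2; rewrite ler_piMl.
have := sqr_ge0 t => h1 h2.
have := ler_wpM2r h1 h2; lra.
Qed.

Lemma softplus_smooth x t :
  softplus (x + t) <= softplus x + logistic x * t + t ^+ 2 / 8.
Proof.
have [s _ ->] := softplus_taylor2 x t; rewrite lerD2l.
have := ler_wpM2r (sqr_ge0 t) (dlogistic_le (x + s * t)); lra.
Qed.

Lemma softplus_taylor4 x t :
  `|softplus (x + t) - (softplus x + logistic x * t + dlogistic x * t ^+ 2 / 2
     + d2logistic x * t ^+ 3 / 6)| <= t ^+ 4 / 96.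
Proof.
have [j s j1 _|s s01] := @taylor_lagrange R chain 3 x t; first exact: is_derive_chain.
rewrite [LHS]/= => ->; rewrite !big_ord_recl big_ord0 /= /bump !leq0n /= !addn0 !add1n.
rewrite !factS !fact0 expr0 expr1.
set e := (X in `|X|); have -> : e = d3logistic (x + s * t) * t ^+ 4 / 24.
  by rewrite /e; field.
rewrite normrM normrM (ger0_norm (_ : 0 <= 24%:R^-1)) //.
have := d3logistic_bound (x + s * t).
rewrite [`|t ^+ 4|]ger0_norm; last by rewrite exprn_even_ge0.
have t4 : 0 <= t ^+ 4 by rewrite exprn_even_ge0.
by move=> /(ler_wpM2r t4); lra.
Qed.

Lemma logistic_taylor2 x t :
  `|logistic (x + t) - (logistic x + dlogistic x * t)| <= t ^+ 2 / 8.
Proof.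
have [j s j1 _|s s01] := @taylor_lagrange R (fun j => chain j.+1) 1 x t.
  by apply: is_derive_chain; lia.
rewrite [LHS]/= => ->; rewrite !big_ord_recl big_ord0 /= /bump !leq0n /= !addn0.
rewrite !factS !fact0 expr0 expr1.
set e := (X in `|X|); have -> : e = d2logistic (x + s * t) * t ^+ 2 / 2.
  by rewrite /e; field.
rewrite normrM normrM (ger0_norm (_ : 0 <= 2%:R^-1)) //.
have := d2logistic_bound (x + s * t).
rewrite [`|t ^+ 2|]ger0_norm ?sqr_ge0 //.
by move=> /(ler_wpM2r (sqr_ge0 t)); lra.
Qed.

Lemma dlogistic_taylor2 x t :
  `|dlogistic (x + t) - (dlogistic x + d2logistic x * t)| <= t ^+ 2 / 8.
Proof.
have [j s j1 _|s s01] := @taylor_lagrange R (fun j => chain j.+2) 1 x t.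
  by apply: is_derive_chain; lia.
rewrite [LHS]/= => ->; rewrite !big_ord_recl big_ord0 /= /bump !leq0n /= !addn0.
rewrite !factS !fact0 expr0 expr1.
set e := (X in `|X|); have -> : e = d3logistic (x + s * t) * t ^+ 2 / 2.
  by rewrite /e; field.
rewrite normrM normrM (ger0_norm (_ : 0 <= 2%:R^-1)) //.
have := d3logistic_bound (x + s * t).
rewrite [`|t ^+ 2|]ger0_norm ?sqr_ge0 //.
by move=> /(ler_wpM2r (sqr_ge0 t)); lra.
Qed.

Lemma logistic_lipschitz x t : `|logistic (x + t) - logistic x| <= `|t| / 4.
Proof.
have [j s j1 _|s s01] := @taylor_lagrange R (fun j => chain j.+1) 0 x t.
  by apply: is_derive_chain; lia.
rewrite [LHS]/= => ->; rewrite !big_ord_recl big_ord0 /= !factE /=.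
rewrite expr0 expr1 mulr1 !divr1 addr0 addrAC subrr add0r.
rewrite normrM (ger0_norm (ltW (dlogistic_gt0 _))).
have := dlogistic_le (x + s * t).
by move=> /(ler_wpM2r (normr_ge0 t)); lra.
Qed.

End LogisticCalculus.

(** * The normal distribution and its heat flow *)

Section NormalCDF.
Context {R : realType}.
Implicit Types x t s : R.

Definition npdf x : R := normal_pdf (0 : R) 1 x.

Let mu := @lebesgue_measure R.

Lemma PhiE : @Phi R = fun x => (\int[mu]_(t in [set` `]-oo, x]]) npdf t)%R.
Proof. by []. Qed.

Lemma is_derive_Phi x : is_derive x 1 (@Phi R) (npdf x).
Proof.
(* The right end [x + 1] only has to lie beyond [x]. *)
have [||||dF eF] := @continuous_FTC1 R npdf -oo%O x (x + 1).
- lra.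
- apply: integrableS (integrable_normal_pdf 0 1) => //=.
- exact: ltNyr.
- exact: (@continuous_normal_pdf R 0 1 (oner_neq0 R)).
by rewrite PhiE; apply: DeriveDef; rewrite -?derive1E.
Qed.

Lemma npdfE x : npdf x = npdf 0 * expR (- (x ^+ 2 / 2)).
Proof.
rewrite /npdf normal_pdfE ?oner_neq0 // /normal_fun !subr0 expr1n.
by rewrite expr0n /= oppr0 mul0r expR0 mulr1 mulNr.
Qed.

Lemma npdf0_gt0 : 0 < npdf 0.
Proof.
rewrite /npdf normal_pdfE ?oner_neq0 // mulr_gt0 ?expR_gt0 //.
by rewrite normal_peak_gt0 ?oner_neq0.
Qed.

Lemma npdf0_le1 : npdf 0 <= 1.
Proof.
rewrite /npdf normal_pdfE ?oner_neq0 // /normal_fun subr0 expr0n /= oppr0 mul0r expR0 mulr1.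
have p0 : 0 < (pi : R) *+ 2 by rewrite pmulrn_lgt0 // pi_gt0.
rewrite /normal_peak expr1n mul1r invf_le1 ?sqrtr_gt0 //.
rewrite -[leLHS]sqrtr1 ler_sqrt; have := @pi_ge2 R; lra.
Qed.

Lemma Phi_ge0 x : 0 <= Phi x.
Proof. by rewrite /Phi fine_ge0. Qed.

Lemma Phi_le1 x : Phi x <= 1.
Proof.
rewrite /Phi -[leRHS]/(fine 1%:E) fine_le ?fin_num_measure //.
exact: probability_le1.
Qed.

Lemma Phi_nondecreasing x t : x <= t -> Phi x <= Phi t.
Proof.
move=> xt; rewrite /Phi fine_le ?fin_num_measure // le_measure ?inE //.
by apply: subitvPr; rewrite bnd_simp.
Qed.

(** Under the normal law the identity is a random variable with distribution function [Phi], so the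
    tails of [Phi] follow from the general limits of distribution functions. *)
Let idTR : measurableTypeR R -> R := idfun.

#[local] HB.instance Definition _ :=
  @isMeasurableFun.Build _ _ _ _ idTR (@measurable_id _ _ setT).

Lemma Phi_tails (e : R) : 0 < e ->
  exists2 K : R, 0 < K & forall t, K <= t -> Phi (- t) <= e /\ 1 - e <= Phi t.
Proof.
move=> e0.
pose X : {RV (normal_prob (0 : R) 1) >-> R} := idTR.
have Phi_cdf t : (Phi t)%:E = cdf X t.
  rewrite /Phi fineK ?fin_num_measure //.
have /fine_cvgP[_ /cvgrPdist_le /(_ e e0) H1] := cvg_cdfy1 X.
have /fine_cvgP[_ /cvgrPdist_le /(_ e e0) H0] := cvg_cdfNy0 X.
move: H1 H0 => [K1 [_ H1]] [K0 [_ H0]].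
exists (1 + `|K1| + `|K0|); first by have := normr_ge0 K1; have := normr_ge0 K0; lra.
move=> t tK; have := normr_ge0 K1; have := normr_ge0 K0.
have := ler_norm K1; have := ler_norm (- K0); rewrite normrN => ? ? ? ?.
have /H1 : K1 < t by lra.
have /H0 : - t < K0 by lra.
by rewrite /comp -!Phi_cdf /= !ler_norml => /andP[? ?] /andP[? ?]; split; lra.
Qed.

(** Up to sign, Hermite polynomials times the density. The last branch is the fourth derivative, the
    highest one used. *)
Definition Phi_deriv (j : nat) (x : R) : R :=
  match j with
  | 0%N => Phi x
  | 1%N => npdf x
  | 2%N => - x * npdf x
  | 3%N => (x ^+ 2 - 1) * npdf x
  | _ => (3 * x - x ^+ 3) * npdf x
  end.

Lemma is_derive_npdf x : is_derive x 1 npdf (- x * npdf x).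
Proof.
have -> : npdf = npdf 0 *: (expR \o (- 2^-1 *: (id ^+ 2))).
  apply/funext => y; rewrite [LHS]npdfE !fctE /GRing.scale /=.
  by congr (_ * expR _); rewrite mulNr mulrC.
have H : is_derive x 1 (- 2^-1 *: (id ^+ 2) : R -> R) (- 2^-1 *: ((2%:R * x ^+ 1) *: 1)).
  exact: (is_deriveZ (- 2^-1) (is_deriveX 2 (is_derive_id x (1 : R)))).
apply: (is_derive_eq (is_deriveZ (npdf 0) (is_derive1_comp (is_derive_expR _) H))).
rewrite !fctE /GRing.scale /=.
rewrite (_ : - 2^-1 * x ^+ 2 = - (x ^+ 2 / 2)); last by rewrite mulNr mulrC.
by rewrite expr1; field.
Qed.

Lemma is_derive_Phi_deriv j x : (j <= 3)%N ->
  is_derive x 1 (Phi_deriv j) (Phi_deriv j.+1 x).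
Proof.
have H := is_derive_npdf x.
case: j => [|[|[|[|//]]]] _.
- exact: is_derive_Phi.
- exact: is_derive_npdf.
- have H2 := is_deriveN (is_derive_id x (1 : R)).
  apply: (is_derive_eq (is_deriveM H2 H)).
  by rewrite !fctE /GRing.scale /=; ring.
- have H2 := is_deriveB (is_deriveX 2 (is_derive_id x (1 : R)))
               (is_derive_cst (1 : R) x (1 : R)).
  apply: (is_derive_eq (is_deriveM H2 H)).
  by rewrite !fctE /GRing.scale /= expr1; ring.
Qed.

Lemma npdf_ge0 x : 0 <= npdf x.
Proof. exact: normal_pdf_ge0. Qed.

(** From [e^(x^2/2) = (e^(x^2/4))^2 >= (1 + x^2/4)^2]. The weight [16 + x ^+ 4] dominates every
    polynomial factor in [Phi_deriv], so one estimate bounds all the derivatives. *)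
Lemma npdf_decay x : (16 + x ^+ 4) * npdf x <= 32.
Proof.
have h1 : 1 + x ^+ 2 / 4 <= expR (x ^+ 2 / 4) by exact: expR_ge1Dx.
have h2 : expR (x ^+ 2 / 2) = expR (x ^+ 2 / 4) ^+ 2.
  by rewrite [RHS]expr2 -expRD; congr expR; field.
have h3 : 0 <= x ^+ 2 by exact: sqr_ge0.
have h4 : 16 + x ^+ 4 <= 16 * expR (x ^+ 2 / 2).
  rewrite h2 (_ : x ^+ 4 = (x ^+ 2) ^+ 2); last by rewrite -exprM.
  nra.
rewrite npdfE expRN mulrA ler_pdivrMr ?expR_gt0 //.
have := npdf0_le1; have := npdf0_gt0; have := expR_gt0 (x ^+ 2 / 2); nra.
Qed.

Lemma Phi_deriv_bound j x : (0 < j)%N -> `|Phi_deriv j x| <= 32.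
Proof.
have key (q : R) : `|q| <= 16 + x ^+ 4 -> `|q * npdf x| <= 32.
  move=> hq; rewrite normrM (ger0_norm (npdf_ge0 x)).
  by apply: le_trans (npdf_decay x); rewrite ler_wpM2r ?npdf_ge0.
have x4 : x ^+ 4 = (x ^+ 2) ^+ 2 by rewrite -exprM.
have x0 := sqr_ge0 x.
have h1 := sqr_ge0 (x ^+ 2 - 1); have h2 := sqr_ge0 (x - 1); have h3 := sqr_ge0 (x + 1).
case: j => [//|[|[|[|j]]]] _ /=.
- by rewrite -[npdf x]mul1r key // normr1 x4; nra.
- by apply: key; rewrite normrN ler_norml x4; apply/andP; split; nra.
- by apply: key; rewrite ler_norml x4; apply/andP; split; nra.
- apply: key; rewrite ler_norml x4 (_ : x ^+ 3 = x * x ^+ 2); last by rewrite -exprS.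
  have := sqr_ge0 (x * (x - 2)); have := sqr_ge0 (x * (x + 2)).
  by move=> h4 h5; apply/andP; split; nra.
Qed.

Lemma Phi_lipschitz x t : `|Phi x - Phi t| <= 32 * `|x - t|.
Proof.
have [j s j0 _|s s01] := @taylor_lagrange R Phi_deriv 0 t (x - t).
  by apply: is_derive_Phi_deriv; lia.
rewrite addrC subrK [LHS]/= => ->; rewrite big_ord_recl big_ord0 /=.
rewrite expr0 expr1 mulr1 !factE !divr1 addr0 addrAC subrr add0r normrM.
by rewrite ler_wpM2r // (Phi_deriv_bound 1).
Qed.

Lemma Phi_taylor3 x t : `|Phi (x + t) -
    (Phi x + npdf x * t + Phi_deriv 2 x * t ^+ 2 / 2)| <= 6 * `|t| ^+ 3.
Proof.
have [j s j0 _|s s01] := @taylor_lagrange R Phi_deriv 2 x t.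
  by apply: is_derive_Phi_deriv; lia.
rewrite [LHS]/= => ->; rewrite !big_ord_recl big_ord0 /= /bump !leq0n /= !addn0 !add1n.
rewrite !factS !fact0 expr0 expr1.
set e := (X in `|X|); have -> : e = Phi_deriv 3 (x + s * t) * t ^+ 3 / 6.
  by rewrite /e /=; field.
have := Phi_deriv_bound 3 (x + s * t) isT; move: (Phi_deriv 3 _) => q.
have t3 : 0 <= `|t| ^+ 3 by rewrite exprn_ge0.
rewrite normrM normrM normrX (ger0_norm (_ : 0 <= 6^-1)) // => /(ler_wpM2r t3); lra.
Qed.

End NormalCDF.

Set Implicit Arguments. Unset Strict Implicit. Unset Printing Implicit Defensive.

Lemma ler_expn_nneg (R : realDomainType) (a b : R) (n : nat) :
  0 <= a -> a <= b -> a ^+ n <= b ^+ n.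
Proof.
by move=> a0 ab; apply: lerXn2r => //; rewrite nnegrE // (le_trans a0).
Qed.

(** * The heat semigroup acting on indicator functions *)

Section HeatFlow.
Context {R : realType}.
Implicit Types w y h t D : R.

(** This is [y^(-1/2)] for positive [y]; the exponential form makes positivity unconditional. *)
Definition isqrt y : R := expR (- (ln y / 2)).

(* [heat y (a - x)] is the heat flow at time [y] of the indicator of
   [x <= a]. *)
Definition heat y w : R := Phi (w * isqrt y).

Lemma isqrt_gt0 y : 0 < isqrt y. Proof. exact: expR_gt0. Qed.

Lemma isqrt_sqr y : 0 < y -> isqrt y ^+ 2 = y^-1.
Proof.
move=> y0; rewrite [LHS]expr2 -expRD -opprD -splitr expRN lnK //.
Qed.

Lemma isqrt_le y h : 0 < y -> y <= h -> isqrt h <= isqrt y.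
Proof.
move=> y0 yh; rewrite ler_expR lerN2 ler_pM2r // ler_ln ?posrE //.
exact: lt_le_trans yh.
Qed.

Lemma isqrt1D_bound t : 0 <= t -> 1 - t <= isqrt (1 + t) <= 1.
Proof.
move=> t0; apply/andP; split.
  have h1 := expR_ge1Dx (- (ln (1 + t) / 2)).
  have h2 : ln (1 + t) <= t by apply: le_ln1Dx; lra.
  by apply: le_trans h1; lra.
have : 0 <= ln (1 + t) by rewrite ln_ge0 //; lra.
by move=> h; rewrite -[leRHS]expR0 ler_expR; lra.
Qed.

Lemma is_derive_isqrt y : 0 < y -> is_derive y 1 isqrt (- (isqrt y ^+ 3 / 2)).
Proof.
move=> y0.
have -> : isqrt = expR \o ((- 2^-1) *: @ln R).
  by apply/funext => z; rewrite /isqrt !fctE /GRing.scale /= mulNr mulrC.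
have H := is_deriveZ (- 2^-1) (is_derive1_ln y0).
apply: (is_derive_eq (is_derive1_comp (is_derive_expR _) H)).
rewrite -isqrt_sqr // /GRing.scale /= -/(isqrt y).
have -> : expR (- 2^-1 * ln y) = isqrt y by rewrite /isqrt mulNr mulrC.
by field.
Qed.

(** By the heat equation each time derivative is half of two space derivatives, whence [Phi_deriv 2]
    and [Phi_deriv 4] with the factors 1/2 and 1/4. *)
Let chain w (j : nat) : R -> R :=
  match j with
  | 0%N => heat ^~ w
  | 1%N => fun y => Phi_deriv 2 (w * isqrt y) * isqrt y ^+ 2 / 2
  | _ => fun y => Phi_deriv 4 (w * isqrt y) * isqrt y ^+ 4 / 4
  end.

Let is_derive_chain w j y : (j <= 1)%N -> 0 < y ->
  is_derive y 1 (chain w j) (chain w j.+1 y).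
Proof.
move=> j1 y0; have H := is_derive_isqrt y0.
have Hw : is_derive y 1 (w *: isqrt) (w *: (- (isqrt y ^+ 3 / 2))) := is_deriveZ w H.
case: j j1 => [|[|//]] _.
  have HP : is_derive ((w *: isqrt) y) 1 (@Phi R) (npdf ((w *: isqrt) y)).
    exact: is_derive_Phi.
  apply: (is_derive_eq (is_derive1_comp HP Hw)).
  by rewrite /= !fctE /GRing.scale /=; field.
have HP : is_derive ((w *: isqrt) y) 1 (@Phi_deriv R 2) (Phi_deriv 3 ((w *: isqrt) y)).
  exact: is_derive_Phi_deriv.
have HC := is_derive1_comp HP Hw.
have -> : chain w 1 = 2^-1 *: ((Phi_deriv 2 \o (w *: isqrt)) * isqrt ^+ 2).
  by apply/funext => z; rewrite /= !fctE /GRing.scale /=; field.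
apply: (is_derive_eq (is_deriveZ 2^-1 (is_deriveM HC (is_deriveX 2 H)))).
by rewrite /= !fctE /GRing.scale /=; field.
Qed.

Lemma heat_time1 y h w : 0 < y -> 0 <= h ->
  `|heat (y + h) w - heat y w| <= 16 * isqrt y ^+ 2 * h.
Proof.
move=> y0 h0.
have pos s : 0 <= s <= 1 -> 0 < y + s * h.
  by move=> /andP[s0 _]; rewrite ltr_wpDr // mulr_ge0.
have [j s j0 s01|s s01] := @taylor_lagrange R (chain w) 0 y h.
  by apply: is_derive_chain; [lia|exact: pos].
rewrite [LHS]/= => ->; rewrite !big_ord_recl big_ord0 /= !fact0.
rewrite expr0 expr1 mulr1 !divr1 addr0 addrAC subrr add0r.
set e := (X in `|X|).
have -> : e = Phi_deriv 2 (w * isqrt (y + s * h)) * isqrt (y + s * h) ^+ 2 * (h / 2).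
  by rewrite /e /=; field.
have /andP[s0 s1] := s01.
have := Phi_deriv_bound 2 (w * isqrt (y + s * h)) isT.
have : isqrt (y + s * h) <= isqrt y.
  by apply: isqrt_le => //; rewrite lerDl mulr_ge0.
have := isqrt_gt0 (y + s * h).
move: (Phi_deriv 2 _) => q {e}.
move: (isqrt (y + _)) (isqrt y) => a b a0 ab hq.
have h2 : 0 <= h / 2 by rewrite divr_ge0.
rewrite normrM normrM (ger0_norm h2) (ger0_norm (sqr_ge0 a)).
have -> : 16 * b ^+ 2 * h = 32 * b ^+ 2 * (h / 2) by field.
apply: ler_wpM2r => //; apply: ler_pM => //; first exact: sqr_ge0.
by apply: ler_expn_nneg => //; exact: ltW.
Qed.

Lemma heat_time2 y h w : 0 < y -> 0 <= h ->
  `|heat (y + h) w - (heat y w + Phi_deriv 2 (w * isqrt y) * isqrt y ^+ 2 / 2 * h)|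
  <= 4 * isqrt y ^+ 4 * h ^+ 2.
Proof.
move=> y0 h0.
have pos s : 0 <= s <= 1 -> 0 < y + s * h.
  by move=> /andP[s0 _]; rewrite ltr_wpDr // mulr_ge0.
have [j s j0 s01|s s01] := @taylor_lagrange R (chain w) 1 y h.
  by apply: is_derive_chain; [lia|exact: pos].
rewrite [LHS]/= => ->; rewrite !big_ord_recl big_ord0 /= /bump !leq0n /= !addn0.
rewrite !factS !fact0 expr0 expr1.
set e := (X in `|X|).
have -> : e = Phi_deriv 4 (w * isqrt (y + s * h)) * isqrt (y + s * h) ^+ 4 * (h ^+ 2 / 8).
  rewrite /e -/(Phi_deriv 4 (w * isqrt (y + s * h))) -/(Phi_deriv 2 (w * isqrt y)).
  by move: (Phi_deriv 4 _) => q4; move: (Phi_deriv 2 _) => q2; field.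
have /andP[s0 s1] := s01.
have := Phi_deriv_bound 4 (w * isqrt (y + s * h)) isT.
have : isqrt (y + s * h) <= isqrt y.
  by apply: isqrt_le => //; rewrite lerDl mulr_ge0.
have := isqrt_gt0 (y + s * h).
move: (Phi_deriv 4 _) => q {e}.
move: (isqrt (y + _)) (isqrt y) => a b a0 ab hq.
have h2 : 0 <= h ^+ 2 / 8 by rewrite divr_ge0 ?sqr_ge0.
have a4 : 0 <= a ^+ 4 by rewrite exprn_ge0 // ltW.
rewrite normrM normrM (ger0_norm h2) (ger0_norm a4).
have -> : 4 * b ^+ 4 * h ^+ 2 = 32 * b ^+ 4 * (h ^+ 2 / 8) by field.
apply: ler_wpM2r => //; apply: ler_pM => //.
by apply: ler_expn_nneg => //; exact: ltW.
Qed.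

Lemma heat_space3 y w D :
  `|heat y (w - D) - (heat y w - npdf (w * isqrt y) * isqrt y * D
      + Phi_deriv 2 (w * isqrt y) * isqrt y ^+ 2 / 2 * D ^+ 2)|
  <= 6 * isqrt y ^+ 3 * `|D| ^+ 3.
Proof.
have := Phi_taylor3 (w * isqrt y) (- D * isqrt y).
rewrite -mulrDl -/(heat y (w - D)) -/(heat y w).
rewrite normrM normrN (ger0_norm (ltW (isqrt_gt0 y))).
have -> : 6 * (`|D| * isqrt y) ^+ 3 = 6 * isqrt y ^+ 3 * `|D| ^+ 3 by ring.
apply: le_trans; rewrite le_eqVlt; apply/orP; left; apply/eqP.
by congr `| _ - _ |; move: (npdf _) (Phi_deriv 2 _) => a b; field.
Qed.

(* The second order terms cancel because [heat] solves the heat equation and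
   the time increment [p (1 - p) t^2] is the conditional variance. *)
Lemma heat_step (th : R) : 0 < th -> exists2 C : R, 0 <= C &
  forall p y w t, 0 <= p <= 1 -> th <= y ->
  `|p * heat y (w - (1 - p) * t) + (1 - p) * heat y (w - (- p) * t)
    - heat (y + p * (1 - p) * t ^+ 2) w|
  <= C * (p * (1 - p) * `|t| ^+ 3 + (p * (1 - p)) ^+ 2 * t ^+ 4).
Proof.
move=> th0; pose S := isqrt th.
have S0 : 0 < S := isqrt_gt0 th.
exists (6 * S ^+ 3 + 4 * S ^+ 4) => [|p y w t /andP[p0 p1] thy].
  by rewrite addr_ge0 // mulr_ge0 // exprn_ge0 // ltW.
have y0 : 0 < y := lt_le_trans th0 thy.
have s0 := isqrt_gt0 y; have sS : isqrt y <= S := isqrt_le th0 thy.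
have v0 : 0 <= p * (1 - p) by rewrite mulr_ge0 // subr_ge0.
have h1 := heat_space3 y w ((1 - p) * t).
have h2 := heat_space3 y w (- p * t).
have h3 := @heat_time2 y (p * (1 - p) * t ^+ 2) w y0 (mulr_ge0 v0 (sqr_ge0 t)).
move: h1 h2 h3.
set A := heat y _; set B := heat y (w - - p * t); set D := heat (y + _) w.
set E := heat y w; set F := npdf _; set G := Phi_deriv 2 _.
set s := isqrt y in s0 sS *.
rewrite !normrM normrN (ger0_norm p0) (ger0_norm (_ : 0 <= 1 - p)) ?subr_ge0 //.
set e1 := (X in `|X| <= _) ; set e2 := (X in _ -> `|X| <= _ -> _).
set e3 := (X in _ -> _ -> `|X| <= _ -> _) => h1 h2 h3.
have -> : p * A + (1 - p) * B - D = p * e1 + (1 - p) * e2 - e3.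
  by rewrite /e1 /e2 /e3; field.
have t3 : 0 <= `|t| ^+ 3 by rewrite exprn_ge0.
have t4 : 0 <= t ^+ 4 by rewrite exprn_even_ge0.
have sS3 : s ^+ 3 <= S ^+ 3 by apply: ler_expn_nneg => //; exact: ltW.
have sS4 : s ^+ 4 <= S ^+ 4 by apply: ler_expn_nneg => //; exact: ltW.
have q0 : 0 <= 1 - p by rewrite subr_ge0.
have S3 : 0 <= S ^+ 3 by rewrite exprn_ge0 // ltW.
have S4 : 0 <= S ^+ 4 by rewrite exprn_ge0 // ltW.
have b1 : `|e1| <= 6 * S ^+ 3 * ((1 - p) * `|t|) ^+ 3.
  apply: le_trans h1 _; apply: ler_wpM2r; first by rewrite exprn_ge0 // mulr_ge0.
  by rewrite ler_wpM2l.
have b2 : `|e2| <= 6 * S ^+ 3 * (p * `|t|) ^+ 3.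
  apply: le_trans h2 _; apply: ler_wpM2r; first by rewrite exprn_ge0 // mulr_ge0.
  by rewrite ler_wpM2l.
have b3 : `|e3| <= 4 * S ^+ 4 * ((p * (1 - p)) ^+ 2 * t ^+ 4).
  apply: le_trans h3 _; rewrite exprMn -exprM; apply: ler_wpM2r.
    by rewrite mulr_ge0 // sqr_ge0.
  by rewrite ler_wpM2l.
apply: le_trans (ler_normB _ _) _.
apply: le_trans (lerD (ler_normD _ _) (lexx _)) _.
rewrite !normrM (ger0_norm p0) (ger0_norm q0).
have c1 := ler_wpM2l p0 b1; have c2 := ler_wpM2l q0 b2.
apply: le_trans (lerD (lerD c1 c2) b3) _.
rewrite !exprMn.
(* The two cubic errors share the factor [p * (1 - p)]: the error of a step is proportional to a
   variance, which allows summation over all steps. *)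
have -> : p * (6 * S ^+ 3 * ((1 - p) ^+ 3 * `|t| ^+ 3)) +
   (1 - p) * (6 * S ^+ 3 * (p ^+ 3 * `|t| ^+ 3)) =
   6 * S ^+ 3 * (p * (1 - p) * `|t| ^+ 3) * ((1 - p) ^+ 2 + p ^+ 2) by ring.
have w1 : (1 - p) ^+ 2 + p ^+ 2 <= 1 by rewrite expr2; nra.
have w0 : 0 <= 6 * S ^+ 3 * (p * (1 - p) * `|t| ^+ 3).
  exact: mulr_ge0 (mulr_ge0 (ler0n _ _) S3) (mulr_ge0 v0 t3).
have w2 := ler_wpM2l w0 w1.
have w3 : 0 <= 6 * S ^+ 3 * (p ^+ 2 * (1 - p) ^+ 2 * t ^+ 4).
  rewrite -exprMn; apply: mulr_ge0 (mulr_ge0 (ler0n _ _) S3) _.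
  exact: mulr_ge0 (sqr_ge0 _) t4.
have w4 : 0 <= 4 * S ^+ 4 * (p * (1 - p) * `|t| ^+ 3).
  exact: mulr_ge0 (mulr_ge0 (ler0n _ _) S4) (mulr_ge0 v0 t3).
by move: w2 w3 w4; rewrite mulr1; lra.
Qed.

End HeatFlow.

(** * Products of Bernoulli measures *)

Lemma ler_of_eq (R : numDomainType) (x y : R) : x = y -> x <= y.
Proof. by move=> ->. Qed.

Section BernoulliProduct.
Context {R : realType} {I : finType}.
Variable p : I -> R.
Hypothesis p01 : forall i, 0 <= p i <= 1.
Local Notation Om := {ffun I -> bool}.
Implicit Types (f g : Om -> R) (w u : Om) (k j : I).

Definition wt w : R := \prod_i (if w i then p i else 1 - p i).
Definition Ex f : R := \sum_w wt w * f w.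
Definition upd k (c : bool) w : Om := [ffun i => if i == k then c else w i].
(** Conditional expectation given the coordinates other than [k], kept as a function of the full
    configuration so that such averages compose. *)
Definition Ek k f w : R := p k * f (upd k true w) + (1 - p k) * f (upd k false w).
Definition dlt k f w : R := f (upd k true w) - f (upd k false w).
Definition bvar k : R := p k * (1 - p k).
Definition ctr k w : R := (w k)%:R - p k.
Definition Pr (E : Om -> Prop) : R := Ex (fun w => `[< E w >]%:R).
Definition indep_of k f := forall w c, f (upd k c w) = f w.

Lemma bvar_ge0 k : 0 <= bvar k.
Proof. by have /andP[? ?] := p01 k; rewrite mulr_ge0 // subr_ge0. Qed.

Lemma bvar_le k : bvar k <= 1 / 4.
Proof. by rewrite /bvar; have := sqr_ge0 (p k - 1 / 2); nra. Qed.

Lemma wt_ge0 w : 0 <= wt w.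
Proof.
rewrite /wt prodr_ge0 // => i _; have /andP[? ?] := p01 i.
by case: ifP => _ //; rewrite subr_ge0.
Qed.

Lemma eq_Ex f g : f =1 g -> Ex f = Ex g.
Proof. by move=> fg; apply: eq_bigr => w _; rewrite fg. Qed.

Lemma ExD f g : Ex (fun w => f w + g w) = Ex f + Ex g.
Proof. by rewrite -big_split; apply: eq_bigr => w _; rewrite mulrDr. Qed.

Lemma ExZ (c : R) f : Ex (fun w => c * f w) = c * Ex f.
Proof. by rewrite mulr_sumr; apply: eq_bigr => w _; rewrite mulrCA. Qed.

Lemma ExB f g : Ex (fun w => f w - g w) = Ex f - Ex g.
Proof.
rewrite -[- Ex g]mulN1r -ExZ -ExD; apply: eq_Ex => w; by rewrite mulN1r.
Qed.

Lemma Ex_sum (J : finType) (P : pred J) (F : J -> Om -> R) :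
  Ex (fun w => \sum_(j | P j) F j w) = \sum_(j | P j) Ex (F j).
Proof.
by rewrite exchange_big; apply: eq_bigr => w _; rewrite mulr_sumr.
Qed.

Lemma Ex_cst (c : R) : Ex (fun=> c) = c.
Proof.
rewrite /Ex -mulr_suml /wt.
rewrite -(bigA_distr_bigA (fun i (b : bool) => if b then p i else 1 - p i)).
by rewrite big1 ?mul1r // => i _; rewrite big_bool /= addrC subrK.
Qed.

Lemma Ex_le f g : (forall w, f w <= g w) -> Ex f <= Ex g.
Proof. by move=> fg; apply: ler_sum => w _; rewrite ler_wpM2l ?wt_ge0. Qed.

Lemma Ex_ge0 f : (forall w, 0 <= f w) -> 0 <= Ex f.
Proof. by move=> f0; rewrite -(Ex_cst 0); exact: Ex_le. Qed.

Lemma Ex_norm f : `|Ex f| <= Ex (fun w => `|f w|).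
Proof.
apply: le_trans (ler_norm_sum _ _ _) _; apply: ler_sum => w _.
by rewrite normrM (ger0_norm (wt_ge0 w)).
Qed.

Lemma upd_eq k c w : upd k c w k = c.
Proof. by rewrite ffunE eqxx. Qed.

Lemma upd_neq k j c w : j != k -> upd k c w j = w j.
Proof. by move=> jk; rewrite ffunE (negbTE jk). Qed.

Lemma upd_id k w : upd k (w k) w = w.
Proof. by apply/ffunP => i; rewrite ffunE; case: eqP => // ->. Qed.

Lemma updK k c d w : upd k c (upd k d w) = upd k c w.
Proof. by apply/ffunP => i; rewrite !ffunE; case: eqP. Qed.

Lemma updC k j c d w : k != j -> upd k c (upd j d w) = upd j d (upd k c w).
Proof.
by move=> kj; apply/ffunP => i; rewrite !ffunE; case: eqP => // ->; rewrite (negbTE kj).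
Qed.

Lemma sum_upd k (F : Om -> R) : \sum_w F w = \sum_(w : Om | w k) (F w + F (upd k false w)).
Proof.
rewrite (bigID (fun w : Om => w k)) /= big_split /=; congr (_ + _).
rewrite (reindex_onto (upd k false) (upd k true)) /=.
  apply: eq_bigl => w; rewrite upd_eq updK /=.
  by apply/eqP/idP => [<-|wk]; rewrite ?upd_eq // -[in LHS]wk upd_id.
by move=> w wk; rewrite updK -(negbTE wk) upd_id.
Qed.

Lemma Ex_Ek k f : Ex (Ek k f) = Ex f.
Proof.
rewrite /Ex (sum_upd k) [RHS](sum_upd k); apply: eq_bigr => w wk.
rewrite /Ek !updK; have wE : upd k true w = w by rewrite -wk upd_id.
rewrite wE.
pose rest := \prod_(i | i != k) (if w i then p i else 1 - p i).
have -> : wt w = p k * rest by rewrite /wt (bigD1 k) //= wk.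
have -> : wt (upd k false w) = (1 - p k) * rest.
  rewrite /wt (bigD1 k) //= upd_eq; congr (_ * _).
  by apply: eq_bigr => i ik; rewrite upd_neq.
by ring.
Qed.

Lemma Ek_indep k f : indep_of k (Ek k f).
Proof. by move=> w c; rewrite /Ek !updK. Qed.

Lemma Ek_indep_other k j f : indep_of j f -> indep_of j (Ek k f).
Proof.
have [->|kj] := eqVneq j k; first by move=> _; exact: Ek_indep.
by move=> fj w c; rewrite /Ek !(updC _ _ _ (_ : k != j)) ?(eq_sym k) // !fj.
Qed.

Lemma ctr_upd k c w : ctr k (upd k c w) = c%:R - p k.
Proof. by rewrite /ctr upd_eq. Qed.

Lemma ctr_indep k j : j != k -> indep_of k (ctr j).
Proof. by move=> jk w c; rewrite /ctr upd_neq. Qed.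

Lemma ctr_bound k w : `|ctr k w| <= 1.
Proof.
have /andP[? ?] := p01 k; rewrite /ctr ler_norml.
by case: (w k) => /=; apply/andP; split; lra.
Qed.

Lemma Ex_ctr0 k g : indep_of k g -> Ex (fun w => ctr k w * g w) = 0.
Proof.
move=> gk; rewrite -(Ex_Ek k) -(Ex_cst 0); apply: eq_Ex => w.
by rewrite /Ek !ctr_upd !gk /=; ring.
Qed.

Lemma Ex_ctr2 k g : indep_of k g ->
  Ex (fun w => ctr k w ^+ 2 * g w) = bvar k * Ex g.
Proof.
move=> gk; rewrite -(Ex_Ek k) -ExZ; apply: eq_Ex => w.
by rewrite /Ek !ctr_upd !gk /bvar /=; ring.
Qed.

(** The variance of a two-point distribution, applied in coordinate [k] with the others fixed. *)
Lemma Ex_sqr_Ek k f :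
  Ex (fun w => f w ^+ 2) = Ex (fun w => Ek k f w ^+ 2) + bvar k * Ex (fun w => dlt k f w ^+ 2).
Proof.
rewrite -(Ex_Ek k) -ExZ -ExD; apply: eq_Ex => w.
by rewrite /Ek /dlt /bvar; ring.
Qed.

Lemma Ex_sqr_Ek_le k f : Ex (fun w => Ek k f w ^+ 2) <= Ex (fun w => f w ^+ 2).
Proof.
rewrite (Ex_sqr_Ek k f) lerDl mulr_ge0 ?bvar_ge0 // Ex_ge0 // => w.
exact: sqr_ge0.
Qed.

Definition avg (l : seq I) f : Om -> R := foldl (fun g k => Ek k g) f l.

Lemma Ex_avg l f : Ex (avg l f) = Ex f.
Proof. by elim: l f => [|k l IHl] f //=; rewrite IHl Ex_Ek. Qed.

Lemma avg_indep l k f : k \in l \/ indep_of k f -> indep_of k (avg l f).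
Proof.
elim: l f => [|j l IHl] f /=; first by case.
rewrite in_cons => -[/orP[/eqP <-|kl]|fk]; apply: IHl.
- by right; exact: Ek_indep.
- by left.
- by right; exact: Ek_indep_other.
Qed.

Lemma indep_const f : (forall k, indep_of k f) -> forall w u, f w = f u.
Proof.
move=> fi w u.
pose S l := foldr (fun k v => upd k (u k) v) w l.
have SE l i : S l i = if i \in l then u i else w i.
  elim: l => [|k l IHl] //=; rewrite ffunE in_cons.
  by case: eqP => [->|_].
have <- : S (enum I) = u by apply/ffunP => i; rewrite SE mem_enum.
by elim: (enum I) => [//|k l IHl] /=; rewrite fi.
Qed.

Lemma avg_enum f w : avg (enum I) f w = Ex f.
Proof.
rewrite -(Ex_avg (enum I)) -[LHS]Ex_cst; apply: eq_Ex => u.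
apply: indep_const => k; apply: avg_indep; left; exact: mem_enum.
Qed.

(** Averaging out the coordinates one after the other, each stage splits off the variance in the
    current coordinate by [Ex_sqr_Ek]. The increment [dlt j] commutes with the averages over other
    coordinates, and these only decrease its second moment. The squared mean is kept because the
    bound is also applied to functions that are not centred. *)
Lemma efron_stein f : Ex (fun w => f w ^+ 2) <=
  Ex f ^+ 2 + \sum_k bvar k * Ex (fun w => dlt k f w ^+ 2).
Proof.
suff H l g : uniq l -> Ex (fun w => g w ^+ 2) <=
    Ex (fun w => avg l g w ^+ 2) + \sum_(k <- l) bvar k * Ex (fun w => dlt k g w ^+ 2).
  apply: le_trans (H (enum I) f (enum_uniq _)) _.
  rewrite big_enum lerD2r; apply: ler_of_eq.
  by rewrite -[RHS]Ex_cst; apply: eq_Ex => w; rewrite avg_enum.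
elim: l g => [|k l IHl] g /=; first by rewrite big_nil addr0.
move=> /andP[kl ul]; rewrite big_cons (Ex_sqr_Ek k g).
rewrite addrCA [leLHS]addrC lerD2l; apply: le_trans (IHl _ ul) _.
rewrite lerD2l big_seq [leRHS]big_seq; apply: ler_sum => j jl.
rewrite ler_wpM2l ?bvar_ge0 //.
have kj : k != j by apply: contraNneq kl => ->.
apply: le_trans (Ex_sqr_Ek_le k _); apply: ler_of_eq; apply: eq_Ex => w; congr (_ ^+ 2).
by rewrite /dlt /Ek !(updC _ _ _ kj); ring.
Qed.

Lemma PrE (E : Om -> Prop) : Pr E = \sum_w wt w * `[< E w >]%:R.
Proof. by []. Qed.

Lemma Pr_le (E F : Om -> Prop) : (forall w, E w -> F w) -> Pr E <= Pr F.
Proof.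
move=> EF; apply: Ex_le => w; rewrite ler_nat.
by case: asboolP => // /EF Fw; case: asboolP.
Qed.

Lemma Pr_or (E F : Om -> Prop) : Pr (fun w => E w \/ F w) <= Pr E + Pr F.
Proof.
rewrite -ExD; apply: Ex_le => w; rewrite -natrD ler_nat.
by case: asboolP => // -[Ew|Fw]; [case: asboolP|case: (asboolP (F w)) => //; rewrite addn1].
Qed.

Lemma Pr_not (E : Om -> Prop) : Pr (fun w => ~ E w) = 1 - Pr E.
Proof.
rewrite -(Ex_cst 1) -ExB; apply: eq_Ex => w.
by case: (asboolP (E w)) => Ew; case: asboolP => // nE; rewrite ?subr0 ?subrr //; case: nE.
Qed.

Lemma Pr_ge0 (E : Om -> Prop) : 0 <= Pr E.
Proof. by apply: Ex_ge0 => w; rewrite ler0n. Qed.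

Lemma Pr_le1 (E : Om -> Prop) : Pr E <= 1.
Proof. by rewrite -subr_ge0 -Pr_not Pr_ge0. Qed.

Lemma markov f (c : R) : (forall w, 0 <= f w) -> 0 < c ->
  Pr (fun w => c < f w) <= Ex f / c.
Proof.
move=> f0 c0; rewrite ler_pdivlMr // mulrC -ExZ; apply: Ex_le => w.
by case: asboolP => [/ltW|_]; rewrite ?mulr1 ?mulr0.
Qed.

End BernoulliProduct.

(** * A central limit theorem for quadratic forms *)

Section QuadraticForm.
Context {R : realType} {I : finType}.
Variables (p : I -> R) (a : I -> I -> R).
Hypothesis p01 : forall i, 0 <= p i <= 1.
Hypothesis a_ge0 : forall k l, 0 <= a k l.
Hypothesis a_sym : forall k l, a k l = a l k.
Local Notation Om := {ffun I -> bool}.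
Local Notation Ex := (Ex p).
Local Notation X := (ctr p).
Local Notation v := (bvar p).
Implicit Types (w : Om) (k l m : I).

Let v0 k : 0 <= v k := bvar_ge0 p01 k.
Let v1 k : v k <= 1.
Proof. by have := bvar_le p k; lra. Qed.

Lemma Ex_lin (c : I -> R) : Ex (fun w => \sum_l c l * X l w) = 0.
Proof.
rewrite Ex_sum big1 // => l _; rewrite ExZ.
have := @Ex_ctr0 _ _ p l (fun=> 1) (fun _ _ => erefl).
by under eq_Ex do rewrite mulr1; move=> ->; rewrite mulr0.
Qed.

Lemma Ex_lin2 (c : I -> R) :
  Ex (fun w => (\sum_l c l * X l w) ^+ 2) = \sum_l c l ^+ 2 * v l.
Proof.
under eq_Ex do rewrite expr2 mulr_suml.
rewrite Ex_sum; apply: eq_bigr => l _.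
transitivity (Ex (fun w => c l ^+ 2 * (X l w ^+ 2 * 1)
   + X l w * (c l * (\sum_(m | m != l) c m * X m w)))).
  by apply: eq_Ex => w; rewrite (bigD1 l) //=; ring.
rewrite ExD ExZ Ex_ctr2 // Ex_cst mulr1 Ex_ctr0 ?addr0 // => w c'.
by congr (_ * _); apply: eq_bigr => m ml; rewrite ctr_indep.
Qed.

Lemma lin_upd (c : I -> R) l (x : bool) w :
  \sum_k c k * X k (upd l x w) = \sum_k c k * X k w + c l * (x%:R - (w l)%:R).
Proof.
rewrite (bigD1 l) //= [in RHS](bigD1 l) //=.
rewrite (eq_bigr (fun m => c m * X m w)).
  by move: (\sum_(i | _) _) => S; rewrite /ctr upd_eq; ring.
by move=> m ml; rewrite ctr_indep.
Qed.

(** Expanding around coordinate [l], terms of first degree in [X l] vanish, and so does the one with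
    [X l ^+ 2 * L], the rest [L] being centred; only cubes of single coordinates remain. Hence no
    power 3/2 of the variance appears. *)
Lemma Ex_lin3 (c : I -> R) :
  `|Ex (fun w => (\sum_l c l * X l w) ^+ 3)| <= \sum_l `|c l| ^+ 3.
Proof.
under eq_Ex do rewrite exprS mulr_suml.
rewrite Ex_sum; apply: le_trans (ler_norm_sum _ _ _) _; apply: ler_sum => l _.
pose L w := \sum_(m | m != l) c m * X m w.
have Li : indep_of l L.
  by move=> w x; apply: eq_bigr => m ml; rewrite ctr_indep.
have -> : Ex (fun w => c l * X l w * (\sum_m c m * X m w) ^+ 2) =
    c l ^+ 3 * Ex (fun w => X l w ^+ 3).
  transitivity (Ex (fun w => X l w * (c l * L w ^+ 2) +
     ((2 * c l ^+ 2) * (X l w ^+ 2 * L w) + c l ^+ 3 * X l w ^+ 3))).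
    apply: eq_Ex => w; rewrite (bigD1 l) //= -/(L w); ring.
  rewrite ExD Ex_ctr0 => [|w x]; last by rewrite Li.
  rewrite add0r ExD !ExZ Ex_ctr2 //.
  have -> : Ex L = 0.
    rewrite -(Ex_lin (fun m => if m != l then c m else 0)); apply: eq_Ex => w.
    rewrite /L big_mkcond; apply: eq_bigr => m _; case: ifP => _ //; by rewrite mul0r.
  by rewrite !mulr0 add0r.
rewrite normrM normrX ler_piMr ?exprn_ge0 //.
apply: le_trans (Ex_norm p01 _) _; rewrite -[leRHS](Ex_cst p); apply: Ex_le => // w.
by rewrite normrX exprn_ile1 // ctr_bound.
Qed.

Lemma Ex_lin2_le (c : I -> R) :
  Ex (fun w => (\sum_l c l * X l w) ^+ 2) <= \sum_l c l ^+ 2.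
Proof.
by rewrite Ex_lin2; apply: ler_sum => l _; rewrite ler_piMr ?sqr_ge0.
Qed.

(** Efron-Stein for the square of the linear form [L]: its increment in coordinate [l] is
    [c l * (2 * L + c l)] or [c l * (2 * L - c l)]. In the constant, 1 comes from the squared mean
    and 8 + 2 from squaring the increments. *)
Lemma Ex_lin4 (c : I -> R) :
  Ex (fun w => (\sum_l c l * X l w) ^+ 4) <= 11 * (\sum_l c l ^+ 2) ^+ 2.
Proof.
set G := \sum_l c l ^+ 2; pose L w := \sum_l c l * X l w.
have E2 : Ex (fun w => L w ^+ 2) <= G by exact: Ex_lin2_le.
have E0 : 0 <= Ex (fun w => L w ^+ 2) by apply: Ex_ge0 => // w; exact: sqr_ge0.
have := efron_stein p01 (fun w => L w ^+ 2).
under eq_Ex do rewrite -exprM.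
move=> /le_trans; apply.
have h1 : Ex (fun w => L w ^+ 2) ^+ 2 <= G ^+ 2 by exact: ler_expn_nneg.
have h2 : \sum_l v l * Ex (fun w => dlt l (fun w => L w ^+ 2) w ^+ 2)
   <= \sum_l c l ^+ 2 * (10 * G).
  apply: ler_sum => l _.
  have ag : c l ^+ 2 <= G.
    by rewrite /G (bigD1 l) //= lerDl sumr_ge0 // => m _; exact: sqr_ge0.
  have h3 : Ex (fun w => dlt l (fun w => L w ^+ 2) w ^+ 2) <= c l ^+ 2 * (10 * G).
    have : Ex (fun w => dlt l (fun w => L w ^+ 2) w ^+ 2) <=
       Ex (fun w => c l ^+ 2 * (8 * L w ^+ 2 + 2 * c l ^+ 2)).
      apply: Ex_le => // w.
      have -> : dlt l (fun w => L w ^+ 2) w =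
          c l * (2 * L w + c l * (1 - 2 * (w l)%:R)).
        by rewrite /dlt /L !lin_upd /=; ring.
      rewrite exprMn ler_wpM2l ?sqr_ge0 //.
      case: (w l) => /=; rewrite ?mulr1 ?mulr0 ?subr0.
        by have := sqr_ge0 (2 * L w + c l); nra.
      by have := sqr_ge0 (2 * L w - c l); nra.
    move=> /le_trans; apply; rewrite ExZ ExD ExZ Ex_cst.
    by apply: ler_wpM2l; [exact: sqr_ge0|lra].
  have h4 : 0 <= Ex (fun w => dlt l (fun w => L w ^+ 2) w ^+ 2).
    by apply: Ex_ge0 => // w; exact: sqr_ge0.
  exact: le_trans (ler_piMl h4 (v1 l)) h3.
rewrite -mulr_suml -/G in h2.
lra.
Qed.

(** An arbitrary linear order on the coordinates; revealing them in this order gives the filtration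
    of the martingale. *)
Definition rk k : nat := enum_rank k.

Lemma rk_inj : injective rk.
Proof. by move=> k l /val_inj /enum_rank_inj. Qed.

Definition gram l m : R := \sum_k a k l * a k m.
(** For symmetric [a] this is [tr A^4], the squared Hilbert-Schmidt norm of [A^2]. *)
Definition tr4 : R := \sum_l \sum_m gram l m ^+ 2.
(** The predictable coefficient: the martingale increment at [k] is [X k * part k], and [part k]
    depends only on coordinates revealed before [k]. Accordingly [cvar] is the total conditional
    variance and [s2] its expectation. *)
Definition part k w : R := \sum_(l | (rk l < rk k)%N) a k l * X l w.
Definition s2 : R := \sum_k v k * (\sum_(l | (rk l < rk k)%N) a k l ^+ 2 * v l).
Definition qform w : R := \sum_k X k w * part k w.
Definition cvar w : R := \sum_k v k * part k w ^+ 2.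

Lemma gram_ge0 l m : 0 <= gram l m.
Proof. by apply: sumr_ge0 => k _; rewrite mulr_ge0. Qed.

Lemma gram_row l : 0 <= \sum_m gram l m ^+ 2.
Proof. by apply: sumr_ge0 => m _; rewrite sqr_ge0. Qed.

Lemma gram_diag_le l : gram l l ^+ 2 <= \sum_m gram l m ^+ 2.
Proof. by rewrite (bigD1 l) //= lerDl sumr_ge0 // => m _; rewrite sqr_ge0. Qed.

Lemma partE k w : part k w = \sum_l (if (rk l < rk k)%N then a k l else 0) * X l w.
Proof.
rewrite /part big_mkcond; apply: eq_bigr => l _.
by case: ifP => _ //; rewrite mul0r.
Qed.

Lemma Ex_part2 k :
  Ex (fun w => part k w ^+ 2) = \sum_(l | (rk l < rk k)%N) a k l ^+ 2 * v l.
Proof.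
under eq_Ex do rewrite partE.
rewrite Ex_lin2 [RHS]big_mkcond; apply: eq_bigr => l _.
by case: ifP => _ //; rewrite expr0n mul0r.
Qed.

Lemma Ex_cvar : Ex cvar = s2.
Proof.
by rewrite Ex_sum; apply: eq_bigr => k _; rewrite ExZ Ex_part2.
Qed.

Lemma part_upd k l c w : part k (upd l c w) =
  part k w + (if (rk l < rk k)%N then a k l else 0) * (c%:R - (w l)%:R).
Proof.
rewrite !partE (bigD1 l) //= [in RHS](bigD1 l) //=.
rewrite (eq_bigr (fun m => (if (rk m < rk k)%N then a k m else 0) * X m w)).
  by move: (\sum_(i | _) _) => S; rewrite /ctr upd_eq; ring.
by move=> m ml; rewrite ctr_indep.
Qed.

Lemma part_indep k l : (rk k <= rk l)%N -> indep_of l (part k).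
Proof. by move=> kl w c; rewrite part_upd ltnNge kl mul0r addr0. Qed.

Lemma dlt_part2 k l w : dlt l (fun w => part k w ^+ 2) w =
  (if (rk l < rk k)%N then a k l else 0) *
  (2 * part k w + (if (rk l < rk k)%N then a k l else 0) * (1 - 2 * (w l)%:R)).
Proof. by rewrite /dlt !part_upd /=; ring. Qed.

Lemma Ex_part4_le k : Ex (fun w => part k w ^+ 4) <= 11 * gram k k ^+ 2.
Proof.
under eq_Ex do rewrite partE.
apply: le_trans (Ex_lin4 _) _; rewrite ler_wpM2l // ler_expn_nneg //.
  by apply: sumr_ge0 => l _; exact: sqr_ge0.
apply: ler_sum => l _; rewrite [a l k]a_sym -expr2.
by case: ifP => _ //; rewrite expr0n sqr_ge0.
Qed.

Lemma sum_rank_pairs (G : I -> I -> R) : (forall k l, G k l = G l k) ->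
  \sum_k \sum_(l | l != k) G k l = 2 * \sum_k \sum_(l | (rk l < rk k)%N) G k l.
Proof.
move=> Gs; rewrite mulr_natl mulr2n.
rewrite [X in _ = _ + X](exchange_big_dep xpredT) //= -big_split /=.
apply: eq_bigr => k _; rewrite (bigID (fun l => (rk l < rk k)%N)) /=; congr (_ + _).
  apply: eq_bigl => l; have [->|] := eqVneq l k; rewrite ?ltnn //.
apply: eq_big => [l|l _]; last exact: Gs.
have [->|lk] := eqVneq l k; rewrite ?ltnn // -leqNgt leq_eqVlt.
case: eqP => // /rk_inj e; by rewrite e eqxx in lk.
Qed.

Lemma qformE w : 2 * qform w = \sum_k \sum_(l | l != k) a k l * X k w * X l w.
Proof.
rewrite sum_rank_pairs => [|k l]; last by rewrite a_sym; ring.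
congr (_ * _); apply: eq_bigr => k _; rewrite /part mulr_sumr.
by apply: eq_bigr => l _; ring.
Qed.

Lemma s2E : 2 * s2 = \sum_k \sum_(l | l != k) a k l ^+ 2 * v k * v l.
Proof.
rewrite sum_rank_pairs => [|k l]; last by rewrite a_sym; ring.
congr (_ * _); apply: eq_bigr => k _; rewrite mulr_sumr.
by apply: eq_bigr => l _; ring.
Qed.

(** By Efron-Stein: the increment of [cvar] in coordinate [l] is a linear form with coefficients
    [2 * c m], plus a constant equal to [d] up to sign. As [a] has nonnegative entries, the
    restricted sums [c m] and [d] are at most the full entries [gram l m] and [gram l l], whose
    squares are summed in [tr4]. *)
Lemma cvar_variance : Ex (fun w => (cvar w - s2) ^+ 2) <= 10 * tr4.
Proof.
have := efron_stein p01 (fun w => cvar w - s2).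
rewrite ExB Ex_cst Ex_cvar subrr expr0n add0r => /le_trans; apply.
rewrite /tr4 mulr_sumr; apply: ler_sum => l _.
pose c m := \sum_(k | (rk l < rk k)%N && (rk m < rk k)%N) v k * (a k l * a k m).
pose d := \sum_(k | (rk l < rk k)%N) v k * a k l ^+ 2.
have c0 m : 0 <= c m by apply: sumr_ge0 => k _; rewrite mulr_ge0 // mulr_ge0.
have cg m : c m <= gram l m.
  rewrite /c big_mkcond; apply: ler_sum => k _; case: ifP => _.
    by rewrite ler_piMl ?mulr_ge0.
  by rewrite mulr_ge0.
have d0 : 0 <= d by apply: sumr_ge0 => k _; rewrite mulr_ge0 // sqr_ge0.
have dg : d <= gram l l.
  rewrite /d big_mkcond; apply: ler_sum => k _; case: ifP => _.
    by rewrite expr2 ler_piMl ?mulr_ge0.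
  by rewrite mulr_ge0.
have dE w : dlt l (fun w => cvar w - s2) w =
    2 * (\sum_m c m * X m w) + (1 - 2 * (w l)%:R) * d.
  have -> : dlt l (fun w => cvar w - s2) w =
      \sum_k v k * dlt l (fun w => part k w ^+ 2) w.
    rewrite /dlt /cvar opprB addrA subrK -sumrB.
    by apply: eq_bigr => k _; rewrite mulrBr.
  have -> : \sum_m c m * X m w = \sum_(k | (rk l < rk k)%N) v k * a k l * part k w.
    under eq_bigr do rewrite /c mulr_suml.
    rewrite (exchange_big_dep (fun k => (rk l < rk k)%N)) /=; last first.
      by move=> m k _ /andP[].
    apply: eq_bigr => k lk; rewrite /part mulr_sumr.
    by apply: eq_big => [m|m _]; rewrite ?lk //; ring.
  rewrite /d !mulr_sumr -big_split [RHS]big_mkcond /=; apply: eq_bigr => k _.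
  by rewrite dlt_part2; case: ifP => _; ring.
have h4 : 0 <= Ex (fun w => dlt l (fun w => cvar w - s2) w ^+ 2).
  by apply: Ex_ge0 => // w; exact: sqr_ge0.
apply: le_trans (ler_piMl h4 (v1 l)) _.
have : Ex (fun w => dlt l (fun w => cvar w - s2) w ^+ 2) <=
    Ex (fun w => 8 * (\sum_m c m * X m w) ^+ 2 + 2 * d ^+ 2).
  apply: Ex_le => // w; rewrite dE; move: (\sum_m _) => x.
  case: (w l) => /=; rewrite ?mulr1 ?mulr0 ?subr0.
    by have := sqr_ge0 (2 * x + d); nra.
  by have := sqr_ge0 (2 * x - d); nra.
move=> /le_trans; apply; rewrite ExD ExZ Ex_cst Ex_lin2.
have h1 : \sum_m c m ^+ 2 * v m <= \sum_m gram l m ^+ 2.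
  apply: ler_sum => m _; apply: le_trans (ler_expn_nneg 2 (c0 m) (cg m)).
  by rewrite ler_piMr // sqr_ge0.
have h2 := ler_expn_nneg 2 d0 dg; have h3 := gram_diag_le l.
lra.
Qed.

Lemma sum_gram_diag_le : \sum_k gram k k ^+ 2 <= tr4.
Proof. by apply: ler_sum => k _; exact: gram_diag_le. Qed.

Lemma tr4_ge0 : 0 <= tr4.
Proof. by apply: sumr_ge0 => l _; exact: gram_row. Qed.

(** Third moments are interpolated by [t^3 <= al * t^2 / 2 + t^4 / (2 * al)]; the second moments sum
    to [s2] and the fourth ones to at most [11 * tr4]. The free parameter [al] avoids a square root
    of [tr4], and 17 rounds up [11 * 3 / 2]. *)
Lemma sum_moments_le (al : R) : 0 < al <= 1 ->
  \sum_k Ex (fun w => v k * `|part k w| ^+ 3 + v k ^+ 2 * part k w ^+ 4)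
  <= al * s2 + 17 * tr4 / al.
Proof.
move=> /andP[al0 al1].
have key k : Ex (fun w => v k * `|part k w| ^+ 3 + v k ^+ 2 * part k w ^+ 4) <=
   al / 2 * (v k * Ex (fun w => part k w ^+ 2)) + 3 / 2 / al * (11 * gram k k ^+ 2).
  have h1 : Ex (fun w => v k * `|part k w| ^+ 3 + v k ^+ 2 * part k w ^+ 4) <=
    Ex (fun w => al / 2 * v k * part k w ^+ 2 + 3 / 2 / al * part k w ^+ 4).
    apply: Ex_le => // w.
    have <- : `|part k w| ^+ 2 = part k w ^+ 2 by rewrite real_normK ?num_real.
    have <- : `|part k w| ^+ 4 = part k w ^+ 4.
      by rewrite (exprM _ 2 2) real_normK ?num_real // -exprM.
    have := normr_ge0 (part k w); move: (`|_|) => t t0.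
    have t3 : t ^+ 3 <= al / 2 * t ^+ 2 + 1 / 2 / al * t ^+ 4.
      have : 0 <= t ^+ 2 * (al - t) ^+ 2 / (2 * al).
        by apply: divr_ge0; [exact: mulr_ge0 (sqr_ge0 _) (sqr_ge0 _)|lra].
      have -> : t ^+ 2 * (al - t) ^+ 2 / (2 * al) =
          al / 2 * t ^+ 2 + 1 / 2 / al * t ^+ 4 - t ^+ 3.
        by field; rewrite gt_eqF.
      lra.
    have t4 : 0 <= t ^+ 4 by rewrite exprn_ge0.
    have b1 := ler_wpM2l (v0 k) t3.
    have ali : 1 <= al^-1 by rewrite invf_ge1.
    have q0 : 0 <= 1 / 2 / al * t ^+ 4 by rewrite mulr_ge0 // divr_ge0 // ltW.
    have b2 : v k * (1 / 2 / al * t ^+ 4) <= 1 / 2 / al * t ^+ 4 by rewrite ler_piMl.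
    have b3 : v k ^+ 2 * t ^+ 4 <= al^-1 * t ^+ 4.
      rewrite ler_wpM2r //; apply: le_trans ali.
      by rewrite exprn_ile1.
    move: b1 b2 b3; move: (al^-1) (v k) (t ^+ 3) (t ^+ 4) (t ^+ 2) => i x y z u; lra.
  apply: le_trans h1 _; rewrite ExD !ExZ.
  have c0 : 0 <= 3 / 2 / al by rewrite divr_ge0 // ltW.
  by rewrite -[al / 2 * v k * _]mulrA lerD2l; exact: ler_wpM2l c0 _ _ (Ex_part4_le k).
apply: le_trans (ler_sum _ (fun k _ => key k)) _.
rewrite big_split /= -!mulr_sumr -Ex_cvar Ex_sum.
have -> : \sum_k v k * Ex (fun w => part k w ^+ 2) =
          \sum_k Ex (fun w => v k * part k w ^+ 2).
  by apply: eq_bigr => k _; rewrite ExZ.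
set S := \sum_k Ex _.
have S0 : 0 <= S.
  apply: sumr_ge0 => k _; apply: Ex_ge0 => // w.
  by rewrite mulr_ge0 // sqr_ge0.
have c0 : 0 <= al^-1 by rewrite invr_ge0 ltW.
have t0 := tr4_ge0.
have h := ler_wpM2l c0 sum_gram_diag_le.
have h' := mulr_ge0 c0 t0.
have h'' := mulr_ge0 (ltW al0) S0.
move: h h' h''; rewrite [17 * _ / al]mulrC; lra.
Qed.

End QuadraticForm.

(** * The stopped martingale compared with the heat flow *)

Section StoppedMartingale.
Context {R : realType} {I : finType}.
Variables (p : I -> R) (a : I -> I -> R).
Hypothesis p01 : forall i, 0 <= p i <= 1.
Hypothesis a_ge0 : forall k l, 0 <= a k l.
Hypothesis a_sym : forall k l, a k l = a l k.
Variables (th x0 C : R).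
Hypothesis th0 : 0 < th.
Hypothesis C0 : 0 <= C.
Hypothesis stepC : forall q y z t : R, 0 <= q <= 1 -> th / 2 <= y ->
  `|q * heat y (z - (1 - q) * t) + (1 - q) * heat y (z - (- q) * t)
    - heat (y + q * (1 - q) * t ^+ 2) z|
  <= C * (q * (1 - q) * `|t| ^+ 3 + (q * (1 - q)) ^+ 2 * t ^+ 4).
Local Notation Om := {ffun I -> bool}.
Local Notation Ex := (Ex p).
Local Notation X := (ctr p).
Local Notation v := (bvar p).
Local Notation part := (part p a).
Implicit Types (w : Om) (k l j : I) (m : nat).

Let v0 k : 0 <= v k := bvar_ge0 p01 k.

(* The martingale is frozen once its conditional variance would exceed
   [1 + th / 2], so that the remaining time [th + 1 - V] stays positive. *)
Definition alive k w : bool :=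
  \sum_(j | (rk j <= rk k)%N) v j * part j w ^+ 2 <= 1 + th / 2.
Definition Vst m w : R :=
  \sum_(k | (rk k < m)%N) (alive k w)%:R * (v k * part k w ^+ 2).
Definition Wst m w : R :=
  \sum_(k | (rk k < m)%N) (alive k w)%:R * (X k w * part k w).
(** Interpolates between the Gaussian and the quadratic form: [m = 0] gives [heat (th + 1) x0], and
    if nothing is frozen and the conditional variance is 1, the last value is
    [heat th (x0 - qform p a w)]. The extra time [th] keeps the flow smooth up to the end. *)
Definition Yst m w : R := heat (th + 1 - Vst m w) (x0 - Wst m w).

Lemma sum_rkS k (F : I -> R) : \sum_(j | (rk j < (rk k).+1)%N) F j =
  \sum_(j | (rk j < rk k)%N) F j + F k.
Proof.
rewrite (bigD1 k) //= addrC; congr (_ + _); apply: eq_bigl => j.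
rewrite ltnS leq_eqVlt; have [->|jk] := eqVneq j k; first by rewrite andbF ltnn.
rewrite andbT; case: eqP => // /rk_inj e; by rewrite e eqxx in jk.
Qed.

Lemma alive_indep k l : (rk k <= rk l)%N -> forall w c, alive k (upd l c w) = alive k w.
Proof.
move=> kl w c; rewrite /alive; congr (_ <= _); apply: eq_bigr => j jk.
by rewrite (part_indep p a (leq_trans jk kl)).
Qed.

Lemma Vst_indep k : indep_of k (Vst (rk k).+1).
Proof.
move=> w c; apply: eq_bigr => j; rewrite ltnS => jk.
by rewrite alive_indep // (part_indep p a jk).
Qed.

Lemma Wst_indep k : indep_of k (Wst (rk k)).
Proof.
move=> w c; apply: eq_bigr => j jk.
rewrite alive_indep ?(ltnW jk) // (part_indep p a (ltnW jk)) ctr_indep //.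
by apply: contraTneq jk => ->; rewrite ltnn.
Qed.

Lemma VstS k w : Vst (rk k).+1 w =
  Vst (rk k) w + (alive k w)%:R * (v k * part k w ^+ 2).
Proof. exact: sum_rkS. Qed.

Lemma WstS k w : Wst (rk k).+1 w =
  Wst (rk k) w + (alive k w)%:R * (X k w * part k w).
Proof. exact: sum_rkS. Qed.

Lemma Vst_le m w : (m <= #|I|)%N -> Vst m w <= 1 + th / 2.
Proof.
elim: m => [_|m IHm mI].
  have h : 0 <= 1 + th / 2 by move: th0; lra.
  by rewrite /Vst big_pred0.
pose k : I := enum_val (Ordinal mI).
have kE : rk k = m by rewrite /rk enum_valK.
rewrite -kE VstS kE; case: (boolP (alive k w)) => [al|_]; last first.
  by rewrite mul0r addr0 IHm // ltnW.
apply: le_trans al; rewrite mul1r -kE.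
under [leRHS]eq_bigl do rewrite -ltnS.
rewrite sum_rkS lerD2r; apply: ler_sum => j _.
by case: (alive j w); rewrite ?mul1r // mul0r mulr_ge0 // sqr_ge0.
Qed.

(** Apart from the factor [X k], everything in [Yst (rk k).+1] is known before coordinate [k] is
    revealed. Averaging over that coordinate is therefore one instance of [heat_step], whose time
    increment is the growth of [Vst]. *)
Lemma Yst_step k : `|Ex (Yst (rk k).+1) - Ex (Yst (rk k))| <=
  C * Ex (fun w => v k * `|part k w| ^+ 3 + v k ^+ 2 * part k w ^+ 4).
Proof.
have -> : Ex (Yst (rk k).+1) - Ex (Yst (rk k)) =
    Ex (fun w => Ek p k (Yst (rk k).+1) w - Yst (rk k) w) by rewrite ExB Ex_Ek.
rewrite -[leRHS]ExZ.
apply: le_trans (Ex_norm p01 _) _; apply: Ex_le => // w.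
pose t := (alive k w)%:R * part k w.
have yge : th / 2 <= th + 1 - Vst (rk k).+1 w.
  by have := @Vst_le (rk k).+1 w (ltn_ord _); lra.
have := stepC (x0 - Wst (rk k) w) t (p01 k) yge.
have -> : th + 1 - Vst (rk k).+1 w + p k * (1 - p k) * t ^+ 2 = th + 1 - Vst (rk k) w.
  rewrite VstS /t exprMn -natrX -/(v k).
  have -> : (alive k w ^ 2 = alive k w)%N by case: (alive k w).
  by ring.
have WE c : Wst (rk k).+1 (upd k c w) = Wst (rk k) w + (c%:R - p k) * t.
  rewrite WstS Wst_indep alive_indep // (part_indep p a (leqnn _)) ctr_upd /t.
  by ring.
have YE c : Yst (rk k).+1 (upd k c w) =
    heat (th + 1 - Vst (rk k).+1 w) (x0 - Wst (rk k) w - (c%:R - p k) * t).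
  by rewrite /Yst Vst_indep WE opprD addrA.
rewrite /Ek !YE /= sub0r -/(Yst (rk k) w) => /le_trans; apply.
rewrite -/(v k); apply: ler_wpM2l => //.
rewrite /t; case: (alive k w); rewrite ?mul1r // mul0r normr0 !expr0n /= !mulr0 addr0.
have t4 : 0 <= part k w ^+ 4 by rewrite exprn_even_ge0.
by rewrite addr_ge0 // mulr_ge0 // ?exprn_ge0.
Qed.

Lemma Yst_total : `|Ex (Yst #|I|) - heat (th + 1) x0| <=
  C * \sum_k Ex (fun w => v k * `|part k w| ^+ 3 + v k ^+ 2 * part k w ^+ 4).
Proof.
pose M k := Ex (fun w => v k * `|part k w| ^+ 3 + v k ^+ 2 * part k w ^+ 4).
suff H m : (m <= #|I|)%N -> `|Ex (Yst m) - heat (th + 1) x0| <=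
    C * \sum_(k | (rk k < m)%N) M k.
  apply: le_trans (H _ (leqnn _)) _; rewrite ler_wpM2l //; apply: ler_of_eq.
  by apply: eq_bigl => k; rewrite ltn_ord.
elim: m => [_|m IHm mI].
  rewrite big_pred0 // mulr0 -[heat _ _](Ex_cst p) -ExB.
  rewrite (@eq_Ex _ _ p _ (fun=> 0)) ?Ex_cst ?normr0 // => w.
  by rewrite /Yst /Vst /Wst !big_pred0 // !subr0 subrr.
pose k : I := enum_val (Ordinal mI).
have kE : rk k = m by rewrite /rk enum_valK.
rewrite -kE sum_rkS kE mulrDr [leRHS]addrC.
have := Yst_step k; rewrite kE -/(M k) => h1.
have := IHm (ltnW mI) => h2.
apply: le_trans (ler_distD (Ex (Yst m)) _ _) _; exact: lerD.
Qed.

Lemma heat_bound (y z : R) : 0 <= heat y z <= 1.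
Proof. by rewrite Phi_ge0 Phi_le1. Qed.

(** If [cvar] exceeds [1 + th / 2], the trivial bound 1 on a difference of values of [heat] is at
    most [2 / th] times the excess over 1. Otherwise nothing is frozen, the two times differ by
    [cvar - 1] and both are at least [th / 2], where [heat_time1] has rate at most [32 / th]. *)
Lemma Yst_end w : `|heat th (x0 - qform p a w) - Yst #|I| w| <=
  32 / th * `|cvar p a w - 1|.
Proof.
have th_gt0 := th0; have th20 : 0 < th / 2 by lra.
have [Vle|Vgt] := leP (cvar p a w) (1 + th / 2); last first.
  have /andP[h1 h2] := heat_bound th (x0 - qform p a w).
  have /andP[h3 h4] := heat_bound (th + 1 - Vst #|I| w) (x0 - Wst #|I| w).
  move: h1 h2 h3 h4 Vgt; rewrite /Yst.
  move: (heat _ _) (heat (th + 1 - _) _) (cvar p a w) => h h' V h1 h2 h3 h4 Vgt.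
  have V1 : 0 <= V - 1 by lra.
  rewrite (ger0_norm V1); apply: (@le_trans _ _ 1).
    by rewrite ler_norml; apply/andP; split; lra.
  by rewrite mulrAC ler_pdivlMr // mul1r; lra.
have al k : alive k w.
  apply: le_trans Vle; rewrite big_mkcond; apply: ler_sum => j _.
  by case: ifP => _ //; rewrite mulr_ge0 // sqr_ge0.
have VE : Vst #|I| w = cvar p a w.
  by apply: eq_big => [k|k _]; rewrite ?ltn_ord // al mul1r.
have WE : Wst #|I| w = qform p a w.
  by apply: eq_big => [k|k _]; rewrite ?ltn_ord // al mul1r.
rewrite /Yst VE WE.
move: (cvar p a w) (x0 - _) Vle => V z Vle.
have I2 y : th / 2 <= y -> 16 * isqrt y ^+ 2 <= 32 / th.
  move=> y2; have y0 : 0 < y by lra.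
  rewrite isqrt_sqr // ler_pdivrMr // mulrAC ler_pdivlMr //; lra.
have [V1|V1] := leP V 1.
  have h := @heat_time1 _ th (1 - V) z th0 ltac:(lra).
  have e : th + (1 - V) = th + 1 - V by ring.
  have i2 : 16 * isqrt th ^+ 2 <= 32 / th by apply: I2; lra.
  rewrite e in h; move: h i2; move: (heat th z) (heat _ z) (_ * _ ^+ 2) => A B c h i2.
  have V1' : V - 1 <= 0 by lra.
  rewrite distrC (ler0_norm V1') opprB; apply: le_trans h _.
  by apply: ler_wpM2r => //; lra.
have h := @heat_time1 _ (th + 1 - V) (V - 1) z ltac:(lra) ltac:(lra).
have e : th + 1 - V + (V - 1) = th by ring.
have i2 : 16 * isqrt (th + 1 - V) ^+ 2 <= 32 / th by apply: I2; lra.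
rewrite e in h; move: h i2; move: (heat th z) (heat _ z) (_ * _ ^+ 2) => A B c h i2.
have V1' : 0 <= V - 1 by lra.
rewrite (ger0_norm V1'); apply: le_trans h _.
by apply: ler_wpM2r.
Qed.

Lemma qform_heat_bound (al : R) : 0 < al <= 1 -> s2 p a <= 2 ->
  `|Ex (fun w => heat th (x0 - qform p a w)) - heat (th + 1) x0| <=
  (2 * C + 32 / th) * al
  + (17 * C + 32 * 10 / th) * (tr4 a + (s2 p a - 1) ^+ 2) / al.
Proof.
move=> al01 s2le; have /andP[al0 al1] := al01; have th_gt0 := th0.
have t0 := tr4_ge0 a.
have h1 : `|Ex (fun w => heat th (x0 - qform p a w)) - Ex (Yst #|I|)| <=
    32 / th * (al / 2 + (10 * tr4 a + (s2 p a - 1) ^+ 2) / (2 * al)).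
  rewrite -ExB; apply: le_trans (Ex_norm p01 _) _.
  (* Young's inequality with weight [al]; the square of [cvar - 1] is expanded around the mean [s2],
     so that the cross term has expectation zero. *)
  apply: (@le_trans _ _ (Ex (fun w => 32 / th * (al / 2 +
     ((cvar p a w - s2 p a) ^+ 2 + 2 * (s2 p a - 1) * (cvar p a w - s2 p a)
      + (s2 p a - 1) ^+ 2) / (2 * al))))).
    apply: Ex_le => // w; apply: le_trans (Yst_end w) _.
    apply: ler_wpM2l; first by rewrite divr_ge0 // ltW.
    have -> : (cvar p a w - s2 p a) ^+ 2 + 2 * (s2 p a - 1) * (cvar p a w - s2 p a)
      + (s2 p a - 1) ^+ 2 = `|cvar p a w - 1| ^+ 2.
      by rewrite real_normK ?num_real //; ring.
    move: (`|_|) => x.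
    have : 0 <= (x - al) ^+ 2 / (2 * al) by apply: divr_ge0; [exact: sqr_ge0|lra].
    have -> : (x - al) ^+ 2 / (2 * al) = al / 2 + x ^+ 2 / (2 * al) - x.
      by field; rewrite gt_eqF.
    lra.
  rewrite ExZ; apply: ler_wpM2l; first by rewrite divr_ge0 // ltW.
  rewrite ExD Ex_cst lerD2l.
  under eq_Ex do rewrite mulrC.
  rewrite ExZ mulrC; apply: ler_wpM2r; first by rewrite invr_ge0; lra.
  rewrite !ExD ExZ ExB !Ex_cst Ex_cvar // subrr mulr0 addr0 lerD2r.
  exact: cvar_variance.
have h2 := Yst_total.
have h3 : C * \sum_k Ex (fun w => v k * `|part k w| ^+ 3 + v k ^+ 2 * part k w ^+ 4)
    <= C * (al * s2 p a + 17 * tr4 a / al).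
  by apply: ler_wpM2l => //; exact: sum_moments_le.
apply: le_trans (ler_distD (Ex (Yst #|I|)) _ _) _.
apply: le_trans (lerD h1 (le_trans h2 h3)) _.
have q0 : 0 <= al^-1 by rewrite invr_ge0 ltW.
have r0 : 0 <= th^-1 by rewrite invr_ge0 ltW.
rewrite invfM.
have d0 := sqr_ge0 (s2 p a - 1).
move: (al^-1) (th^-1) (tr4 a) ((s2 p a - 1) ^+ 2) (s2 p a) s2le q0 r0 t0 d0.
move=> ia it T D S SL q0 r0 t0 d0.
have e1 := mulr_ge0 C0 (mulr_ge0 (ltW al0) (_ : 0 <= 2 - S)).
have e1' := e1 ltac:(lra).
have e2 := mulr_ge0 r0 (mulr_ge0 q0 t0).
have e3 := mulr_ge0 r0 (mulr_ge0 q0 d0).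
have e4 := mulr_ge0 r0 (ltW al0).
have e5 := mulr_ge0 C0 (mulr_ge0 q0 d0).
lra.
Qed.

End StoppedMartingale.

(** The constant depends on [th] only: it comes from [heat_step] at [th / 2], below which the
    remaining time never falls. Uniformity in the index set and the kernel is what a sequence of
    growing graphs requires. *)
Lemma quadratic_form_clt {R : realType} (th : R) : 0 < th ->
  exists2 C : R, 0 <= C &
  forall (I : finType) (p : I -> R) (a : I -> I -> R) (x0 al : R),
    (forall i, 0 <= p i <= 1) -> (forall k l, 0 <= a k l) ->
    (forall k l, a k l = a l k) -> 0 < al <= 1 -> s2 p a <= 2 ->
    `|Ex p (fun w => heat th (x0 - qform p a w)) - heat (th + 1) x0| <=
    C * (al + (tr4 a + (s2 p a - 1) ^+ 2) / al).
Proof.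
move=> th0; have [|C C0 HC] := @heat_step R (th / 2); first by lra.
have i0 : 0 <= th^-1 by rewrite invr_ge0 ltW.
exists (17 * C + 32 * 10 / th); first by rewrite addr_ge0 ?mulr_ge0.
move=> I p a x0 al p01 a0 asym al01 s22.
have /andP[al0 al1] := al01.
apply: le_trans (qform_heat_bound p01 a0 asym x0 th0 C0 (fun q y z t => HC q y z t) al01 s22) _.
move: (tr4 a + _) => T; rewrite [leRHS]mulrDr [X in _ <= _ + X]mulrA lerD2r.
by apply: ler_wpM2r; [exact: ltW|lra].
Qed.

(** * The log-likelihood and its maximizers *)

Section PairSums.
Context {R : realType} {n : nat}.
Implicit Types (G : 'I_n -> 'I_n -> R) (k : 'I_n -> R).

(** Ordered pairs, hence twice a sum over edges for symmetric [G]; symmetrization then becomes a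
    relabelling. *)
Definition offsum G : R := \sum_i \sum_(j | j != i) G i j.
Definition nsq k : R := \sum_i k i ^+ 2.

Lemma offsum_pairs G : (forall i j, G i j = G j i) ->
  offsum G = 2 * \sum_(i : 'I_n) \sum_(j : 'I_n | (i < j)%N) G i j.
Proof.
move=> Gs; rewrite mulr_natl mulr2n.
rewrite [X in _ = _ + X](exchange_big_dep xpredT) //= -big_split /=.
apply: eq_bigr => i _; rewrite (bigID (fun j : 'I_n => (i < j)%N)) /=; congr (_ + _).
  by apply: eq_bigl => j; rewrite neq_ltn andb_orl ltnNge; case: ltngtP.
apply: eq_big => [j|j _]; last exact: Gs.
by rewrite neq_ltn; case: ltngtP.
Qed.

Lemma offsum_le G H : (forall i j, i != j -> G i j <= H i j) -> offsum G <= offsum H.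
Proof.
by move=> GH; apply: ler_sum => i _; apply: ler_sum => j ji; apply: GH; rewrite eq_sym.
Qed.

Lemma eq_offsum G H : (forall i j, i != j -> G i j = H i j) -> offsum G = offsum H.
Proof.
by move=> GH; apply: eq_bigr => i _; apply: eq_bigr => j ji; apply: GH; rewrite eq_sym.
Qed.

Lemma offsumD G H : offsum (fun i j => G i j + H i j) = offsum G + offsum H.
Proof. by rewrite -big_split; apply: eq_bigr => i _; rewrite big_split. Qed.

Lemma offsumZ (c : R) G : offsum (fun i j => c * G i j) = c * offsum G.
Proof. by rewrite mulr_sumr; apply: eq_bigr => i _; rewrite mulr_sumr. Qed.

Lemma offsumB G H : offsum (fun i j => G i j - H i j) = offsum G - offsum H.
Proof. by rewrite -sumrB; apply: eq_bigr => i _; rewrite sumrB. Qed.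

Lemma offsum_ge0 G : (forall i j, i != j -> 0 <= G i j) -> 0 <= offsum G.
Proof.
by move=> G0; apply: sumr_ge0 => i _; apply: sumr_ge0 => j ji; rewrite G0 // eq_sym.
Qed.

Lemma offsum_norm G : `|offsum G| <= offsum (fun i j => `|G i j|).
Proof.
apply: le_trans (ler_norm_sum _ _ _) _; apply: ler_sum => i _.
exact: ler_norm_sum.
Qed.

Lemma offsumC G : offsum (fun i j => G j i) = offsum G.
Proof.
rewrite /offsum (exchange_big_dep xpredT) //=; apply: eq_bigr => j _.
by apply: eq_bigl => i; rewrite eq_sym.
Qed.

Lemma offsum_sym_lin G k : (forall i j, G i j = G j i) ->
  offsum (fun i j => G i j * (k i + k j)) = 2 * \sum_i k i * \sum_(j | j != i) G i j.
Proof.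
move=> Gs; have e : offsum (fun i j => G i j * k i) = \sum_i k i * \sum_(j | j != i) G i j.
  by apply: eq_bigr => i _; rewrite mulr_sumr; apply: eq_bigr => j _; rewrite mulrC.
under eq_offsum do rewrite mulrDr.
rewrite offsumD e -[X in _ + X]offsumC.
under [X in _ + X]eq_offsum do rewrite Gs.
by rewrite e mulr_natl mulr2n.
Qed.

Lemma sum_ord_cst (c : R) : \sum_(i < n) c = n%:R * c.
Proof. by rewrite sumr_const card_ord mulr_natl. Qed.

Lemma offsum_all G : offsum G = \sum_i \sum_j G i j - \sum_i G i i.
Proof.
rewrite -sumrB; apply: eq_bigr => i _.
by rewrite [\sum_j G i j](bigD1 i) //= addrAC subrr add0r.
Qed.

Lemma offsum_sqr k : offsum (fun i j => (k i + k j) ^+ 2) =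
  2 * (n%:R - 2) * nsq k + 2 * (\sum_i k i) ^+ 2.
Proof.
rewrite offsum_all.
have -> : \sum_i \sum_j (k i + k j) ^+ 2 = 2 * n%:R * nsq k + 2 * (\sum_i k i) ^+ 2.
  transitivity (\sum_i (n%:R * k i ^+ 2 + nsq k + 2 * (k i * \sum_j k j))).
    apply: eq_bigr => i _; rewrite -sum_ord_cst !mulr_sumr -!big_split /=.
    by apply: eq_bigr => j _; ring.
  by rewrite !big_split /= -!mulr_sumr -mulr_suml sum_ord_cst -/(nsq k); ring.
have -> : \sum_i (k i + k i) ^+ 2 = 4 * nsq k.
  by rewrite mulr_sumr; apply: eq_bigr => i _; ring.
by ring.
Qed.

(** Up to the factor 2 the form has the matrix [(n - 2) I + J], the signless Laplacian of the
    complete graph. Its positivity on all vectors is the source of curvature in every direction. *)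
Lemma offsum_sqr_ge k : 2 * (n%:R - 2) * nsq k <= offsum (fun i j => (k i + k j) ^+ 2).
Proof. by rewrite offsum_sqr lerDl mulr_ge0 // sqr_ge0. Qed.

Lemma nsq_ge0 k : 0 <= nsq k.
Proof. by apply: sumr_ge0 => i _; exact: sqr_ge0. Qed.

Lemma nsq_coord k i : k i ^+ 2 <= nsq k.
Proof. by rewrite /nsq (bigD1 i) //= lerDl sumr_ge0 // => j _; exact: sqr_ge0. Qed.

Lemma offsum_split_le (F : 'I_n -> R) : (forall i, 0 <= F i) ->
  offsum (fun i j => F i + F j) <= 2 * n%:R * \sum_i F i.
Proof.
move=> F0; rewrite offsum_all.
have -> : \sum_i \sum_j (F i + F j) = 2 * n%:R * \sum_i F i.
  transitivity (\sum_i (n%:R * F i + \sum_j F j)).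
    by apply: eq_bigr => i _; rewrite big_split /= sum_ord_cst.
  by rewrite big_split /= -mulr_sumr sum_ord_cst; ring.
by rewrite gerBl sumr_ge0 // => i _; rewrite addr_ge0.
Qed.

Lemma offsum_sqr_le k : offsum (fun i j => (k i + k j) ^+ 2) <= 4 * n%:R * nsq k.
Proof.
have h : offsum (fun i j => (k i + k j) ^+ 2) <=
    2 * offsum (fun i j => k i ^+ 2 + k j ^+ 2).
  rewrite -offsumZ; apply: offsum_le => i j _.
  by have := sqr_ge0 (k i - k j); nra.
apply: le_trans h _.
have := @offsum_split_le (fun i => k i ^+ 2) (fun i => sqr_ge0 _).
rewrite -/(nsq k); lra.
Qed.

Lemma offsum_pow4_le k : offsum (fun i j => (k i + k j) ^+ 4) <=
  16 * n%:R * \sum_i k i ^+ 4.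
Proof.
have h : offsum (fun i j => (k i + k j) ^+ 4) <=
    8 * offsum (fun i j => k i ^+ 4 + k j ^+ 4).
  rewrite -offsumZ; apply: offsum_le => i j _.
  have -> : 8 * (k i ^+ 4 + k j ^+ 4) = (k i + k j) ^+ 4 + 
    (k i - k j) ^+ 2 * (7 * k i ^+ 2 + 10 * k i * k j + 7 * k j ^+ 2) by ring.
  rewrite lerDl mulr_ge0 ?sqr_ge0 //.
  by have := sqr_ge0 (k i + k j); have := sqr_ge0 (k i); have := sqr_ge0 (k j); nra.
apply: le_trans h _.
have k4 i : 0 <= k i ^+ 4 by rewrite exprn_even_ge0.
have := @offsum_split_le (fun i => k i ^+ 4) k4.
lra.
Qed.

Lemma dot_young (x y : 'I_n -> R) (c : R) : 0 < c ->
  \sum_i x i * y i <= c / 2 * nsq x + nsq y / (2 * c).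
Proof.
move=> c0; rewrite /nsq mulr_sumr mulr_suml -big_split /=; apply: ler_sum => i _.
have : 0 <= (c * x i - y i) ^+ 2 / (2 * c).
  by apply: divr_ge0; [exact: sqr_ge0|lra].
have -> : (c * x i - y i) ^+ 2 / (2 * c) =
   c / 2 * x i ^+ 2 + y i ^+ 2 / (2 * c) - x i * y i.
  by field; rewrite gt_eqF.
lra.
Qed.

Lemma dot_CS (x y : 'I_n -> R) : (\sum_i x i * y i) ^+ 2 <= nsq x * nsq y.
Proof.
have H (c : R) : 0 <= c ^+ 2 * nsq x - 2 * c * (\sum_i x i * y i) + nsq y.
  have <- : nsq (fun i => c * x i - y i) =
      c ^+ 2 * nsq x - 2 * c * (\sum_i x i * y i) + nsq y.
    rewrite /nsq !mulr_sumr -sumrB -big_split; apply: eq_bigr => i _ /=; ring.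
  exact: nsq_ge0.
have [x0|] := eqVneq (nsq x) 0.
  have -> : \sum_i x i * y i = 0; last by rewrite x0 mul0r expr0n.
  apply: big1 => i _; suff -> : x i = 0 by rewrite mul0r.
  by apply/eqP; rewrite -sqrf_eq0 -[_ == 0]andTb eq_le sqr_ge0 andbT -x0 nsq_coord.
move=> xn0; have x0 : 0 < nsq x by rewrite lt_def xn0 nsq_ge0.
have := H ((\sum_i x i * y i) / nsq x).
set S := \sum_i _; rewrite -(ler_pM2l x0) mulr0.
have -> : nsq x * ((S / nsq x) ^+ 2 * nsq x - 2 * (S / nsq x) * S + nsq y) =
  nsq x * nsq y - S ^+ 2 by field.
lra.
Qed.

Lemma sum_CS (x : 'I_n -> R) : (\sum_i x i) ^+ 2 <= n%:R * nsq x.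
Proof.
have := dot_CS (fun=> 1) x; rewrite {1}/nsq.
under eq_bigr do rewrite mul1r.
by under [X in _ <= X * _]eq_bigr do rewrite expr1n; rewrite sum_ord_cst mulr1.
Qed.

End PairSums.

Section LoglikExpansion.
Context {R : realType} {n : nat}.
Variable A : adj n.
Implicit Types (z k : 'I_n -> R).

Definition shift z k : 'I_n -> R := fun i => z i + k i.
Definition grad z (i : 'I_n) : R :=
  degree A i - \sum_(j | j != i) logistic (z i + z j).

Lemma loglikE z : loglik A z =
  \sum_i z i * degree A i - offsum (fun i j => softplus (z i + z j)) / 2.
Proof.
rewrite /loglik offsum_pairs => [|i j]; last by rewrite addrC.
by rewrite mulrC mulrA mulVf ?mul1r // pnatr_eq0.
Qed.

(** An exact expansion: the remainder is a sum of Bregman divergences of [softplus], so the tangent,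
    concavity, smoothness and Taylor bounds below follow edge by edge. *)
Lemma loglik_shift z k : loglik A (shift z k) =
  loglik A z + \sum_i grad z i * k i -
  offsum (fun i j => softplus (z i + z j + (k i + k j))
     - (softplus (z i + z j) + logistic (z i + z j) * (k i + k j))) / 2.
Proof.
rewrite !loglikE offsumB offsumD offsum_sym_lin; last by move=> i j; rewrite addrC.
have -> : \sum_i grad z i * k i = \sum_i k i * degree A i -
    \sum_i k i * \sum_(j | j != i) logistic (z i + z j).
  by rewrite -sumrB; apply: eq_bigr => i _; rewrite /grad mulrC mulrBr.
have -> : offsum (fun i j => softplus (shift z k i + shift z k j)) =
   offsum (fun i j => softplus (z i + z j + (k i + k j))).
  by apply: eq_offsum => i j _; rewrite /shift addrACA.
have -> : \sum_i shift z k i * degree A i =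
   \sum_i z i * degree A i + \sum_i k i * degree A i.
  by rewrite -big_split; apply: eq_bigr => i _; rewrite /shift mulrDl.
by field.
Qed.

Lemma loglik_tangent z k : loglik A (shift z k) <= loglik A z + \sum_i grad z i * k i.
Proof.
rewrite loglik_shift gerBl divr_ge0 // offsum_ge0 // => i j _.
by rewrite subr_ge0 softplus_tangent.
Qed.

Lemma loglik_strong z k : (forall i, `|k i| <= 1 / 4) ->
  loglik A (shift z k) <= loglik A z + \sum_i grad z i * k i
    - offsum (fun i j => dlogistic (z i + z j) * (k i + k j) ^+ 2) / 8.
Proof.
move=> k4; rewrite loglik_shift lerD2l lerN2.
rewrite (_ : _ / 8 = 4^-1 * offsum (fun i j => dlogistic (z i + z j) * (k i + k j) ^+ 2) / 2).
  rewrite ler_pM2r // -offsumZ; apply: offsum_le => i j _.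
  have := @softplus_strong _ (z i + z j) (k i + k j).
  have -> // : `|k i + k j| <= 1 / 2.
    by apply: le_trans (ler_normD _ _) _; have := k4 i; have := k4 j; lra.
  move/(_ isT); lra.
by field.
Qed.

Lemma loglik_smooth z k : loglik A z + \sum_i grad z i * k i
  - offsum (fun i j => (k i + k j) ^+ 2) / 16 <= loglik A (shift z k).
Proof.
rewrite loglik_shift lerD2l lerN2.
rewrite (_ : _ / 16 = 8^-1 * offsum (fun i j => (k i + k j) ^+ 2) / 2).
  rewrite ler_pM2r // -offsumZ; apply: offsum_le => i j _.
  by have := softplus_smooth (z i + z j) (k i + k j); lra.
by field.
Qed.

Lemma loglik_taylor4 z k : `|loglik A (shift z k) - (loglik A z + \sum_i grad z i * k i
  - offsum (fun i j => dlogistic (z i + z j) * (k i + k j) ^+ 2) / 4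
  - offsum (fun i j => d2logistic (z i + z j) * (k i + k j) ^+ 3) / 12)|
  <= offsum (fun i j => (k i + k j) ^+ 4) / 192.
Proof.
rewrite loglik_shift.
set S := offsum _; set S2 := offsum (fun i j => dlogistic _ * _).
set S3 := offsum (fun i j => d2logistic _ * _).
have -> : loglik A z + \sum_i grad z i * k i - S / 2 -
  (loglik A z + \sum_i grad z i * k i - S2 / 4 - S3 / 12) =
  - (S - (2^-1 * S2 + 6^-1 * S3)) / 2 by field.
rewrite mulNr normrN normrM (ger0_norm (_ : 0 <= 2^-1)) //.
rewrite -!offsumZ -offsumD -offsumB.
set G := fun i j => _ - _; have := offsum_norm G => h.
rewrite (_ : _ / 192 = 96^-1 * offsum (fun i j => (k i + k j) ^+ 4) / 2); last by field.
rewrite ler_pM2r //; apply: le_trans h _; rewrite -offsumZ; apply: offsum_le => i j _.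
rewrite /G; have := softplus_taylor4 (z i + z j) (k i + k j).
rewrite [_ / 96]mulrC; apply: le_trans; apply: ler_of_eq.
by congr (`| _ |); move: (softplus _) (softplus (z i + z j)) => s t; field.
Qed.

Lemma grad_shift z k i : grad (shift z k) i =
  grad z i - \sum_(j | j != i) (logistic (z i + z j + (k i + k j)) - logistic (z i + z j)).
Proof.
rewrite /grad sumrB opprB addrA subrK; congr (_ - _).
by apply: eq_bigr => j _; rewrite /shift addrACA.
Qed.

(** Two tangent inequalities at the intermediate point, towards the two end points; with weights
    [1 - s] and [s] the gradient terms cancel. *)
Lemma loglik_concave z k (s : R) : 0 <= s <= 1 ->
  (1 - s) * loglik A z + s * loglik A (shift z k) <=
  loglik A (shift z (fun i => s * k i)).
Proof.
move=> /andP[s0 s1]; pose m := shift z (fun i => s * k i).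
have h1 := loglik_tangent m (fun i => - s * k i).
have h2 := loglik_tangent m (fun i => (1 - s) * k i).
have e1 : shift m (fun i => - s * k i) = z.
  by apply/funext => i; rewrite /m /shift; ring.
have e2 : shift m (fun i => (1 - s) * k i) = shift z k.
  by apply/funext => i; rewrite /m /shift; ring.
rewrite e1 in h1; rewrite e2 in h2.
have q0 : 0 <= 1 - s by rewrite subr_ge0.
apply: le_trans (lerD (ler_wpM2l q0 h1) (ler_wpM2l s0 h2)) _.
apply: ler_of_eq.
have -> : \sum_i grad m i * (- s * k i) = - s * \sum_i grad m i * k i.
  by rewrite mulr_sumr; apply: eq_bigr => i _; ring.
have -> : \sum_i grad m i * ((1 - s) * k i) = (1 - s) * \sum_i grad m i * k i.
  by rewrite mulr_sumr; apply: eq_bigr => i _; ring.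
by rewrite -/m; ring.
Qed.

End LoglikExpansion.

Section Maximizers.
Context {R : realType} {n : nat}.
Variable A : adj n.
Implicit Types (z k h : 'I_n -> R) (c : 'I_n -> 'I_n).

Lemma loglik_rV_continuous z c :
  continuous (fun v : 'rV[R]_n => loglik A (shift z (fun i => v ord0 (c i)))).
Proof.
have cc i : continuous (fun v : 'rV[R]_n => z i + v ord0 (c i)).
  move=> v; have c1 : (cst (z i) : 'rV[R]_n -> R^o) x @[x --> v] --> z i.
    exact: (@cst_continuous _ _ (z i) v).
  have c2 : (fun x : 'rV[R]_n => x ord0 (c i) : R^o) x @[x --> v] --> v ord0 (c i).
    exact: coord_continuous.
  exact: (cvgD c1 c2).
have cs : continuous (@softplus R).
  move=> x; apply: differentiable_continuous.
  by apply/derivable1_diffP; have [] := is_derive_softplus x.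
have c1 i : continuous (fun v : 'rV[R]_n => (z i + v ord0 (c i)) * degree A i : R^o).
  move=> v; have cd : (cst (degree A i) : 'rV[R]_n -> R^o) x @[x --> v] --> degree A i.
    exact: (@cst_continuous _ _ (degree A i) v).
  exact: (cvgM (cc i v) cd).
have c2 i j : continuous (fun v : 'rV[R]_n =>
    softplus (z i + v ord0 (c i) + (z j + v ord0 (c j))) : R^o).
  move=> v; have cij := cvgD (cc i v) (cc j v).
  exact: (cvg_comp _ _ (cij (nbhs_filter v)) (cs _)).
have H1 : continuous (fun v : 'rV[R]_n => \sum_i (z i + v ord0 (c i)) * degree A i : R^o).
  by apply: continuous_big => [|i _]; [exact: add_continuous|exact: c1].
have H2 : continuous (fun v : 'rV[R]_n => \sum_(i : 'I_n) \sum_(j : 'I_n | (i < j)%N)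
    softplus (z i + v ord0 (c i) + (z j + v ord0 (c j))) : R^o).
  apply: continuous_big => [|i _]; first exact: add_continuous.
  by apply: continuous_big => [|j _]; [exact: add_continuous|exact: c2].
have -> : (fun v : 'rV[R]_n => loglik A (shift z (fun i => v ord0 (c i)))) =
  (fun v : 'rV[R]_n => \sum_i (z i + v ord0 (c i)) * degree A i : R^o) -
  (fun v : 'rV[R]_n => \sum_(i : 'I_n) \sum_(j : 'I_n | (i < j)%N)
    softplus (z i + v ord0 (c i) + (z j + v ord0 (c j))) : R^o) by apply/funext.
by move=> v; have := cvgB (H1 v) (H2 v); apply; exact: nbhs_filter.
Qed.

(** The idempotent map [c] encodes the constraint of being constant on its fibres: the identity
    gives the full space and [rep] gives [Theta0], so one compactness argument serves both
    maximizers. *)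
Lemma box_max z c (rho : R) : (forall i, c (c i) = c i) -> 0 <= rho ->
  exists h, [/\ forall i, h i = h (c i), forall i, `|h i| <= rho &
    forall k, (forall i, k i = k (c i)) -> (forall i, `|k i| <= rho) ->
      loglik A (shift z k) <= loglik A (shift z h)].
Proof.
move=> cc rho0.
pose B := [set v : 'rV[R]_n | forall i, `[- rho, rho]%classic (v ord0 i)].
have cB : compact B.
  by apply: (@rV_compact _ _ (fun=> `[- rho, rho]%classic)) => i; exact: segment_compact.
have B0 : B !=set0.
  by exists 0 => i /=; rewrite mxE in_itv /= oppr_le0 rho0.
have [v vB vmax] := EVT_max_rV B0 cB
  (@continuous_subspaceT _ _ B _ (@loglik_rV_continuous z c)).
exists (fun i => v ord0 (c i)); split => [i|i|k kc krho].
- by rewrite cc.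
- by move: vB; rewrite inE => /(_ (c i)) /=; rewrite in_itv /= ler_norml.
have := vmax (\row_i k i).
have -> : (\row_i k i) \in B.
  by rewrite inE => i /=; rewrite mxE in_itv /= -ler_norml.
move=> /(_ isT); congr (_ <= _); congr (loglik A _); apply/funext => i.
by rewrite /shift mxE -kc.
Qed.

(** The smoothness bound gives [t * S <= t ^+ 2 * Q] for every [t], which forces [S = 0]. The choice
    [t = S / (Q + 1)] also covers [Q = 0]. *)
Lemma max_stationary z k : (forall t : R, loglik A (shift z (fun i => t * k i)) <= loglik A z) ->
  \sum_i grad A z i * k i = 0.
Proof.
move=> zmax; set S := \sum_i _; pose Q := offsum (fun i j => (k i + k j) ^+ 2) / 16.
have Q0 : 0 <= Q by rewrite divr_ge0 // offsum_ge0 // => i j _; exact: sqr_ge0.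
have H t : t * S <= t ^+ 2 * Q.
  have := le_trans (loglik_smooth A z (fun i => t * k i)) (zmax t).
  have -> : \sum_i grad A z i * (t * k i) = t * S.
    by rewrite mulr_sumr; apply: eq_bigr => i _; ring.
  have -> : offsum (fun i j => (t * k i + t * k j) ^+ 2) / 16 = t ^+ 2 * Q.
    rewrite /Q mulrA -offsumZ; congr (_ / _).
    by apply: eq_offsum => i j _; ring.
  lra.
have Q1 : 0 < Q + 1 by lra.
have := H (S / (Q + 1)).
rewrite -(ler_pM2l (mulr_gt0 Q1 Q1)).
have -> : (Q + 1) * (Q + 1) * (S / (Q + 1) * S) = S ^+ 2 * (Q + 1).
  by field; rewrite gt_eqF.
have -> : (Q + 1) * (Q + 1) * ((S / (Q + 1)) ^+ 2 * Q) = S ^+ 2 * Q.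
  by field; rewrite gt_eqF.
move=> h; have S0 : S ^+ 2 <= 0 by lra.
by apply/eqP; rewrite -sqrf_eq0 eq_le S0 sqr_ge0.
Qed.

Lemma grad_shift_bound z k i : k i = 0 ->
  `|grad A (shift z k) i| <= `|grad A z i| + (\sum_j `|k j|) / 4.
Proof.
move=> ki; rewrite grad_shift; apply: le_trans (ler_normB _ _) _; rewrite lerD2l.
apply: le_trans (ler_norm_sum _ _ _) _; rewrite mulr_suml big_mkcond.
apply: ler_sum => j _; case: ifP => _; last by rewrite divr_ge0.
by rewrite ki add0r logistic_lipschitz.
Qed.

Lemma sum_neq_cst (i : 'I_n) (x : R) : \sum_(j | j != i) x = (n%:R - 1) * x.
Proof.
have := sum_ord_cst (n := n) x; rewrite (bigD1 i) //= => e.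
by rewrite mulrBl mul1r -e addrAC subrr add0r.
Qed.

(** * Existence of a constrained maximizer near the true parameter *)

Section RestrictedMLE.
Variables (be : 'I_n -> R) (c : 'I_n -> 'I_n) (b S : R).
Hypothesis cc : forall i, c (c i) = c i.
Hypothesis be_c : forall i, be i = be (c i).
Hypothesis n4 : (4 <= n)%N.
Hypothesis b1 : 1 <= b.
Hypothesis nu_lb : forall i j, i != j -> 1 / b <= dlogistic (be i + be j).
Hypothesis grad2 : nsq (grad A be) <= S * n%:R ^+ 2.
Hypothesis gradoo : forall i, `|grad A be i| <= n%:R / (64 * b) / 4.
Hypothesis Sn : 64 ^+ 3 * b ^+ 4 * S <= n%:R.

Let N4 : 4 <= n%:R :> R. Proof. by rewrite ler_nat. Qed.
Let b0 : 0 < b. Proof. by apply: lt_le_trans b1. Qed.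

(** The quadratic loss inside the box is played against the linear gain, by Young's inequality with
    weight [q = (n - 2) / (4 * b)]; since [n >= 4], this is at least [n / (8 * b)]. *)
Lemma box_nsq h : (forall i, `|h i| <= 1 / 4) ->
  loglik A be <= loglik A (shift be h) -> nsq h <= 64 * b ^+ 2 * S.
Proof.
move=> h4 hmax; have N := N4; have b_gt0 := b0.
have str := le_trans hmax (loglik_strong A be h4).
have low : 2 * (n%:R - 2) * nsq h / b <=
    offsum (fun i j => dlogistic (be i + be j) * (h i + h j) ^+ 2).
  apply: le_trans (_ : b^-1 * offsum (fun i j => (h i + h j) ^+ 2) <= _).
    by rewrite mulrC ler_pM2l ?invr_gt0 // offsum_sqr_ge.
  rewrite -offsumZ; apply: offsum_le => i j ij; rewrite ler_wpM2r ?sqr_ge0 //.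
  by have := nu_lb ij; rewrite div1r.
pose q := (n%:R - 2) / (4 * b).
have q0 : 0 < q by rewrite divr_gt0 //; lra.
have y := dot_young h (grad A be) q0.
have e : \sum_i h i * grad A be i = \sum_i grad A be i * h i.
  by apply: eq_bigr => i _; rewrite mulrC.
rewrite e in y.
have h1 : q * nsq h <= \sum_i grad A be i * h i.
  have -> : q * nsq h = 2 * (n%:R - 2) * nsq h / b / 8 by rewrite /q; field; rewrite gt_eqF.
  lra.
have h2 : q / 2 * nsq h <= nsq (grad A be) / (2 * q) by lra.
have h3 : q ^+ 2 * nsq h <= nsq (grad A be).
  move: h2; rewrite ler_pdivlMr; last by lra.
  by apply: le_trans; apply: ler_of_eq; field.
have q8 : n%:R / (8 * b) <= q.
  rewrite /q ler_pdivrMr; last by lra.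
  have -> : (n%:R - 2) / (4 * b) * (8 * b) = (n%:R - 2) * 2 :> R by field; rewrite gt_eqF.
  lra.
have q8' : (n%:R / (8 * b)) ^+ 2 <= q ^+ 2.
  by apply: ler_expn_nneg => //; rewrite divr_ge0 //; lra.
have n0 : 0 < n%:R ^+ 2 :> R by rewrite exprn_gt0 //; lra.
have h5 := le_trans (le_trans (ler_wpM2r (nsq_ge0 h) q8') h3) grad2.
rewrite -(ler_pM2l n0).
have -> : n%:R ^+ 2 * nsq h = 64 * b ^+ 2 * ((n%:R / (8 * b)) ^+ 2 * nsq h).
  by field; rewrite gt_eqF.
have -> : n%:R ^+ 2 * (64 * b ^+ 2 * S) = 64 * b ^+ 2 * (S * n%:R ^+ 2) by ring.
by rewrite ler_pM2l // mulr_gt0 // exprn_gt0.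
Qed.

Lemma sum_abs_small h : nsq h <= 64 * b ^+ 2 * S -> \sum_i `|h i| <= n%:R / (64 * b).
Proof.
move=> hS; have N := N4; have b_gt0 := b0.
have N0 : 0 <= n%:R / (64 * b) by rewrite divr_ge0 //; lra.
rewrite -(@ler_pXn2r _ 2) // ?nnegrE //; last by apply: sumr_ge0.
apply: le_trans (sum_CS _) _.
have -> : nsq (fun i => `|h i|) = nsq h.
  by apply: eq_bigr => i _; rewrite real_normK ?num_real.
apply: le_trans (ler_wpM2l (ler0n _ _) hS) _.
have -> : (n%:R / (64 * b)) ^+ 2 = n%:R * (n%:R / (64 * b) ^+ 2) by field; rewrite gt_eqF.
rewrite ler_wpM2l // ler_pdivlMr; last by rewrite exprn_gt0 //; lra.
apply: le_trans Sn; apply: ler_of_eq; ring.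
Qed.

(** The squared-norm bound may exceed the size of the box, so coordinates are treated one class at a
    time. Let [h'] vanish on the class of [i] and agree with [h] elsewhere. Going back from [h'] to
    [h] cannot lose likelihood, yet it costs curvature of order [n * h i ^+ 2 / b] per node of the
    class. The linear gain is small by [gradoo] and because the sum of all [|h j|] is at most
    [n / (64 * b)]. *)
Lemma box_interior h : (forall i, h i = h (c i)) -> (forall i, `|h i| <= 1 / 4) ->
  (forall k, (forall i, k i = k (c i)) -> (forall i, `|k i| <= 1 / 4) ->
      loglik A (shift be k) <= loglik A (shift be h)) ->
  nsq h <= 64 * b ^+ 2 * S -> forall i, `|h i| <= 1 / 6.
Proof.
move=> hc h4 hmax hS i; have N := N4; have b_gt0 := b0.
pose C := [pred k | c k == c i].
pose h' (k : 'I_n) := if C k then 0 else h k.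
pose d (k : 'I_n) := if C k then h i else 0.
have hk (k : 'I_n) : C k -> h k = h i by move=> /eqP e; rewrite hc e -hc.
have cC (k : 'I_n) : C (c k) = C k by rewrite /C /= cc.
have h'4 (k : 'I_n) : `|h' k| <= 1 / 4 by rewrite /h'; case: ifP => _ //; rewrite normr0.
have d4 (k : 'I_n) : `|d k| <= 1 / 4 by rewrite /d; case: ifP => _ //; rewrite normr0.
have hE : shift be h = shift (shift be h') d.
  apply/funext => k; rewrite /shift /h' /d; case: ifP => Ck; last by ring.
  by rewrite hk //; ring.
have m1 : loglik A (shift be h') <= loglik A (shift be h).
  by apply: hmax => // k; rewrite /h' cC; case: ifP => // _; rewrite -hc.
rewrite hE in m1; have := le_trans m1 (loglik_strong A (shift be h') d4).
set G := \sum_k _; set O := offsum _ => m2.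
have m3 : O / 8 <= G by lra.
pose D := n%:R / (64 * b) / 4 + n%:R / (64 * b) / 4.
have D0 : 0 <= D.
  have D1 : 0 <= n%:R / (64 * b) by rewrite divr_ge0 //; lra.
  by rewrite /D; lra.
have h'h : \sum_j `|h' j| <= n%:R / (64 * b).
  apply: le_trans (sum_abs_small hS); apply: ler_sum => j _.
  by rewrite /h'; case: ifP => _ //; rewrite normr0.
have Gle : G <= \sum_(k | C k) D * `|h i|.
  rewrite /G [leRHS]big_mkcond; apply: ler_sum => k _; rewrite /d.
  case: ifP => Ck; last by rewrite mulr0.
  apply: le_trans (ler_norm _) _; rewrite normrM ler_wpM2r //.
  have h'k : h' k = 0 by rewrite /h' Ck.
  apply: le_trans (grad_shift_bound be h'k) _; rewrite /D lerD //.
  by rewrite ler_pM2r.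
have Oge : \sum_(k | C k) (n%:R - 1) * (h i ^+ 2 / (2 * b)) <= O.
  rewrite /O /offsum [leLHS]big_mkcond; apply: ler_sum => k _; case: ifP => Ck; last first.
    by apply: sumr_ge0 => j _; rewrite mulr_ge0 ?sqr_ge0 // ltW // dlogistic_gt0.
  have -> : (n%:R - 1) * (h i ^+ 2 / (2 * b)) = \sum_(j | j != k) h i ^+ 2 / (2 * b).
    by rewrite sum_neq_cst.
  apply: ler_sum => j jk.
  have nu2 : 1 / (2 * b) <= dlogistic (shift be h' k + shift be h' j).
    have -> : shift be h' k + shift be h' j = be k + be j + (h' k + h' j).
      by rewrite /shift addrACA.
    apply: le_trans (dlogistic_half (be k + be j) _ _); last first.
      by apply: le_trans (ler_normD _ _) _; have := h'4 k; have := h'4 j; lra.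
    rewrite eq_sym in jk; have := nu_lb jk.
    have -> : 1 / (2 * b) = 1 / b / 2 by field; rewrite gt_eqF.
    lra.
  have hd : h i ^+ 2 <= (d k + d j) ^+ 2.
    rewrite /d Ck; case: ifP => _; last by rewrite addr0.
    by have := sqr_ge0 (h i); nra.
  rewrite mulrC -div1r; apply: ler_pM => //; last exact: sqr_ge0.
  by rewrite divr_ge0 //; lra.
have CiC : C i by rewrite /C /=.
have card0 : 0 < #|C|%:R :> R by rewrite ltr0n; apply/card_gt0P; exists i.
have m4 : (n%:R - 1) * (h i ^+ 2 / (2 * b)) / 8 <= D * `|h i|.
  have : (\sum_(k | C k) (n%:R - 1) * (h i ^+ 2 / (2 * b))) / 8 <=
     \sum_(k | C k) D * `|h i| by lra.
  have cs (x : R) : \sum_(k | C k) x = #|C|%:R * x by rewrite sumr_const mulr_natl.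
  rewrite !cs; move: (h i ^+ 2 / (2 * b)) (D * `|h i|) => x y.
  by rewrite -[_ * (_ * x) / 8]mulrA ler_pM2l.
have [->|hi0] := eqVneq (h i) 0; first by rewrite normr0.
have a0 : 0 < `|h i| by rewrite normr_gt0.
move: m4; rewrite -[h i ^+ 2]real_normK ?num_real //; move: (`|h i|) a0 => a a0 m4.
have m5 : (n%:R - 1) * a <= n%:R / 8.
  have : (n%:R - 1) * (a ^+ 2 / (2 * b)) / 8 * (16 * b / a) <= D * a * (16 * b / a).
    by rewrite ler_wpM2r // divr_ge0 // ?mulr_ge0 // ltW.
  have -> : (n%:R - 1) * (a ^+ 2 / (2 * b)) / 8 * (16 * b / a) = (n%:R - 1) * a.
    by field; rewrite !gt_eqF.
  have -> // : D * a * (16 * b / a) = n%:R / 8.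
  by rewrite /D; field; rewrite !gt_eqF.
(* The inequality [n / 8 <= (n - 1) / 6] is exactly [n >= 4]. *)
have : (n%:R - 1) * (a - 1 / 6) <= 0 by lra.
rewrite pmulr_rle0; last by lra.
lra.
Qed.

Lemma restricted_mle : exists h, [/\ forall i, h i = h (c i), forall i, `|h i| <= 1 / 4,
  nsq h <= 64 * b ^+ 2 * S &
  forall g, (forall i, g i = g (c i)) -> loglik A g <= loglik A (shift be h)].
Proof.
have [|h [hc h4 hmax]] := @box_max be c (1 / 4) cc; first by lra.
exists h.
have z0 : shift be (fun=> 0) = be by apply/funext => i; rewrite /shift addr0.
have hS : nsq h <= 64 * b ^+ 2 * S.
  apply: box_nsq => //; rewrite -[in leLHS]z0; apply: hmax => // i.
  by rewrite normr0; lra.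
split=> // g gc.
have h6 := box_interior hc h4 hmax hS.
pose k i := g i - (be i + h i).
have gE : g = shift (shift be h) k by apply/funext => i; rewrite /shift /k; ring.
pose K := \sum_i `|k i|.
have K0 : 0 <= K by apply: sumr_ge0.
have kK i : `|k i| <= K by rewrite /K (bigD1 i) //= lerDl sumr_ge0.
(* A step this short towards [g] stays in the box, as [1 / 6 + 1 / 12 = 1 / 4]; concavity then
   carries the comparison to [g] itself. *)
pose s := (12 * (1 + K))^-1.
have s0 : 0 < s by rewrite invr_gt0; lra.
have sK : s * K <= 1 / 12.
  by rewrite /s mulrC ler_pdivrMr; lra.
have s1 : s <= 1.
  by rewrite /s invf_le1; lra.
have := @loglik_concave R n A (shift be h) k s.
rewrite -gE => /(_ _); have -> : 0 <= s <= 1 by rewrite (ltW s0) s1.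
move=> /(_ isT) cv.
have : loglik A (shift (shift be h) (fun i => s * k i)) <= loglik A (shift be h).
  have -> : shift (shift be h) (fun i => s * k i) = shift be (fun i => h i + s * k i).
    by apply/funext => i; rewrite /shift; ring.
  apply: hmax => i; first by rewrite /k -gc -be_c -hc.
  apply: le_trans (ler_normD _ _) _; rewrite normrM (gtr0_norm s0).
  have := ler_wpM2l (ltW s0) (kK i); have := h6 i; lra.
move=> cv2; have : s * loglik A g <= s * loglik A (shift be h) by lra.
by rewrite ler_pM2l.
Qed.

End RestrictedMLE.

End Maximizers.

(** * The likelihood ratio near an exchangeable block *)

Section LRTExpansion.
Context {R : realType} {n : nat}.
Variables (A : adj n) (z : 'I_n -> R) (P : pred 'I_n) (i0 : 'I_n) (b : R).
Hypothesis zP : forall i, P i -> z i = z i0.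
Hypothesis n4 : (4 <= n)%N.
Hypothesis b1 : 1 <= b.
Hypothesis nu_lb : forall i j, i != j -> 1 / (2 * b) <= dlogistic (z i + z j).

(** The diagonal entry of the negative Hessian at a block node minus the common entry between two
    block nodes: one subtracted term removes [j = i0] from the sum, the other is the off-diagonal
    entry. *)
Definition lam : R := \sum_j dlogistic (z i0 + z j) - 2 * dlogistic (z i0 + z i0).

Let N4 : 4 <= n%:R :> R. Proof. by rewrite ler_nat. Qed.
Let b0 : 0 < b. Proof. by apply: lt_le_trans b1. Qed.

Section Direction.
Variable d : 'I_n -> R.
Hypothesis dP : forall i, ~~ P i -> d i = 0.
Hypothesis dsum : \sum_i d i = 0.

Lemma sum_kernel_P (F : R -> R) i (u : 'I_n -> R) : (forall j, ~~ P j -> u j = 0) ->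
  \sum_j F (z i + z j) * u j = F (z i + z i0) * \sum_j u j.
Proof.
move=> uP; rewrite mulr_sumr; apply: eq_bigr => j _.
by have [/zP ->|/uP ->] := boolP (P j); rewrite ?mulr0.
Qed.

Lemma sum_neq (F : 'I_n -> R) i : \sum_(j | j != i) F j = \sum_j F j - F i.
Proof. by rewrite [\sum_j F j](bigD1 i) //= addrAC subrr add0r. Qed.

(* On vectors supported on the exchangeable block with zero sum the Hessian
   acts as the scalar [lam]. *)
Lemma hessian_eigen i : \sum_(j | j != i) dlogistic (z i + z j) * (d i + d j) = lam * d i.
Proof.
rewrite sum_neq; under eq_bigr do rewrite mulrDr.
rewrite big_split /= (sum_kernel_P dlogistic i dP) dsum mulr0 addr0 -mulr_suml /lam.
have [Pi|/dP ->] := boolP (P i); last by ring.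
by rewrite (zP Pi); ring.
Qed.

Lemma hessian_quad : offsum (fun i j => dlogistic (z i + z j) * (d i + d j) ^+ 2) =
  2 * lam * nsq d.
Proof.
under eq_offsum do rewrite expr2 mulrA.
rewrite offsum_sym_lin; last by move=> i j; rewrite addrC [d i + _]addrC.
rewrite -mulrA; congr (_ * _); rewrite mulr_sumr; apply: eq_bigr => i _.
by rewrite hessian_eigen; ring.
Qed.

(** The mixed terms contain the factor [\sum_i d i = 0], which leaves a signed sum of cubes. A bound
    by the sum of [|d i| ^+ 3] would be too large when [r] is comparable to [n]. *)
Lemma cubic_form : offsum (fun i j => d2logistic (z i + z j) * (d i + d j) ^+ 3) =
  2 * (\sum_j d2logistic (z i0 + z j) - 4 * d2logistic (z i0 + z i0)) * \sum_i d i ^+ 3.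
Proof.
under eq_offsum do rewrite exprSr mulrA.
rewrite offsum_sym_lin; last by move=> i j; rewrite addrC [d i + _]addrC.
rewrite -mulrA; congr (_ * _).
set T := \sum_j d2logistic _; set t0 := d2logistic (z i0 + z i0).
transitivity (\sum_i ((T - 4 * t0) * d i ^+ 3 + t0 * nsq d * d i)); last first.
  by rewrite big_split /= -!mulr_sumr dsum mulr0 addr0.
apply: eq_bigr => i _; have [Pi|/dP ->] := boolP (P i); last by ring.
rewrite sum_neq.
have -> : \sum_j d2logistic (z i + z j) * (d i + d j) ^+ 2 =
   T * d i ^+ 2 + t0 * nsq d.
  transitivity (\sum_j (d2logistic (z i + z j) * d i ^+ 2 + (2 * d i) *
     (d2logistic (z i + z j) * d j) + d2logistic (z i + z j) * d j ^+ 2)).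
    by apply: eq_bigr => j _; ring.
  have d2P j : ~~ P j -> d j ^+ 2 = 0 by move=> /dP ->; rewrite expr0n.
  rewrite !big_split /= -mulr_suml -mulr_sumr (sum_kernel_P d2logistic i dP).
  rewrite (sum_kernel_P d2logistic i d2P) dsum !mulr0 addr0 (zP Pi).
  by [].
by rewrite (zP Pi) -/t0; ring.
Qed.

Lemma cubic_bound : `|offsum (fun i j => d2logistic (z i + z j) * (d i + d j) ^+ 3)| <=
  n%:R * `|\sum_i d i ^+ 3|.
Proof.
rewrite cubic_form normrM ler_wpM2r // normrM ger0_norm //.
have h : `|\sum_j d2logistic (z i0 + z j) - 4 * d2logistic (z i0 + z i0)| <=
    n%:R * (1 / 4) + 4 * (1 / 4).
  apply: le_trans (ler_normB _ _) _; apply: lerD.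
    apply: le_trans (ler_norm_sum _ _ _) _; rewrite -sum_ord_cst.
    by apply: ler_sum => j _; exact: d2logistic_bound.
  rewrite normrM ger0_norm // ler_wpM2l //; exact: d2logistic_bound.
have N := N4; lra.
Qed.

Lemma nsq_sqr_le : nsq d ^+ 2 <= n%:R * \sum_i d i ^+ 4.
Proof.
apply: le_trans (sum_CS (fun i => d i ^+ 2)) _; rewrite ler_wpM2l //.
by apply: ler_of_eq; apply: eq_bigr => i _; rewrite -exprM.
Qed.

End Direction.

Section Newton.
Let g := grad A z.
Hypothesis gP : forall i, ~~ P i -> g i = 0.
Hypothesis gsum : \sum_i g i = 0.
Hypothesis lam0 : 0 < lam.
Let d i := g i / lam.
Let D4 := \sum_i d i ^+ 4.
Hypothesis d4 : 64 ^+ 2 * b ^+ 2 * D4 <= 1.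

Let dP i : ~~ P i -> d i = 0.
Proof. by move=> /gP gi; rewrite /d gi mul0r. Qed.

Let dsum : \sum_i d i = 0.
Proof. by rewrite /d -mulr_suml gsum mul0r. Qed.

Let D40 : 0 <= D4.
Proof. by apply: sumr_ge0 => i _; rewrite exprn_even_ge0. Qed.

Let dsmall i : `|d i| <= 1 / 4.
Proof.
have di : d i ^+ 4 <= D4.
  rewrite /D4 (bigD1 i) //= lerDl sumr_ge0 // => j _.
  by rewrite exprn_even_ge0.
have D41 : 64 ^+ 2 * D4 <= 1.
  apply: le_trans d4; rewrite ler_wpM2r // ler_peMr //.
  by rewrite exprn_ege1.
rewrite -(@ler_pXn2r _ 4) // ?nnegrE //.
rewrite -normrX ger0_norm ?exprn_even_ge0 //; lra.
Qed.

Lemma newton_value : `|loglik A (shift z d) - loglik A z - nsq g / (2 * lam)| <=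
  n%:R / 12 * (`|\sum_i d i ^+ 3| + D4).
Proof.
have l0 : lam != 0 by rewrite gt_eqF.
have := loglik_taylor4 A z d; rewrite (hessian_quad dP dsum).
have -> : \sum_i grad A z i * d i = nsq g / lam.
  by rewrite /nsq mulr_suml; apply: eq_bigr => i _; rewrite /d /g; field.
have -> : nsq d = nsq g / lam ^+ 2.
  by rewrite /nsq mulr_suml; apply: eq_bigr => i _; rewrite /d; field.
have h3 := cubic_bound dP dsum; have h4 := offsum_pow4_le d.
move: h3 h4; rewrite -/D4.
move: (offsum _) (offsum _) => c4 c3 h3 h4 h.
rewrite (_ : _ - _ - _ = (loglik A (shift z d) - (loglik A z + nsq g / lam -
  2 * lam * (nsq g / lam ^+ 2) / 4 - c3 / 12)) - c3 / 12); last by field.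
apply: le_trans (ler_normB _ _) _; rewrite normrM (ger0_norm (_ : 0 <= 12^-1)) //.
lra.
Qed.

(** By [hessian_eigen] the Newton step cancels the linear part of the gradient exactly; the rest is
    quadratic in [d]. *)
Lemma newton_grad : nsq (grad A (shift z d)) <= n%:R ^+ 2 / 4 * D4.
Proof.
have gle i : `|grad A (shift z d) i| <= (n%:R * d i ^+ 2 + nsq d) / 4.
  rewrite grad_shift.
  have -> : grad A z i = \sum_(j | j != i) dlogistic (z i + z j) * (d i + d j).
    by rewrite (hessian_eigen dP dsum) /d /g; field; rewrite gt_eqF.
  rewrite -sumrB; apply: le_trans (ler_norm_sum _ _ _) _.
  apply: (@le_trans _ _ (\sum_j (d i ^+ 2 + d j ^+ 2) / 4)).
    rewrite big_mkcond; apply: ler_sum => j _; case: ifP => _; last first.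
      by rewrite divr_ge0 // addr_ge0 // sqr_ge0.
    have := logistic_taylor2 (z i + z j) (d i + d j); rewrite distrC.
    have -> : logistic (z i + z j) + dlogistic (z i + z j) * (d i + d j) -
       logistic (z i + z j + (d i + d j)) = dlogistic (z i + z j) * (d i + d j) -
       (logistic (z i + z j + (d i + d j)) - logistic (z i + z j)) by ring.
    move=> /le_trans; apply.
    by have := sqr_ge0 (d i - d j); nra.
  by rewrite -mulr_suml big_split /= sum_ord_cst.
have ge2 i : grad A (shift z d) i ^+ 2 <= (n%:R ^+ 2 * d i ^+ 4 + nsq d ^+ 2) / 8.
  rewrite -[leLHS]real_normK ?num_real //.
  apply: le_trans (ler_expn_nneg 2 (normr_ge0 _) (gle i)) _.
  have -> : d i ^+ 4 = (d i ^+ 2) ^+ 2 by rewrite -exprM.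
  by have := sqr_ge0 (n%:R * d i ^+ 2 - nsq d); nra.
apply: le_trans (ler_sum _ (fun i _ => ge2 i)) _.
rewrite -mulr_suml big_split /= -mulr_sumr sum_ord_cst -/D4.
have := ler_wpM2l (ler0n R n) (nsq_sqr_le d); rewrite -/D4; lra.
Qed.

Let nu_lb' i j : i != j -> 1 / (4 * b) <= dlogistic (shift z d i + shift z d j).
Proof.
move=> ij; have -> : shift z d i + shift z d j = z i + z j + (d i + d j).
  by rewrite /shift addrACA.
apply: le_trans (dlogistic_half (z i + z j) _ _); last first.
  by apply: le_trans (ler_normD _ _) _; have := dsmall i; have := dsmall j; lra.
have := nu_lb ij; have -> : 1 / (4 * b) = 1 / (2 * b) / 2 by field; rewrite gt_eqF.
lra.
Qed.

Let q := (n%:R - 2) / (16 * b).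

Let q0 : 0 < q.
Proof. by have := b0; have := N4 => ? ?; rewrite divr_gt0 //; lra. Qed.

Lemma newton_local k : (forall i, `|k i| <= 1 / 4) ->
  loglik A (shift (shift z d) k) <= loglik A (shift z d)
    + \sum_i grad A (shift z d) i * k i - q * nsq k.
Proof.
move=> k4; apply: le_trans (loglik_strong A (shift z d) k4) _.
have N := N4; have b_gt0 := b0; rewrite lerD2l lerN2.
have h : (4 * b)^-1 * offsum (fun i j => (k i + k j) ^+ 2) <=
  offsum (fun i j => dlogistic (shift z d i + shift z d j) * (k i + k j) ^+ 2).
  rewrite -offsumZ; apply: offsum_le => i j ij; rewrite ler_wpM2r ?sqr_ge0 //.
  by have := nu_lb' ij; rewrite div1r.
have i0' : 0 <= (4 * b)^-1 by rewrite invr_ge0; lra.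
have h2 := ler_wpM2l i0' (offsum_sqr_ge k).
have -> : q * nsq k = (4 * b)^-1 * (2 * (n%:R - 2) * nsq k) / 8.
  by rewrite /q; field; rewrite gt_eqF.
lra.
Qed.

Let e := grad A (shift z d).

Let e_small : 16 * nsq e <= q ^+ 2.
Proof.
have N := N4; have b_gt0 := b0.
have q1 : n%:R / (32 * b) <= q.
  rewrite /q ler_pdivrMr; last by lra.
  have -> : (n%:R - 2) / (16 * b) * (32 * b) = (n%:R - 2) * 2 :> R by field; rewrite gt_eqF.
  lra.
have q2 : (n%:R / (32 * b)) ^+ 2 <= q ^+ 2.
  by apply: ler_expn_nneg => //; rewrite divr_ge0 //; lra.
apply: le_trans q2.
have -> : (n%:R / (32 * b)) ^+ 2 = 4 * n%:R ^+ 2 / (64 ^+ 2 * b ^+ 2) :> R.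
  by field; rewrite gt_eqF.
have p0 : 0 < 64 ^+ 2 * b ^+ 2 by rewrite mulr_gt0 // exprn_gt0.
have ng := newton_grad; have n2 := sqr_ge0 (n%:R : R).
rewrite ler_pdivlMr //.
apply: le_trans (ler_wpM2r (ltW p0) (ler_wpM2l (ler0n _ _) ng)) _.
have := ler_wpM2l n2 d4; lra.
Qed.

(** By concavity it is enough to look at the point of the segment with [nsq = 1 / 16]. Its
    coordinates are at most [1 / 4], so [newton_local] applies, and the loss [q / 16] covers the
    linear gain, which is at most [q / 32] from each half of Young's inequality. *)
Lemma newton_far k : 1 / 16 < nsq k ->
  loglik A (shift (shift z d) k) <= loglik A (shift z d).
Proof.
move=> k16; have k0 : 0 < nsq k by lra.
pose s := (4 * Num.sqrt (nsq k))^-1.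
have sq0 : 0 < Num.sqrt (nsq k) by rewrite sqrtr_gt0.
have s0 : 0 < s by rewrite invr_gt0; lra.
have s2 : s ^+ 2 * nsq k = 1 / 16.
  rewrite /s exprVn exprMn sqr_sqrtr ?ltW //; field; exact: lt0r_neq0.
have s1 : s <= 1.
  rewrite -(@ler_pXn2r _ 2) ?nnegrE ?(ltW s0) // expr1n.
  by rewrite -(ler_pM2r k0) s2; lra.
pose x i := s * k i.
have x2 : nsq x = 1 / 16.
  by rewrite -s2 /nsq mulr_sumr; apply: eq_bigr => i _; rewrite exprMn.
have x4 i : `|x i| <= 1 / 4.
  rewrite -(@ler_pXn2r _ 2) ?nnegrE //.
  rewrite real_normK ?num_real //; apply: le_trans (nsq_coord x i) _; rewrite x2; lra.
have cv := @loglik_concave R n A (shift z d) k s.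
have := cv; have -> : 0 <= s <= 1 by rewrite (ltW s0) s1.
move=> /(_ isT) {}cv; have nl := newton_local x4.
have yo := dot_young x e q0; rewrite x2 in yo nl.
have ee : \sum_i x i * e i = \sum_i e i * x i by apply: eq_bigr => i _; rewrite mulrC.
rewrite ee in yo.
have es : nsq e / (2 * q) <= q / 32.
  rewrite ler_pdivrMr; last by have := q0; lra.
  have := e_small; lra.
have : s * loglik A (shift (shift z d) k) <= s * loglik A (shift z d).
  move: cv nl yo es; rewrite -/e -/x.
  move: (loglik A (shift (shift z d) x)) (loglik A (shift (shift z d) k)).
  by move: (loglik A _) (nsq e / _) (\sum_i _) => l1 c1 c2 l2 l3; lra.
by rewrite ler_pM2l.
Qed.

Lemma newton_near k : nsq k <= 1 / 16 ->
  loglik A (shift (shift z d) k) <= loglik A (shift z d) + 2 * b * n%:R * D4.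
Proof.
move=> k16; have N := N4; have b_gt0 := b0; have q_gt0 := q0.
have k4 i : `|k i| <= 1 / 4.
  rewrite -(@ler_pXn2r _ 2) ?nnegrE //.
  rewrite real_normK ?num_real //; apply: le_trans (nsq_coord k i) _; lra.
apply: le_trans (newton_local k4) _.
have q20 : 0 < 2 * q by lra.
have yo := dot_young k e q20.
have ee : \sum_i k i * e i = \sum_i e i * k i by apply: eq_bigr => i _; rewrite mulrC.
rewrite ee in yo.
have es : nsq e / (2 * (2 * q)) <= 2 * b * n%:R * D4.
  rewrite ler_pdivrMr; last by lra.
  apply: le_trans newton_grad _.
  have -> : 2 * b * n%:R * D4 * (2 * (2 * q)) = (n%:R * (n%:R - 2) / 2) * D4.
    by rewrite /q; field; rewrite gt_eqF.
  rewrite ler_wpM2r //; nra.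
move: yo es; rewrite -/e; lra.
Qed.

(** Only the value of the maximizer is located, between that of the Newton point and that value plus
    [2 * b * n * D4]. The box of radius [1 / 4] contains the ball [nsq <= 1 / 16], outside of which
    the Newton point is at least as good, so the box maximizer is global. *)
Lemma lrt_expansion : exists gh, (forall y, loglik A y <= loglik A gh) /\
  `|loglik A gh - loglik A z - nsq g / (2 * lam)| <=
  n%:R / 12 * `|\sum_i d i ^+ 3| + 3 * b * n%:R * D4.
Proof.
have [|h [_ h4 hmax]] := @box_max R n A (shift z d) id (1 / 4) (fun=> erefl); first by lra.
pose gh := shift (shift z d) h; exists gh.
have z0 : shift (shift z d) (fun=> 0) = shift z d.
  by apply/funext => i; rewrite {1}/shift addr0.
have m0 : loglik A (shift z d) <= loglik A gh.
  rewrite -[in leLHS]z0; apply: hmax => // i; by rewrite normr0; lra.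
have kE y : y = shift (shift z d) (fun i => y i - shift z d i).
  by apply/funext => i; rewrite {1}/shift addrC subrK.
have mx y : loglik A y <= loglik A gh.
  rewrite (kE y); set k := fun i => _.
  have [k16|k16] := leP (nsq k) (1 / 16); last first.
    exact: le_trans (newton_far k16) m0.
  apply: hmax => // i.
  rewrite -(@ler_pXn2r _ 2) ?nnegrE //.
  rewrite real_normK ?num_real //; apply: le_trans (nsq_coord k i) _; lra.
split => //.
have up : loglik A gh <= loglik A (shift z d) + 2 * b * n%:R * D4.
  have [h16|h16] := leP (nsq h) (1 / 16); first exact: newton_near.
  apply: le_trans (newton_far h16) _; rewrite lerDl.
  by have := b0 => b_gt0; rewrite !mulr_ge0 // ltW.
have := newton_value.
have nb : n%:R / 12 * D4 <= b * n%:R * D4.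
  rewrite ler_wpM2r // mulrC ler_wpM2r //; have := b1; lra.
move: up m0 nb; rewrite ler_norml => up m0 nb /andP[v1 v2].
by rewrite ler_norml; apply/andP; split; lra.
Qed.

End Newton.
End LRTExpansion.

(** * The Fisher information and the perturbation of [lam] *)

Section Fisher.
Context {R : realType} {n : nat}.
Variables (be : 'I_n -> R) (P : pred 'I_n) (i0 : 'I_n) (b : R).
Hypothesis Pi0 : P i0.
Hypothesis beP : forall i, P i -> be i = be i0.
Hypothesis n4 : (4 <= n)%N.
Hypothesis r4 : (4 <= #|P|)%N.
Hypothesis b1 : 1 <= b.
Hypothesis nu_lb : forall i j, i != j -> 1 / b <= dlogistic (be i + be j).
Implicit Types u h w : 'I_n -> R.

Let N4 : 4 <= n%:R :> R. Proof. by rewrite ler_nat. Qed.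
Let r := #|P|%:R : R.
Let R4 : 4 <= r. Proof. by rewrite ler_nat. Qed.
Let Rn : r <= n%:R. Proof. by rewrite ler_nat -[X in (_ <= X)%N]card_ord max_card. Qed.
Let b0 : 0 < b. Proof. by apply: lt_le_trans b1. Qed.

Definition fisher u i : R := \sum_(j | j != i) dlogistic (be i + be j) * (u i + u j).

Lemma fisher_dot u h :
  2 * \sum_i u i * fisher h i =
  offsum (fun i j => dlogistic (be i + be j) * (h i + h j) * (u i + u j)).
Proof.
by rewrite offsum_sym_lin // => i j; rewrite addrC [h i + _]addrC.
Qed.

Lemma fisher_sym u h : \sum_i u i * fisher h i = \sum_i h i * fisher u i.
Proof.
have two0 : (2 : R) != 0 by rewrite pnatr_eq0.
apply: (mulfI two0); rewrite !fisher_dot.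
by apply: eq_offsum => i j _; ring.
Qed.

Lemma fisher_posdef u : (n%:R - 2) / b * nsq u <= \sum_i u i * fisher u i.
Proof.
have := fisher_dot u u.
have i0' : 0 <= b^-1 by rewrite invr_ge0 ltW.
have h : b^-1 * offsum (fun i j => (u i + u j) ^+ 2) <=
   offsum (fun i j => dlogistic (be i + be j) * (u i + u j) * (u i + u j)).
  rewrite -offsumZ; apply: offsum_le => i j ij; rewrite -mulrA -expr2.
  by rewrite ler_wpM2r ?sqr_ge0 //; have := nu_lb ij; rewrite div1r.
have := ler_wpM2l i0' (offsum_sqr_ge u); lra.
Qed.

Lemma fisher_solve w : exists u, forall i, fisher u i = w i.
Proof.
pose V : 'M[R]_n := \matrix_(i, j) if i == j then \sum_(k | k != i) dlogistic (be i + be k)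
                            else dlogistic (be i + be j).
have VE (v : 'rV[R]_n) i : (v *m V) 0 i = fisher (fun j => v 0 j) i.
  rewrite mxE (bigD1 i) //= mxE eqxx /fisher mulr_sumr -big_split /=.
  by apply: eq_bigr => j ji; rewrite mxE (negbTE ji) [be j + _]addrC; ring.
have Vu : V \in unitmx.
  rewrite -row_free_unit; apply: inj_row_free => v vV.
  have := fisher_posdef (fun j => v 0 j).
  rewrite [X in _ <= X]big1 => [h|i _]; last by rewrite -VE vV mxE mulr0.
  have q0 : 0 < (n%:R - 2) / b by rewrite divr_gt0 //; have := N4; lra.
  have v0 : nsq (fun j => v 0 j) = 0.
    apply/eqP; rewrite eq_le nsq_ge0 andbT.
    by move: h; rewrite pmulr_rle0.
  apply/rowP => j; rewrite mxE; apply/eqP; rewrite -sqrf_eq0 eq_le sqr_ge0 andbT -v0.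
  exact: (nsq_coord (fun j => v 0 j)).
exists (fun i => ((\row_j w j) *m invmx V) 0 i) => i.
by rewrite -VE mulmxKV // mxE.
Qed.

Lemma lam_ge : (n%:R - 2) / b <= lam be i0.
Proof.
have /card_gt0P [i1] : (0 < #|[predD1 P & i0]|)%N.
  have := r4; rewrite (cardD1 i0); move: (leq_b1 (i0 \in P)).
  by move: (nat_of_bool _) (#|_|) => x y; lia.
rewrite !inE => /andP[i10 Pi1].
have i01 : i0 != i1 by rewrite eq_sym.
rewrite /lam (bigD1 i0) //= (bigD1 i1) //= (beP Pi1).
have -> : (n%:R - 2) / b = \sum_(j | (j != i0) && (j != i1)) 1 / b.
  have := sum_ord_cst (n := n) (1 / b); rewrite (bigD1 i0) //= (bigD1 i1) //= => e.
  move: e; set s := \sum_(i | _) _ => e; move: e; rewrite div1r; lra.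
have : \sum_(j | (j != i0) && (j != i1)) 1 / b <=
       \sum_(j | (j != i0) && (j != i1)) dlogistic (be i0 + be j).
  by apply: ler_sum => j /andP[ji0 _]; apply: nu_lb; rewrite eq_sym.
lra.
Qed.

Lemma lam_gt0 : 0 < lam be i0.
Proof.
apply: lt_le_trans lam_ge; rewrite divr_gt0 //; have := N4; lra.
Qed.

Lemma fisher_block u i : P i -> fisher u i =
  lam be i0 * u i + \sum_j dlogistic (be i0 + be j) * u j.
Proof.
move=> Pi; rewrite /fisher sum_neq; under eq_bigr do rewrite mulrDr.
by rewrite big_split /= -mulr_suml /lam (beP Pi); ring.
Qed.

(** On the block the equation reads [lam * u i + const = w i], so [u] inherits constancy from [w].
    This makes [u] an admissible direction for the restricted score equations. *)
Lemma fisher_solution_block u w : (forall i, fisher u i = w i) ->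
  (forall i, P i -> w i = w i0) -> forall i, P i -> u i = u i0.
Proof.
move=> uw wP i Pi; have := wP i Pi; rewrite -!uw !fisher_block //.
move/addIr; apply: mulfI; exact: lt0r_neq0 lam_gt0.
Qed.

Lemma fisher_solution_nsq u w : (forall i, fisher u i = w i) ->
  nsq u <= (2 * b / n%:R) ^+ 2 * nsq w.
Proof.
move=> uw; have N := N4; have b_gt0 := b0.
have := fisher_posdef u; under [X in _ <= X]eq_bigr do rewrite uw.
pose q := (n%:R - 2) / b; rewrite -/q => h.
have q0 : 0 < q by rewrite divr_gt0 //; lra.
have y := dot_young u w q0.
have h3 : q ^+ 2 * nsq u <= nsq w.
  have h2 : q / 2 * nsq u <= nsq w / (2 * q) by lra.
  move: h2; rewrite ler_pdivlMr; last by lra.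
  by apply: le_trans; apply: ler_of_eq; field.
have q8 : n%:R / (2 * b) <= q.
  rewrite /q ler_pdivrMr; last by lra.
  have -> : (n%:R - 2) / b * (2 * b) = (n%:R - 2) * 2 :> R by field; rewrite gt_eqF.
  lra.
have n0 : 0 < n%:R :> R by lra.
have q8' : (n%:R / (2 * b)) ^+ 2 <= q ^+ 2.
  by apply: ler_expn_nneg => //; rewrite divr_ge0 //; lra.
have h5 := le_trans (ler_wpM2r (nsq_ge0 u) q8') h3.
have k0 : 0 <= (2 * b / n%:R) ^+ 2 by exact: sqr_ge0.
apply: le_trans (ler_wpM2l k0 h5); rewrite mulrA -exprMn.
have -> : 2 * b / n%:R * (n%:R / (2 * b)) = 1 :> R by field; rewrite !gt_eqF.
by rewrite expr1n mul1r.
Qed.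

Lemma fisher_solution_sup u w (W : R) : (forall i, fisher u i = w i) ->
  (forall i, `|w i| <= W) -> forall i,
  `|u i| <= b / (n%:R - 1) * (W + (\sum_j `|u j|) / 4).
Proof.
move=> uw wW i; have N := N4; have b_gt0 := b0.
have e : u i * \sum_(j | j != i) dlogistic (be i + be j) =
    w i - \sum_(j | j != i) dlogistic (be i + be j) * u j.
  rewrite -uw /fisher -sumrB mulr_sumr; apply: eq_bigr => j _; ring.
have lo : (n%:R - 1) / b <= \sum_(j | j != i) dlogistic (be i + be j).
  rewrite -(sum_neq_cst i b^-1); apply: ler_sum => j ji.
  by rewrite -div1r nu_lb // eq_sym.
have q0 : 0 < (n%:R - 1) / b by rewrite divr_gt0 //; lra.
have up : `|w i - \sum_(j | j != i) dlogistic (be i + be j) * u j| <=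
    W + (\sum_j `|u j|) / 4.
  apply: le_trans (ler_normB _ _) _; apply: lerD => //.
  apply: le_trans (ler_norm_sum _ _ _) _; rewrite mulr_suml big_mkcond.
  apply: ler_sum => j _; case: ifP => _; last by rewrite divr_ge0.
  rewrite normrM (ger0_norm (ltW (dlogistic_gt0 _))) mulrC.
  by have := ler_wpM2l (normr_ge0 (u j)) (dlogistic_le (be i + be j)); lra.
have h : (n%:R - 1) / b * `|u i| <= W + (\sum_j `|u j|) / 4.
  apply: le_trans up; rewrite -e normrM mulrC ler_wpM2l //.
  by rewrite ger0_norm //; apply: sumr_ge0 => j _; rewrite ltW // dlogistic_gt0.
have i0' : 0 <= b / (n%:R - 1) by rewrite divr_ge0 //; lra.
apply: le_trans (ler_wpM2l i0' h); rewrite mulrA.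
have -> : b / (n%:R - 1) * ((n%:R - 1) / b) = 1.
  by field; apply/andP; split; apply: lt0r_neq0; lra.
by rewrite mul1r.
Qed.

(* The gradient of [lam] along perturbations that are constant on the block. *)
Definition lam_dir (i : 'I_n) : R :=
  if P i then (\sum_j d2logistic (be i0 + be j)
               + (r - 4) * d2logistic (be i0 + be i0)) / r
  else d2logistic (be i0 + be i).

(** Averaging the weight of the block over its [r] nodes keeps [lam_dir] constant there. The total
    weight collects the coefficient of [h i0]: the sum of all [t j] from the first summand, [r * t0]
    from the block part of the second, and [- 4 * t0] from the correction at [i0]. *)
Lemma lam_dir_dot h : (forall i, P i -> h i = h i0) ->
  \sum_i lam_dir i * h i = \sum_j d2logistic (be i0 + be j) * (h i0 + h j)
     - 2 * (d2logistic (be i0 + be i0) * (h i0 + h i0)).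
Proof.
move=> hP; have r0 : r != 0 by apply: lt0r_neq0; have := R4; lra.
set t := fun j => d2logistic (be i0 + be j); set t0 := d2logistic (be i0 + be i0).
have cs (x : R) : \sum_(i | P i) x = r * x by rewrite sumr_const mulr_natl.
rewrite (bigID P) /=.
have -> : \sum_(i | P i) lam_dir i * h i =
    (\sum_j t j + (r - 4) * t0) * h i0.
  rewrite (eq_bigr (fun=> (\sum_j t j + (r - 4) * t0) / r * h i0)).
    by rewrite cs; field.
  by move=> i Pi; rewrite /lam_dir Pi (hP i Pi).
have -> : \sum_(i | ~~ P i) lam_dir i * h i = \sum_(i | ~~ P i) t i * h i.
  by apply: eq_bigr => i /negbTE Pi; rewrite /lam_dir Pi.
have -> : \sum_j t j * (h i0 + h j) = (\sum_j t j) * h i0 + \sum_j t j * h j.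
  by rewrite mulr_suml -big_split; apply: eq_bigr => j _; rewrite mulrDr.
rewrite [\sum_j t j * h j](bigID P) /=.
have -> : \sum_(i | P i) t i * h i = r * (t0 * h i0).
  by rewrite -cs; apply: eq_bigr => i Pi; rewrite (hP i Pi) /t (beP Pi).
by ring.
Qed.

Lemma lam_dir_bound i : `|lam_dir i| <= n%:R / r.
Proof.
have R_4 := R4; have N := N4; have R_n := Rn.
have r0 : 0 < r by lra.
have nr : 1 <= n%:R / r by rewrite ler_pdivlMr // mul1r.
rewrite /lam_dir; case: ifP => _; last first.
  by have := d2logistic_bound (be i0 + be i); lra.
have ri : 0 < r^-1 by rewrite invr_gt0.
rewrite normrM (ger0_norm (ltW ri)) ler_pM2r //.
apply: le_trans (ler_normD _ _) _.
have h1 : `|\sum_j d2logistic (be i0 + be j)| <= n%:R * (1 / 4).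
  apply: le_trans (ler_norm_sum _ _ _) _; rewrite -sum_ord_cst.
  by apply: ler_sum => j _; exact: d2logistic_bound.
have h2 : `|(r - 4) * d2logistic (be i0 + be i0)| <= (r - 4) * (1 / 4).
  rewrite normrM ger0_norm; last by lra.
  by rewrite ler_wpM2l ?d2logistic_bound //; lra.
lra.
Qed.

Lemma lam_dir_nsq : nsq lam_dir <= 2 * n%:R ^+ 2 / r.
Proof.
have R_4 := R4; have N := N4; have R_n := Rn; have r0 : 0 < r by lra.
have cs (x : R) : \sum_(i | P i) x = r * x by rewrite sumr_const mulr_natl.
rewrite /nsq (bigID P) /=.
have h1 : \sum_(i | P i) lam_dir i ^+ 2 <= n%:R ^+ 2 / r.
  have -> : n%:R ^+ 2 / r = \sum_(i | P i) (n%:R / r) ^+ 2.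
    by rewrite cs; field; exact: lt0r_neq0.
  apply: ler_sum => i _; rewrite -[leLHS]real_normK ?num_real //.
  exact: ler_expn_nneg (lam_dir_bound i).
have h2 : \sum_(i | ~~ P i) lam_dir i ^+ 2 <= n%:R * 1.
  rewrite -sum_ord_cst big_mkcond; apply: ler_sum => i _; case: ifP => //.
  move=> /negbTE Pi; rewrite /lam_dir Pi -[leLHS]real_normK ?num_real //.
  have := d2logistic_bound (be i0 + be i); have := normr_ge0 (d2logistic (be i0 + be i)).
  by move: (`|_|) => x x0 x1; nra.
have h3 : n%:R * 1 <= n%:R ^+ 2 / r.
  by rewrite ler_pdivlMr // mulr1 expr2 ler_wpM2l.
lra.
Qed.

(** The vector [u] solves the Fisher system for [lam_dir] and is chosen before the graph, so the
    first-order change of [lam] is a fixed linear statistic of the score. Indeed, pairing [lam_dir]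
    with [h] amounts to pairing [u] with the Fisher image of [h]; this image is the score at the
    truth up to second order when tested against [u], because the score at [shift be h] is
    orthogonal to [u]. *)
Lemma lam_perturb : exists u, nsq u <= 8 * b ^+ 2 / r /\
  forall (A : adj n) h (H : R), (forall i, P i -> h i = h i0) -> nsq h <= H ->
   (forall u', (forall i, P i -> u' i = u' i0) -> \sum_i grad A (shift be h) i * u' i = 0) ->
   `|lam (shift be h) i0 - lam be i0| <=
     `|\sum_i u i * grad A be i| + 3 * b ^+ 2 * n%:R * H / r.
Proof.
have R_4 := R4; have N := N4; have R_n := Rn; have r0 : 0 < r by lra.
have b_gt0 := b0; have b_1 := b1; have n0 : 0 < n%:R :> R by lra.
have [u uw] := fisher_solve lam_dir.
have wP i : P i -> lam_dir i = lam_dir i0 by move=> Pi; rewrite /lam_dir Pi Pi0.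
have uP := fisher_solution_block uw wP.
have u2 : nsq u <= 8 * b ^+ 2 / r.
  apply: le_trans (fisher_solution_nsq uw) _.
  apply: le_trans (ler_wpM2l (sqr_ge0 _) lam_dir_nsq) _.
  by apply: ler_of_eq; field; apply/andP; split; exact: lt0r_neq0.
have uabs : \sum_j `|u j| <= 3 * b * n%:R / r.
  have t0 : 0 <= 3 * b * n%:R / r.
    by apply: divr_ge0; [rewrite mulr_ge0 // mulr_ge0 // ltW|exact: ltW].
  rewrite -(@ler_pXn2r _ 2) ?nnegrE //; last by apply: sumr_ge0.
  apply: le_trans (sum_CS _) _.
  have -> : nsq (fun i => `|u i|) = nsq u.
    by apply: eq_bigr => i _; rewrite real_normK ?num_real.
  apply: le_trans (ler_wpM2l (ltW n0) u2) _.
  have -> : (3 * b * n%:R / r) ^+ 2 = n%:R * (9 * b ^+ 2 * (n%:R / r) / r).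
    by field; exact: lt0r_neq0.
  apply: ler_wpM2l => //; apply: ler_wpM2r; first by rewrite invr_ge0 ltW.
  have nr : 1 <= n%:R / r by rewrite ler_pdivlMr // mul1r.
  have b2 := sqr_ge0 b; nra.
have usup i : `|u i| <= 3 * b ^+ 2 / r.
  apply: le_trans (fisher_solution_sup uw lam_dir_bound i) _.
  have i0' : 0 <= b / (n%:R - 1) by rewrite divr_ge0 //; lra.
  apply: le_trans (ler_wpM2l i0' (_ : _ <= 7 / 4 * b * n%:R / r)) _.
    have : n%:R / r <= b * n%:R / r.
      by rewrite ler_pM2r ?invr_gt0 // ler_pMl.
    move: uabs; rewrite -!mulrA; lra.
  have -> : b / (n%:R - 1) * (7 / 4 * b * n%:R / r) =
     (7 / 4 * (n%:R / (n%:R - 1))) * (b ^+ 2 / r).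
    by field; apply/andP; split; apply: lt0r_neq0; lra.
  have -> : 3 * b ^+ 2 / r = 3 * (b ^+ 2 / r) by rewrite mulrA.
  apply: ler_wpM2r; first by apply: divr_ge0; [exact: sqr_ge0|exact: ltW].
  have : n%:R / (n%:R - 1) <= 4 / 3 :> R by rewrite ler_pdivrMr; lra.
  lra.
exists u; split => // A h H hP hH stat.
have H0 : 0 <= H := le_trans (nsq_ge0 h) hH.
pose rho i := \sum_(j | j != i) (logistic (be i + be j + (h i + h j)) -
   (logistic (be i + be j) + dlogistic (be i + be j) * (h i + h j))).
have gE i : grad A (shift be h) i = grad A be i - fisher h i - rho i.
  rewrite grad_shift -[RHS]addrA -opprD; congr (_ - _).
  by rewrite /fisher /rho -big_split /=; apply: eq_bigr => j _; ring.
have wh : \sum_i lam_dir i * h i = \sum_i u i * grad A be i - \sum_i u i * rho i.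
  have := stat u uP; under eq_bigr do rewrite gE.
  have -> : \sum_i lam_dir i * h i = \sum_i u i * fisher h i.
    by rewrite fisher_sym; apply: eq_bigr => i _; rewrite uw mulrC.
  have -> : \sum_i (grad A be i - fisher h i - rho i) * u i =
    \sum_i u i * grad A be i - \sum_i u i * fisher h i - \sum_i u i * rho i.
    by rewrite -!sumrB; apply: eq_bigr => i _; ring.
  by move: (\sum_i _) (\sum_i _) (\sum_i _) => s1 s2 s3 e; lra.
have urho : `|\sum_i u i * rho i| <= 3 * b ^+ 2 / r * (n%:R * H / 2).
  apply: le_trans (ler_norm_sum _ _ _) _.
  apply: (@le_trans _ _ (\sum_i 3 * b ^+ 2 / r * \sum_(j | j != i) (h i + h j) ^+ 2 / 8)).
    apply: ler_sum => i _; rewrite normrM; apply: ler_pM => //.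
    apply: le_trans (ler_norm_sum _ _ _) _; apply: ler_sum => j _.
    exact: logistic_taylor2.
  rewrite -mulr_sumr; apply: ler_wpM2l.
    by apply: divr_ge0; [rewrite mulr_ge0 // sqr_ge0|exact: ltW].
  under eq_bigr do rewrite -mulr_suml.
  rewrite -mulr_suml.
  have h1 := offsum_sqr_le h; have h2 := ler_wpM2l (ltW n0) hH.
  rewrite /offsum in h1; lra.
(* Constancy of [h] on the block gains the factor [1 / r]. *)
have h0 : h i0 ^+ 2 <= H / r.
  rewrite ler_pdivlMr // mulrC; apply: le_trans hH.
  have <- : \sum_(i | P i) h i0 ^+ 2 = r * h i0 ^+ 2 by rewrite sumr_const mulr_natl.
  rewrite big_mkcond; apply: ler_sum => i _; case: ifP => [/hP ->|_] //.
  exact: sqr_ge0.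
pose rh j := dlogistic (be i0 + be j + (h i0 + h j)) -
  (dlogistic (be i0 + be j) + d2logistic (be i0 + be j) * (h i0 + h j)).
have lE : lam (shift be h) i0 - lam be i0 =
   \sum_i lam_dir i * h i + (\sum_j rh j - 2 * rh i0).
  rewrite (lam_dir_dot hP) /lam /rh !sumrB big_split /= /shift.
  rewrite (eq_bigr (fun j => dlogistic (be i0 + be j + (h i0 + h j)))); last first.
    by move=> j _; rewrite addrACA.
  by rewrite addrACA; ring.
have rhb j : `|rh j| <= (h i0 + h j) ^+ 2 / 8 by exact: dlogistic_taylor2.
have rhs : `|\sum_j rh j| <= (n%:R * h i0 ^+ 2 + H) / 4.
  apply: le_trans (ler_norm_sum _ _ _) _.
  apply: (@le_trans _ _ (\sum_j (h i0 ^+ 2 + h j ^+ 2) / 4)).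
    apply: ler_sum => j _; apply: le_trans (rhb j) _.
    by have := sqr_ge0 (h i0 - h j); nra.
  rewrite -mulr_suml big_split /= sum_ord_cst; move: hH; rewrite /nsq; lra.
have nr : H <= n%:R * H / r.
  by rewrite ler_pdivlMr // mulrC ler_wpM2r.
have h01 : n%:R * h i0 ^+ 2 <= n%:R * H / r.
  by rewrite -mulrA ler_wpM2l // ltW.
have h02 : 4 * h i0 ^+ 2 <= n%:R * H / r.
  apply: le_trans h01; rewrite ler_wpM2r ?sqr_ge0 //.
rewrite lE wh; apply: le_trans (ler_normD _ _) _.
apply: le_trans (lerD (ler_normB _ _) (ler_normB _ _)) _.
rewrite [`|2 * rh i0|]normrM ger0_norm //.
have rh0 := rhb i0.
have e1 : 3 * b ^+ 2 / r * (n%:R * H / 2) = 3 / 2 * (b ^+ 2 * (n%:R * H / r)).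
  by field; exact: lt0r_neq0.
have e2 : 3 * b ^+ 2 * n%:R * H / r = 3 * (b ^+ 2 * (n%:R * H / r)).
  by field; exact: lt0r_neq0.
have x0 : 0 <= n%:R * H / r by apply: le_trans nr.
have e3 : n%:R * H / r <= b ^+ 2 * (n%:R * H / r).
  by rewrite ler_peMl // exprn_ege1.
rewrite e1 in urho; rewrite e2.
move: urho rhs rh0 h01 h02 nr e3.
rewrite (_ : (h i0 + h i0) ^+ 2 = 4 * h i0 ^+ 2); last by ring.
by move: (b ^+ 2 * (n%:R * H / r)) (n%:R * H / r) (n%:R * h i0 ^+ 2) => y x v; lra.
Qed.

End Fisher.

(** * Independent edges *)

Section EdgeModel.
Context {R : realType} {n : nat}.
Variable be : 'I_n -> R.
Local Notation edge := ('I_n * 'I_n)%type.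
Local Notation Om := {ffun edge -> bool}.
Implicit Types (e f : edge) (w : Om) (i j : 'I_n).

Definition upper e : bool := (e.1 < e.2)%N.
(* All ordered pairs are sampled; those off the upper triangle have probability 0. *)
Definition eprob e : R := if upper e then logistic (be e.1 + be e.2) else 0.
Definition sym_adj w : adj n :=
  [ffun q : edge => if (q.1 < q.2)%N then w q
                    else if (q.2 < q.1)%N then w (q.2, q.1) else false].
Local Notation Ex := (Ex eprob).
Local Notation X := (ctr eprob).
Local Notation v := (bvar eprob).

Lemma eprob01 e : 0 <= eprob e <= 1.
Proof.
rewrite /eprob; case: ifP => _; last by rewrite lexx ler01.
by rewrite (ltW (logistic_gt0 _)) (ltW (logistic_lt1 _)).
Qed.

Lemma bvar_eprob_ge0 e : 0 <= v e.
Proof. exact: bvar_ge0 eprob01 e. Qed.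

Lemma sym_adj_sym w i j : sym_adj w (i, j) = sym_adj w (j, i).
Proof. by rewrite !ffunE /=; case: ltngtP. Qed.

Lemma valid_sym_adj w : valid_adj (sym_adj w).
Proof.
apply/andP; split; first by apply/forallP => i; apply/forallP => j; rewrite sym_adj_sym.
by apply/forallP => i; rewrite ffunE /= ltnn.
Qed.

Definition upper_part (A : adj n) : Om := [ffun e => upper e && A e].

Lemma upper_partK (A : adj n) : valid_adj A -> sym_adj (upper_part A) = A.
Proof.
move=> /andP[/forallP As /forallP Ad]; apply/ffunP => -[i j]; rewrite !ffunE /= /upper /=.
have /eqP sij := forallP (As i) j.
by case: ltngtP => //= /val_inj ij; rewrite ij; apply/esym/negbTE/Ad.
Qed.

(** A configuration charging a pair off the upper triangle has a factor 0; on the others [sym_adj]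
    is inverted by [upper_part], which justifies the change of variables in [bmodel_prob_Pr]. *)
Lemma wt_upper w : upper_part (sym_adj w) != w -> wt eprob w = 0.
Proof.
move=> nw; have [e ew] : exists e, ~~ upper e && w e.
  apply/existsP; apply: contraNT nw; rewrite negb_exists => /forallP H.
  apply/eqP/ffunP => e; rewrite !ffunE /upper; have := H e; rewrite /upper.
  by case: (e.1 < e.2)%N => //=; case: (w e).
move/andP: ew => [eu we]; rewrite /wt (bigD1 e) //= we /eprob (negbTE eu).
by rewrite mul0r.
Qed.

Lemma wt_pmf w : upper_part (sym_adj w) = w -> wt eprob w = bmodel_pmf be (sym_adj w).
Proof.
move=> wE; rewrite /bmodel_pmf valid_sym_adj.
rewrite (pair_big_dep xpredT (fun i j : 'I_n => (i < j)%N)) /=.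
rewrite /wt (bigID upper) /= [X in _ * X]big1 ?mulr1 => [|e eu]; last first.
  by rewrite -wE ffunE /eprob (negbTE eu) /= subr0.
apply: eq_big => [[i j]|[i j] eu] //.
by rewrite /eprob eu ffunE /= -[(i < j)%N]/(upper (i, j)) eu.
Qed.

Lemma bmodel_prob_Pr (E : adj n -> Prop) :
  bmodel_prob be E = Pr eprob (fun w => E (sym_adj w)).
Proof.
rewrite /bmodel_prob PrE (bigID valid_adj) /= [X in _ + X]big1 ?addr0; last first.
  by move=> A /andP[_ /negbTE vA]; rewrite /bmodel_pmf vA.
rewrite (reindex_onto sym_adj upper_part) /=; last by move=> A /andP[_]; exact: upper_partK.
rewrite [RHS](bigID (fun w => upper_part (sym_adj w) == w)) /= [X in _ + X]big1 ?addr0; last first.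
  by move=> w /wt_upper ->; rewrite mul0r.
rewrite big_mkcond [RHS]big_mkcond; apply: eq_bigr => w _.
rewrite valid_sym_adj andbT.
case: (upper_part (sym_adj w) =P w) => [wE|_]; last by rewrite andbF.
rewrite andbT; case: asboolP => _; last by rewrite mulr0.
by rewrite mulr1 wt_pmf.
Qed.

(** The incidence matrix of nodes and edges, set to zero off the upper triangle so that each edge
    counts once. *)
Definition inc e i : R := (upper e)%:R * ((e.1 == i)%:R + (e.2 == i)%:R).

Lemma inc_sum (F : 'I_n -> 'I_n -> R) i : (forall a b, F a b = F b a) ->
  \sum_e inc e i * F e.1 e.2 = \sum_(j | j != i) F i j.
Proof.
move=> Fs.
rewrite -(pair_bigA _ (fun a b => inc (a, b) i * F a b)) /=.
rewrite (eq_bigr (fun a => \sum_b (upper (a, b))%:R * ((a == i)%:R * F a b)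
   + \sum_b (upper (a, b))%:R * ((b == i)%:R * F a b))); last first.
  by move=> a _; rewrite -big_split; apply: eq_bigr => b _; rewrite /inc /=; ring.
rewrite big_split /= [X in _ + X]exchange_big /=.
rewrite (bigD1 i) //= [X in _ + X + _]big1 ?addr0; last first.
  by move=> a /negbTE ai; apply: big1 => b _; rewrite ai mul0r mulr0.
rewrite [X in _ + X](bigD1 i) //= [X in _ + (_ + X)]big1 ?addr0; last first.
  by move=> a /negbTE ai; apply: big1 => b _; rewrite ai mul0r mulr0.
rewrite -big_split [RHS]big_mkcond; apply: eq_bigr => j _.
rewrite eqxx !mul1r /upper /= [F j i]Fs -mulrDl -natrD -val_eqE /=.
by case: ltngtP => _ /=; rewrite ?mul1r ?mul0r.
Qed.

Lemma inc01 e i : inc e i = 0 \/ inc e i = 1.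
Proof.
rewrite /inc; case: (boolP (upper e)) => [|_]; last by left; rewrite mul0r.
rewrite /upper mul1r; case: e => a b /=.
case: (a =P i) => [ai|_]; case: (b =P i) => [bi|_]; rewrite /= ?addr0 ?add0r; auto.
by rewrite ai bi ltnn.
Qed.

Lemma inc_ge0 e i : 0 <= inc e i.
Proof. by case: (inc01 e i) => ->. Qed.

Lemma inc_sqr e i : inc e i ^+ 2 = inc e i.
Proof. by case: (inc01 e i) => ->; rewrite ?expr0n ?expr1n. Qed.

Lemma inc_le1 e i : inc e i <= 1.
Proof. by case: (inc01 e i) => ->. Qed.

Lemma inc_col i : \sum_e inc e i = n%:R - 1.
Proof.
have := @inc_sum (fun _ _ => 1) i (fun _ _ => erefl).
by under eq_bigr do rewrite mulr1; rewrite sum_neq_cst mulr1.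
Qed.

Lemma inc_row (P : pred 'I_n) e : \sum_(i | P i) inc e i <= 2.
Proof.
apply: (@le_trans _ _ (\sum_i inc e i)).
  by rewrite big_mkcond; apply: ler_sum => i _; case: ifP => // _; exact: inc_ge0.
rewrite /inc -mulr_sumr big_split /=.
have one j : \sum_i (j == i)%:R = 1 :> R.
  rewrite (bigD1 j) //= eqxx big1 ?addr0 // => i ij.
  by rewrite eq_sym (negbTE ij).
by rewrite !one; case: (upper e); rewrite ?mul1r ?mul0r.
Qed.

Lemma inc_gram (F : 'I_n -> 'I_n -> R) i i' : (forall a b, F a b = F b a) ->
  \sum_e inc e i * inc e i' * F e.1 e.2 =
  if i == i' then \sum_(j | j != i) F i j else F i i'.
Proof.
move=> Fs; pose G (a b : 'I_n) : R := ((a == i')%:R + (b == i')%:R) * F a b.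
have -> : \sum_e inc e i * inc e i' * F e.1 e.2 = \sum_e inc e i * G e.1 e.2.
  apply: eq_bigr => e _; rewrite /inc /G.
  by case: (upper e); rewrite ?mul0r ?mul1r // mulrA.
rewrite inc_sum /G => [|a b]; last by rewrite addrC Fs.
have [<-|ii'] := eqVneq i i'.
  by apply: eq_bigr => j ji; rewrite (negbTE ji) addr0 mul1r.
rewrite (bigD1 i') 1?eq_sym //= eqxx add0r mul1r big1 ?addr0 // => j /andP[_ ji'].
by rewrite (negbTE ji') addr0 mul0r.
Qed.

Lemma bvar_eprob e : v e = (upper e)%:R * dlogistic (be e.1 + be e.2).
Proof.
by rewrite /bvar /eprob; case: (upper e); rewrite ?mul0r ?mul1r.
Qed.

Lemma inc_bvar e i : inc e i * v e = inc e i * dlogistic (be e.1 + be e.2).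
Proof.
by rewrite bvar_eprob /inc; case: (upper e); rewrite ?mul0r ?mul1r.
Qed.

Definition eps i w : R := \sum_e inc e i * X e w.

Lemma epsE i w : eps i w = grad (sym_adj w) be i.
Proof.
rewrite /eps; under eq_bigr do rewrite /ctr mulrBr.
rewrite sumrB /grad; congr (_ - _).
  pose G (a b : 'I_n) : R := (sym_adj w (a, b))%:R.
  transitivity (\sum_e inc e i * G e.1 e.2).
    apply: eq_bigr => e _; rewrite /G /inc ffunE /= /upper; case: e => a b /=.
    by case: ltnP => _; rewrite ?mul0r ?mul1r.
  by rewrite inc_sum // /G => a b; rewrite sym_adj_sym.
pose G (a b : 'I_n) : R := logistic (be a + be b).
transitivity (\sum_e inc e i * G e.1 e.2).
  by apply: eq_bigr => e _; rewrite /eprob /inc; case: (upper e); rewrite ?mul0r.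
by rewrite inc_sum // /G => a b; rewrite addrC.
Qed.

Lemma Ex_eps4 i : Ex (fun w => eps i w ^+ 4) <= 11 * n%:R ^+ 2.
Proof.
apply: le_trans (Ex_lin4 eprob01 _) _; rewrite ler_wpM2l //.
under eq_bigr do rewrite inc_sqr.
rewrite inc_col; apply: ler_expn_nneg; last by lra.
by rewrite subr_ge0 ler1n; have := ltn_ord i; lia.
Qed.

(** An edge meets at most two nodes, so its squared coefficient is at most twice the sum of
    [u i ^+ 2] over its ends. *)
Lemma Ex_dot_eps (u : 'I_n -> R) :
  Ex (fun w => (\sum_i u i * eps i w) ^+ 2) <= n%:R * nsq u / 2.
Proof.
have -> : Ex (fun w => (\sum_i u i * eps i w) ^+ 2) =
    Ex (fun w => (\sum_e (\sum_i u i * inc e i) * X e w) ^+ 2).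
  apply: eq_Ex => w; congr (_ ^+ 2); rewrite /eps.
  under eq_bigr do rewrite mulr_sumr.
  rewrite exchange_big; apply: eq_bigr => e _; rewrite mulr_suml.
  by apply: eq_bigr => i _; rewrite mulrA.
rewrite Ex_lin2.
apply: (@le_trans _ _ (\sum_e (2 * \sum_i inc e i * u i ^+ 2) * (1 / 4))).
  apply: ler_sum => e _; apply: ler_pM;
    [exact: sqr_ge0|exact: bvar_eprob_ge0| |exact: bvar_le].
  have -> : \sum_i u i * inc e i = \sum_i inc e i * (inc e i * u i).
    by apply: eq_bigr => i _; rewrite mulrA -expr2 inc_sqr mulrC.
  apply: le_trans (dot_CS _ _) _; apply: ler_pM; rewrite ?nsq_ge0 //.
    by rewrite /nsq; under eq_bigr do rewrite inc_sqr; exact: inc_row.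
  by apply: ler_of_eq; apply: eq_bigr => i _; rewrite exprMn inc_sqr.
rewrite -mulr_suml -mulr_sumr exchange_big /=.
under eq_bigr do rewrite -mulr_suml inc_col.
rewrite -mulr_sumr -/(nsq u); have := nsq_ge0 u; lra.
Qed.

Section Block.
Variable P : pred 'I_n.
Let r := #|P|%:R : R.

Definition incP e : R := \sum_(i | P i) inc e i.

Lemma incP_ge0 e : 0 <= incP e.
Proof. by apply: sumr_ge0 => i _; exact: inc_ge0. Qed.

Lemma incP_le2 e : incP e <= 2. Proof. exact: inc_row. Qed.

Lemma incP_sqr e : incP e ^+ 2 <= 2 * incP e.
Proof. by rewrite expr2 ler_wpM2r ?incP_ge0 ?incP_le2. Qed.

Lemma sumP_cst (x : R) : \sum_(i | P i) x = r * x.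
Proof. by rewrite sumr_const mulr_natl. Qed.

Lemma incP_sum : \sum_e incP e = r * (n%:R - 1).
Proof.
by rewrite exchange_big /=; under eq_bigr do rewrite inc_col; rewrite sumP_cst.
Qed.

Let r0 : 0 <= r. Proof. exact: ler0n. Qed.

Lemma Ex_sum_eps2 : Ex (fun w => (\sum_(i | P i) eps i w) ^+ 2) <= r * n%:R.
Proof.
have -> : Ex (fun w => (\sum_(i | P i) eps i w) ^+ 2) =
    Ex (fun w => (\sum_e incP e * X e w) ^+ 2).
  apply: eq_Ex => w; congr (_ ^+ 2); rewrite /eps exchange_big.
  by apply: eq_bigr => e _; rewrite mulr_suml.
rewrite Ex_lin2; apply: (@le_trans _ _ (\sum_e 2 * incP e * (1 / 4))).
  apply: ler_sum => e _; apply: ler_pM;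
    [exact: sqr_ge0|exact: bvar_eprob_ge0|exact: incP_sqr|exact: bvar_le].
rewrite -mulr_suml -mulr_sumr incP_sum; have := r0; have := mulr_ge0 r0 (ler0n R n); lra.
Qed.

Lemma Ex_sum_eps4 : Ex (fun w => \sum_(i | P i) eps i w ^+ 4) <= 11 * r * n%:R ^+ 2.
Proof.
rewrite Ex_sum mulrAC mulrC -sumP_cst; apply: ler_sum => i _; exact: Ex_eps4.
Qed.

(** The increment of [X e ^+ 2] in its own coordinate is the constant [1 - 2 * eprob e], so
    Efron-Stein leaves a sum bounded by that of [incP e ^+ 2]. *)
Lemma diag_variance : Ex (fun w => (\sum_e incP e * X e w ^+ 2 - \sum_e incP e * v e) ^+ 2)
  <= r * n%:R.
Proof.
have := efron_stein eprob01 (fun w => \sum_e incP e * X e w ^+ 2 - \sum_e incP e * v e).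
have -> : Ex (fun w => \sum_e incP e * X e w ^+ 2 - \sum_e incP e * v e) = 0.
  rewrite ExB Ex_cst Ex_sum; apply/eqP; rewrite subr_eq0; apply/eqP.
  apply: eq_bigr => e _; rewrite ExZ; congr (_ * _).
  have := @Ex_ctr2 _ _ eprob e (fun=> 1) (fun _ _ => erefl).
  by rewrite Ex_cst mulr1 => <-; apply: eq_Ex => w; rewrite mulr1.
rewrite expr0n add0r => /le_trans; apply.
apply: (@le_trans _ _ (\sum_e (1 / 4) * (2 * incP e))).
  apply: ler_sum => e _; apply: ler_pM; [exact: bvar_eprob_ge0| |exact: bvar_le|].
    by apply: Ex_ge0 => [|w]; [exact: eprob01|exact: sqr_ge0].
  apply: le_trans (incP_sqr e); rewrite -[leRHS](Ex_cst eprob).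
  apply: Ex_le => [|w]; first exact: eprob01.
  have -> : dlt e (fun w => \sum_e incP e * X e w ^+ 2 - \sum_e incP e * v e) w =
      incP e * (1 - 2 * eprob e).
    rewrite /dlt opprB addrA subrK (bigD1 e) //= [X in _ - X](bigD1 e) //= !ctr_upd /=.
    rewrite (eq_bigr (fun f => incP f * X f w ^+ 2)); last by move=> f fe; rewrite ctr_indep.
    rewrite [X in _ - (_ + X)](eq_bigr (fun f => incP f * X f w ^+ 2)); last first.
      by move=> f fe; rewrite ctr_indep.
    by ring.
  rewrite exprMn ler_piMr ?sqr_ge0 //.
  by have /andP[? ?] := eprob01 e; nra.
rewrite -!mulr_sumr incP_sum; have := r0; have := mulr_ge0 r0 (ler0n R n); lra.
Qed.

(** The mean is at most [r * n] by [Ex_lin3], and its square is absorbed using [r <= n]. For the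
    fluctuation, switching an edge affects at most two of the [eps i], each cube by at most
    [6 * (eps i ^+ 2 + 1)], and fourth moments give [432 * r * n ^+ 3]. Bounds on the individual
    cubes would lose a further factor of order [r]. *)
Lemma Ex_sum_eps3 : (1 <= n)%N -> r <= n%:R ->
  Ex (fun w => (\sum_(i | P i) eps i w ^+ 3) ^+ 2) <= 433 * r * n%:R ^+ 3.
Proof.
move=> n1 rn; have N1 : 1 <= n%:R :> R by rewrite ler1n.
have := efron_stein eprob01 (fun w => \sum_(i | P i) eps i w ^+ 3).
move=> /le_trans; apply.
have h1 : Ex (fun w => \sum_(i | P i) eps i w ^+ 3) ^+ 2 <= r * n%:R ^+ 3.
  have h : `|Ex (fun w => \sum_(i | P i) eps i w ^+ 3)| <= r * n%:R.
    rewrite Ex_sum; apply: le_trans (ler_norm_sum _ _ _) _; rewrite -sumP_cst.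
    apply: ler_sum => i _; apply: le_trans (Ex_lin3 eprob01 _) _.
    under eq_bigr do rewrite (ger0_norm (inc_ge0 _ _)) exprS inc_sqr -expr2 inc_sqr.
    by rewrite inc_col; lra.
  rewrite -[leLHS]real_normK ?num_real //.
  apply: le_trans (ler_expn_nneg 2 (normr_ge0 _) h) _.
  have -> : (r * n%:R) ^+ 2 = r * (n%:R ^+ 2 * r) by ring.
  apply: ler_wpM2l => //; rewrite [leRHS]exprSr.
  by apply: ler_wpM2l => //; exact: sqr_ge0.
have h2 : \sum_e v e * Ex (fun w => dlt e (fun w => \sum_(i | P i) eps i w ^+ 3) w ^+ 2)
    <= \sum_e (1 / 4) * \sum_(i | P i) 144 * (inc e i * (11 * n%:R ^+ 2 + 1)).
  apply: ler_sum => e _; apply: ler_pM; [exact: bvar_eprob_ge0| |exact: bvar_le|].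
    by apply: Ex_ge0 => [|w]; [exact: eprob01|exact: sqr_ge0].
  have : Ex (fun w => dlt e (fun w => \sum_(i | P i) eps i w ^+ 3) w ^+ 2) <=
     Ex (fun w => \sum_(i | P i) 144 * (inc e i * (eps i w ^+ 4 + 1))).
    apply: Ex_le => [|w]; first exact: eprob01.
    have db : `|dlt e (fun w => \sum_(i | P i) eps i w ^+ 3) w| <=
        \sum_i inc e i * (inc e i * (if P i then 6 * (eps i w ^+ 2 + 1) else 0)).
      rewrite /dlt -sumrB big_mkcond; apply: le_trans (ler_norm_sum _ _ _) _.
      apply: ler_sum => i _; case: ifP => _; last by rewrite normr0 !mulr0.
      rewrite /eps !lin_upd -/(eps i w) /= mulrA -expr2 inc_sqr.
      have := inc_ge0 e i; have := inc_le1 e i.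
      move: (inc e i) (eps i w) => c x c1 c0.
      have -> : (x + c * (1 - (w e)%:R)) ^+ 3 - (x + c * (0 - (w e)%:R)) ^+ 3 =
        c * (3 * x ^+ 2 + 3 * c * x * (1 - 2 * (w e)%:R) +
             c ^+ 2 * (1 - 3 * (w e)%:R + 3 * (w e)%:R ^+ 2)) by ring.
      rewrite normrM (ger0_norm c0) ler_wpM2l //.
      have cx : `|c * x| <= x ^+ 2 + 1.
        rewrite normrM (ger0_norm c0).
        have := normr_ge0 x; rewrite -[x ^+ 2]real_normK ?num_real //.
        by move: (`|x|) => y y0; nra.
      move: cx; rewrite !ler_norml => /andP[? ?].
      have c2 : c ^+ 2 <= 1 by rewrite exprn_ile1.
      have c20 := sqr_ge0 c; have x20 := sqr_ge0 x.
      by case: (w e) => /=; apply/andP; split; nra.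
    rewrite -[leLHS]real_normK ?num_real //.
    apply: le_trans (ler_expn_nneg 2 (normr_ge0 _) db) _.
    apply: le_trans (dot_CS _ _) _.
    apply: (@le_trans _ _ (2 * \sum_(i | P i) 72 * (inc e i * (eps i w ^+ 4 + 1)))).
      apply: ler_pM; rewrite ?nsq_ge0 //.
        by rewrite /nsq; under eq_bigr do rewrite inc_sqr; exact: inc_row.
      rewrite [leRHS]big_mkcond; apply: ler_sum => i _.
      case: ifP => _; last by rewrite mulr0 expr0n.
      rewrite [leLHS]exprMn inc_sqr [leRHS]mulrCA; apply: ler_wpM2l; first exact: inc_ge0.
      rewrite (_ : eps i w ^+ 4 = (eps i w ^+ 2) ^+ 2); last by rewrite -exprM.
      by have := sqr_ge0 (eps i w ^+ 2 - 1); nra.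
    by rewrite mulr_sumr; apply: ler_of_eq; apply: eq_bigr => i _; ring.
  move=> /le_trans; apply; rewrite Ex_sum; apply: ler_sum => i _.
  rewrite !ExZ ler_wpM2l // ler_wpM2l ?inc_ge0 // ExD Ex_cst lerD2r.
  exact: Ex_eps4.
apply: le_trans (lerD h1 h2) _.
have -> : \sum_e (1 / 4) * (\sum_(i | P i) 144 * (inc e i * (11 * n%:R ^+ 2 + 1))) =
    36 * (11 * n%:R ^+ 2 + 1) * (r * (n%:R - 1)).
  rewrite -incP_sum mulr_sumr; apply: eq_bigr => e _.
  have -> : \sum_(i | P i) 144 * (inc e i * (11 * n%:R ^+ 2 + 1)) =
      144 * (11 * n%:R ^+ 2 + 1) * incP e.
    by rewrite /incP mulr_sumr; apply: eq_bigr => i _; ring.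
  by field.
have N0 : 0 <= n%:R :> R by [].
have a1 : 1 <= n%:R ^+ 2 :> R by rewrite exprn_ege1.
have a2 : 36 * (11 * n%:R ^+ 2 + 1) * (r * (n%:R - 1)) <=
   36 * (12 * n%:R ^+ 2) * (r * n%:R).
  apply: ler_pM.
  - by rewrite mulr_ge0 //; lra.
  - by rewrite mulr_ge0 //; lra.
  - by rewrite ler_wpM2l //; lra.
  - by rewrite ler_wpM2l //; lra.
apply: le_trans (lerD (lexx _) a2) _.
by apply: ler_of_eq; ring.
Qed.

End Block.
End EdgeModel.

(** * The quadratic form in the edge variables *)

Section EdgeKernel.
Context {R : realType} {n : nat}.
Variables (be : 'I_n -> R) (P : pred 'I_n) (kap : R).
Hypothesis kap0 : 0 <= kap.
Local Notation edge := ('I_n * 'I_n)%type.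
Local Notation inc := (@inc R n).
Local Notation incP := (@incP R n).
Local Notation p := (eprob be).
Local Notation X := (ctr p).
Local Notation v := (bvar p).
Let r := #|P|%:R : R.
Implicit Types (e f k l m : edge).

Definition cooc e f : R := \sum_(i | P i) inc e i * inc f i.
(** Writing the sum of [eps i ^+ 2] over the block as a double sum over edges, this is its
    off-diagonal coefficient matrix, scaled by [kap]; the diagonal is left to [diag_variance]. *)
Definition ekern e f : R := if e == f then 0 else kap * cooc e f.
Definition finfo (i : 'I_n) : R := \sum_(j | j != i) dlogistic (be i + be j).

Lemma cooc_ge0 e f : 0 <= cooc e f.
Proof. by apply: sumr_ge0 => i _; rewrite mulr_ge0 ?inc_ge0. Qed.

Lemma cooc_sym e f : cooc e f = cooc f e.
Proof. by apply: eq_bigr => i _; rewrite mulrC. Qed.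

Lemma cooc_diag e : cooc e e = incP P e.
Proof. by apply: eq_bigr => i _; rewrite -expr2 inc_sqr. Qed.

Lemma cooc_le2 e f : cooc e f <= 2.
Proof.
apply: le_trans (inc_row P e); apply: ler_sum => i _.
by rewrite ler_piMr ?inc_ge0 ?inc_le1.
Qed.

Lemma ekern_ge0 e f : 0 <= ekern e f.
Proof. by rewrite /ekern; case: ifP => _ //; rewrite mulr_ge0 ?cooc_ge0. Qed.

Lemma ekern_sym e f : ekern e f = ekern f e.
Proof. by rewrite /ekern eq_sym cooc_sym. Qed.

Lemma ekern_le e f : ekern e f <= kap * cooc e f.
Proof. by rewrite /ekern; case: ifP => _ //; rewrite mulr_ge0 ?cooc_ge0. Qed.

Lemma cooc_total : \sum_e \sum_f cooc e f = r * (n%:R - 1) ^+ 2.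
Proof.
under eq_bigr do rewrite exchange_big.
rewrite exchange_big /= -sumP_cst; apply: eq_bigr => i _.
under eq_bigr do rewrite -mulr_sumr inc_col.
by rewrite -mulr_suml inc_col expr2.
Qed.

Lemma inc_gram1 (i j : 'I_n) : \sum_e inc e i * inc e j <= n%:R * (i == j)%:R + 1 :> R.
Proof.
have := @inc_gram R n (fun _ _ => 1) i j (fun _ _ => erefl).
under eq_bigr do rewrite mulr1.
move=> ->; case: (i == j); last by rewrite mulr0 add0r.
by rewrite sum_neq_cst !mulr1; lra.
Qed.

(** With [B] the incidence matrix restricted to the block, [cooc] is [B B^T] and its square is
    [B (B^T B) B^T]; entrywise [B^T B <= n I + J], because two distinct nodes share a single
    edge. *)
Lemma cooc_gram l m : \sum_k cooc k l * cooc k m <= n%:R * cooc l m + incP P l * incP P m.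
Proof.
have -> : \sum_k cooc k l * cooc k m =
   \sum_(i | P i) \sum_(j | P j) inc l i * inc m j * \sum_k inc k i * inc k j.
  under eq_bigr do rewrite /cooc mulr_suml.
  rewrite exchange_big /=; apply: eq_bigr => i _.
  under eq_bigr do rewrite mulr_sumr.
  rewrite exchange_big /=; apply: eq_bigr => j _; rewrite mulr_sumr.
  by apply: eq_bigr => k _; ring.
have -> : n%:R * cooc l m + incP P l * incP P m =
   \sum_(i | P i) \sum_(j | P j) inc l i * inc m j * (n%:R * (i == j)%:R + 1).
  have -> : incP P l * incP P m = \sum_(i | P i) \sum_(j | P j) inc l i * inc m j :> R.
    by rewrite /incP mulr_suml; apply: eq_bigr => i _; rewrite mulr_sumr.
  rewrite /cooc mulr_sumr -big_split; apply: eq_bigr => i Pi /=.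
  transitivity (\sum_(j | P j) (inc l i * inc m j * (n%:R * (i == j)%:R) + inc l i * inc m j)).
    rewrite big_split /=; congr (_ + _).
    rewrite (bigD1 i) //= eqxx big1 ?addr0 ?mulr1; first by rewrite mulrC.
    by move=> j /andP[_ ji]; rewrite eq_sym (negbTE ji) !mulr0.
  by apply: eq_bigr => j _; ring.
apply: ler_sum => i _; apply: ler_sum => j _.
by rewrite ler_wpM2l ?inc_gram1 // mulr_ge0 ?inc_ge0.
Qed.

(** The entries of [cooc] and [incP] are at most 2, so their squares are replaced by twice the
    entries and only total sums matter. With [kap] of order [1 / (n * sqrt r)] the result is of
    order [1 / r]. *)
Lemma tr4_ekern : (1 <= n)%N -> r <= n%:R -> tr4 ekern <= 12 * kap ^+ 4 * r * n%:R ^+ 4.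
Proof.
move=> n1 rn; have N1 : 1 <= n%:R :> R by rewrite ler1n.
have r0 : 0 <= r by exact: ler0n.
have k2 : 0 <= kap ^+ 2 by exact: sqr_ge0.
have k4 : 0 <= kap ^+ 4 by rewrite exprn_ge0.
have gb l m : gram ekern l m ^+ 2 <=
    kap ^+ 4 * (4 * n%:R ^+ 2 * cooc l m + 8 * (incP P l * incP P m)).
  have g1 : gram ekern l m <= kap ^+ 2 * (n%:R * cooc l m + incP P l * incP P m).
    apply: le_trans (ler_wpM2l k2 (cooc_gram l m)); rewrite mulr_sumr.
    apply: ler_sum => k _.
    have -> : kap ^+ 2 * (cooc k l * cooc k m) = (kap * cooc k l) * (kap * cooc k m) by ring.
    by apply: ler_pM; rewrite ?ekern_ge0 ?ekern_le.
  have g0 : 0 <= gram ekern l m by apply: gram_ge0 => k' l'; exact: ekern_ge0.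
  apply: le_trans (ler_expn_nneg 2 g0 g1) _; rewrite exprMn -exprM ler_wpM2l //.
  have c0 := cooc_ge0 l m; have c2 := cooc_le2 l m.
  have pl0 := incP_ge0 (R := R) P l; have pm0 := incP_ge0 (R := R) P m.
  have pl2 := incP_sqr (R := R) P l; have pm2 := incP_sqr (R := R) P m.
  have cc : n%:R ^+ 2 * cooc l m ^+ 2 <= n%:R ^+ 2 * (2 * cooc l m).
    by rewrite ler_wpM2l ?sqr_ge0 // expr2 ler_wpM2r.
  have pp : incP P l ^+ 2 * incP P m ^+ 2 <= 4 * (incP P l * incP P m).
    have -> : 4 * (incP P l * incP P m) = 2 * incP P l * (2 * incP P m) by ring.
    by apply: ler_pM; rewrite ?sqr_ge0.
  have := sqr_ge0 (n%:R * cooc l m - incP P l * incP P m).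
  move: cc pp; rewrite -!exprMn; move: (incP P l * incP P m) => y; move: (cooc l m) => x.
  move: (n%:R : R) => N cc pp h.
  have -> : (N * x + y) ^+ 2 = 2 * (N * x) ^+ 2 + 2 * y ^+ 2 - (N * x - y) ^+ 2 by ring.
  lra.
apply: le_trans (ler_sum _ (fun l _ => ler_sum _ (fun m _ => gb l m))) _.
have -> : \sum_l \sum_m kap ^+ 4 * (4 * n%:R ^+ 2 * cooc l m + 8 * (incP P l * incP P m)) =
   kap ^+ 4 * (4 * n%:R ^+ 2 * (r * (n%:R - 1) ^+ 2) + 8 * (r * (n%:R - 1)) ^+ 2).
  rewrite -cooc_total -(incP_sum P) expr2 [X in 8 * X]mulr_suml !mulr_sumr -big_split mulr_sumr.
  apply: eq_bigr => l _ /=; rewrite !mulr_sumr -big_split mulr_sumr.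
  by apply: eq_bigr => m _ /=; ring.
have -> : 12 * kap ^+ 4 * r * n%:R ^+ 4 = kap ^+ 4 * (12 * r * n%:R ^+ 4) by ring.
rewrite ler_wpM2l //.
have m1 : (n%:R - 1) ^+ 2 <= n%:R ^+ 2 :> R by apply: ler_expn_nneg; lra.
have m0 := sqr_ge0 (n%:R - 1 : R); have N2 := sqr_ge0 (n%:R : R).
have a1 : 4 * n%:R ^+ 2 * (r * (n%:R - 1) ^+ 2) <= 4 * n%:R ^+ 2 * (r * n%:R ^+ 2).
  by rewrite ler_wpM2l ?mulr_ge0 // ler_wpM2l.
have a2 : 8 * (r * (n%:R - 1)) ^+ 2 <= 8 * (r * (n%:R ^+ 2 * n%:R ^+ 2)).
  rewrite ler_wpM2l // exprMn expr2 -mulrA ler_wpM2l //.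
  apply: ler_pM => //; apply: le_trans rn _.
  by rewrite expr2 ler_peMl // ltW // (lt_le_trans ltr01).
apply: le_trans (lerD a1 a2) _; apply: ler_of_eq; ring.
Qed.

Lemma qform_ekern w : 2 * qform p ekern w =
  kap * (\sum_(i | P i) eps be i w ^+ 2 - \sum_e incP P e * X e w ^+ 2).
Proof.
rewrite qformE; last exact: ekern_sym.
have -> : \sum_e \sum_(f | f != e) ekern e f * X e w * X f w =
   \sum_e \sum_f kap * (cooc e f * X e w * X f w) - \sum_e kap * (cooc e e * X e w ^+ 2).
  rewrite -sumrB; apply: eq_bigr => e _; rewrite [X in _ = X - _](bigD1 e) //=.
  rewrite (eq_bigr (fun f => kap * (cooc e f * X e w * X f w))); first by ring.
  by move=> f fe; rewrite /ekern eq_sym (negbTE fe); ring.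
under [X in _ - X]eq_bigr do rewrite cooc_diag.
rewrite -mulr_sumr mulrBr; congr (_ - _).
under eq_bigr do rewrite -mulr_sumr.
rewrite -mulr_sumr; congr (_ * _); rewrite /cooc.
transitivity (\sum_e \sum_f \sum_(i | P i) (inc e i * X e w) * (inc f i * X f w)).
  apply: eq_bigr => e _; apply: eq_bigr => f _; rewrite !mulr_suml.
  by apply: eq_bigr => i _; ring.
under eq_bigr do rewrite exchange_big.
rewrite exchange_big /=; apply: eq_bigr => i _; rewrite /eps expr2 mulr_suml.
by apply: eq_bigr => e _; rewrite mulr_sumr.
Qed.

(** Exchanging sums turns a squared Hilbert-Schmidt norm over edges into that of the block of the
    Fisher information, with [finfo i] on the diagonal and single edge variances elsewhere. The
    errors come from at most [r ^+ 2] off-diagonal entries, each with square at most [1 / 16], and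
    from the removed terms [e = f]. *)
Lemma s2_ekern : kap ^+ 2 * (\sum_(i | P i) finfo i ^+ 2 - r * n%:R / 8) <= 2 * s2 p ekern
  <= kap ^+ 2 * (\sum_(i | P i) finfo i ^+ 2 + r ^+ 2 / 16).
Proof.
have k2 : 0 <= kap ^+ 2 by exact: sqr_ge0.
have r0 : 0 <= r by exact: ler0n.
have e1 : 2 * s2 p ekern = kap ^+ 2 * (\sum_e \sum_f cooc e f ^+ 2 * v e * v f
    - \sum_e incP P e ^+ 2 * v e ^+ 2).
  rewrite s2E; last exact: ekern_sym.
  rewrite mulrBr !mulr_sumr -sumrB; apply: eq_bigr => e _.
  rewrite mulr_sumr [X in _ = X - _](bigD1 e) //= cooc_diag.
  rewrite (eq_bigr (fun f => kap ^+ 2 * (cooc e f ^+ 2 * v e * v f))); first by ring.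
  by move=> f fe; rewrite /ekern eq_sym (negbTE fe); ring.
have e2 : \sum_e \sum_f cooc e f ^+ 2 * v e * v f =
   \sum_(i | P i) \sum_(j | P j) (\sum_e inc e i * inc e j * v e) ^+ 2.
  transitivity (\sum_e \sum_f \sum_(i | P i) \sum_(j | P j)
     (inc e i * inc e j * v e) * (inc f i * inc f j * v f)).
    apply: eq_bigr => e _; apply: eq_bigr => f _; rewrite expr2 -mulrA /cooc mulr_suml.
    rewrite mulr_suml; apply: eq_bigr => i _; rewrite mulr_sumr mulr_suml.
    by apply: eq_bigr => j _; ring.
  under eq_bigr do rewrite exchange_big.
  rewrite exchange_big /=; apply: eq_bigr => i _.
  under eq_bigr do rewrite exchange_big.
  rewrite exchange_big /=; apply: eq_bigr => j _.
  rewrite expr2 mulr_suml; apply: eq_bigr => e _; by rewrite mulr_sumr.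
have e3 i j : \sum_e inc e i * inc e j * v e =
   if i == j then finfo i else dlogistic (be i + be j).
  pose F (a b : 'I_n) : R := dlogistic (be a + be b).
  transitivity (\sum_e inc e i * inc e j * F e.1 e.2).
    by apply: eq_bigr => e _; rewrite -mulrA inc_bvar mulrA.
  by rewrite inc_gram // /F => a b; rewrite addrC.
have up : \sum_(i | P i) \sum_(j | P j) (\sum_e inc e i * inc e j * v e) ^+ 2 <=
    \sum_(i | P i) finfo i ^+ 2 + r ^+ 2 / 16.
  have -> : r ^+ 2 / 16 = \sum_(i | P i) r * (1 / 16) by rewrite sumP_cst; field.
  rewrite -big_split; apply: ler_sum => i Pi /=; rewrite (bigD1 i) //= e3 eqxx lerD2l.
  rewrite -sumP_cst big_mkcond [leRHS]big_mkcond; apply: ler_sum => j _.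
  case: (P j) => //=; case: eqP => [_|ij] /=; first by lra.
  rewrite e3; case: eqP => [ji|_]; first by case: ij.
  have := dlogistic_gt0 (be i + be j); have := dlogistic_le (be i + be j).
  by move: (dlogistic _) => x; nra.
have lo : \sum_(i | P i) finfo i ^+ 2 <=
    \sum_(i | P i) \sum_(j | P j) (\sum_e inc e i * inc e j * v e) ^+ 2.
  apply: ler_sum => i Pi; rewrite (bigD1 i) //= e3 eqxx lerDl sumr_ge0 // => j _.
  exact: sqr_ge0.
have dg : \sum_e incP P e ^+ 2 * v e ^+ 2 <= r * n%:R / 8.
  apply: (@le_trans _ _ (\sum_e 2 * incP P e * (1 / 16))).
    apply: ler_sum => e _; apply: ler_pM; rewrite ?sqr_ge0 ?incP_sqr //.
    have := bvar_eprob_ge0 be e; have := bvar_le p e.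
    by move: (v e) => x; nra.
  rewrite -mulr_suml -mulr_sumr incP_sum -/r; lra.
have d0 : 0 <= \sum_e incP P e ^+ 2 * v e ^+ 2.
  by apply: sumr_ge0 => e _; apply: mulr_ge0; exact: sqr_ge0.
by rewrite e1 e2; apply/andP; split; apply: ler_wpM2l => //; lra.
Qed.

End EdgeKernel.

(** * Graphs of fixed size *)

Lemma invr_mono (R : realFieldType) (x y : R) : 0 < x -> x <= y -> y^-1 <= x^-1.
Proof. by move=> x0 xy; rewrite lef_pV2 ?posrE // (lt_le_trans x0). Qed.

Section Assembly.
Context {R : realType} {n : nat}.
Variables (be : 'I_n -> R) (r : nat) (b M : R).
Hypothesis r4 : (4 <= r)%N.
Hypothesis rn : (r <= n)%N.
Hypothesis be0 : Theta0 r be.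
Hypothesis b1 : 1 <= b.
Hypothesis M1 : 1 <= M.
Hypothesis nu_lb : forall i j, i != j -> 1 / b <= dlogistic (be i + be j).
Hypothesis big_r : 4 ^+ 8 * b ^+ 6 * M ^+ 3 <= Num.sqrt (r%:R : R).

Let n4 : (4 <= n)%N. Proof. exact: leq_trans r4 rn. Qed.
Let n0 : (0 < n)%N. Proof. exact: leq_trans n4. Qed.
Definition fst_ord : 'I_n := Ordinal n0.
Definition blk : pred 'I_n := [pred i : 'I_n | (i < r)%N].
Definition rep (i : 'I_n) : 'I_n := if blk i then fst_ord else i.
Local Notation i0 := fst_ord.
Local Notation P := blk.

Lemma blk0 : P i0. Proof. by rewrite /blk /=; exact: leq_trans r4. Qed.

Lemma card_blk : #|P| = r.
Proof. by rewrite -sum1_card /= -(big_ord_widen n (fun=> 1%N) rn) sum1_card card_ord. Qed.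

Lemma blk_const (g : 'I_n -> R) : Theta0 r g -> forall i, P i -> g i = g i0.
Proof. by move=> gT i Pi; apply: gT => //; exact: blk0. Qed.

Lemma rep_idem i : rep (rep i) = rep i.
Proof. by rewrite /rep; case: (boolP (P i)) => [_|/negbTE ->]; rewrite ?blk0. Qed.

Lemma rep_Theta0 (g : 'I_n -> R) : (forall i, g i = g (rep i)) <-> Theta0 r g.
Proof.
split=> [gr i j ir jr|gT i].
  by rewrite gr [RHS]gr /rep /blk /= ir jr.
by rewrite /rep; case: ifP => // Pi; exact: blk_const.
Qed.

Local Notation N := (n%:R : R).
Local Notation rr := (r%:R : R).
Let s := Num.sqrt rr.
Let sn := Num.sqrt N.

Lemma s_sqr : s ^+ 2 = rr. Proof. by rewrite sqr_sqrtr. Qed.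
Lemma sn_sqr : sn ^+ 2 = N. Proof. by rewrite sqr_sqrtr. Qed.
Lemma s_ge1 : 1 <= s.
Proof. by rewrite -[leLHS]sqrtr1 ler_sqrt // ler1n; exact: leq_trans r4. Qed.
Lemma s_le_sn : s <= sn. Proof. by rewrite ler_sqrt // ler_nat. Qed.

Lemma N_big : (4 ^+ 8) ^+ 2 * b ^+ 12 * M ^+ 6 <= N.
Proof.
have b0 : 0 <= b by have := b1; lra.
have M0 : 0 <= M by have := M1; lra.
have h0 : 0 <= 4 ^+ 8 * b ^+ 6 * M ^+ 3.
  by apply: mulr_ge0; [apply: mulr_ge0|]; rewrite exprn_ge0.
apply: (@le_trans _ _ rr); last by rewrite ler_nat.
rewrite -s_sqr; apply: le_trans (ler_expn_nneg 2 h0 big_r).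
by apply: ler_of_eq; ring.
Qed.

Lemma pow_le (k l k' l' : nat) : (k <= k')%N -> (l <= l')%N ->
  b ^+ k * M ^+ l <= b ^+ k' * M ^+ l'.
Proof.
move=> kk ll; have b0 : 0 <= b by have := b1; lra.
have M0 : 0 <= M by have := M1; lra.
apply: ler_pM; rewrite ?exprn_ge0 //; apply: ler_weXn2l => //.
Qed.

(** Later requirements that [N] be large compare it with a monomial in [b] and [M]; they all follow
    from the square of [big_r]. *)
Lemma monomial_le_N (c : R) (k l : nat) : 0 <= c -> c <= (4 ^+ 8) ^+ 2 ->
  (k <= 12)%N -> (l <= 6)%N -> c * (b ^+ k * M ^+ l) <= N.
Proof.
move=> c0 cc kk ll; apply: le_trans N_big; rewrite -[leRHS]mulrA.
have b0 : 0 <= b by have := b1; lra.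
have M0 : 0 <= M by have := M1; lra.
by apply: ler_pM => //; [rewrite mulr_ge0 ?exprn_ge0|exact: pow_le].
Qed.

Let lb := lam be i0.

Lemma lam_lb : N / (2 * b) <= lb.
Proof.
have b0 : 0 < b by have := b1; lra.
have N4 : 4 <= N by rewrite ler_nat.
have := @lam_ge R n be P i0 b blk0 (blk_const be0) n4 _ b1 nu_lb.
rewrite card_blk => /(_ r4); apply: le_trans.
rewrite ler_pdivrMr; last by lra.
have -> : (N - 2) / b * (2 * b) = (N - 2) * 2 by field; exact: lt0r_neq0.
lra.
Qed.

Section Event.
Variable (A : adj n).
Let e i := grad A be i.
Let SP (F : 'I_n -> R) := \sum_(i | P i) F i.
Variable U : R.
Hypothesis U_small : U <= b * M * N / rr.
Hypothesis G1 : \sum_i e i ^+ 4 <= M * N ^+ 3.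
Hypothesis G3 : SP (fun i => e i ^+ 4) <= M * rr * N ^+ 2.
Hypothesis G4 : SP e ^+ 2 <= M * rr * N.
Hypothesis G5 : SP (fun i => e i ^+ 3) ^+ 2 <= M * rr * N ^+ 3.

Let b0 : 0 < b. Proof. by have := b1; lra. Qed.
Let M0 : 0 < M. Proof. by have := M1; lra. Qed.
Let N4 : 4 <= N. Proof. by rewrite ler_nat. Qed.
Let N0 : 0 < N. Proof. by have := N4; lra. Qed.
Let r0 : 0 < rr. Proof. by rewrite ltr0n; exact: leq_trans r4. Qed.
Let rN : rr <= N. Proof. by rewrite ler_nat. Qed.
Let s0 : 0 < s. Proof. by have := s_ge1; lra. Qed.
Let sn0 : 0 < sn. Proof. by have := s_ge1; have := s_le_sn; lra. Qed.

(** Using [M] in place of its square root, legitimate as [M >= 1], keeps all later bounds monomials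
    in [M]. *)
Lemma sqr_bound (x y : R) : 0 <= y -> x ^+ 2 <= M * y ^+ 2 -> `|x| <= M * y.
Proof.
move=> y0 h; have m0 := M0; have m1 := M1.
have My : 0 <= M * y by rewrite mulr_ge0 // ltW.
rewrite -(@ler_pXn2r _ 2) ?nnegrE // real_normK ?num_real //.
apply: le_trans h _; rewrite exprMn ler_wpM2r ?sqr_ge0 //.
by rewrite expr2 ler_peMl // ltW.
Qed.

(** The sum of fourth powers supplies both inputs of [restricted_mle]: the squared norm by
    Cauchy-Schwarz, and the sup-norm condition because a single [e i] is then at most of order
    [N^(3/4)]. *)
Lemma mle_exists : exists h, [/\ forall i, h i = h (rep i), forall i, `|h i| <= 1 / 4,
  nsq h <= 64 * b ^+ 2 * M &
  forall g, (forall i, g i = g (rep i)) -> loglik A g <= loglik A (shift be h)].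
Proof.
have NB := N_big; have b_1 := b1; have M_1 := M1; have b_0 := b0.
have n2 : nsq e <= M * N ^+ 2.
  have h : nsq e ^+ 2 <= M * (N ^+ 2) ^+ 2.
    apply: le_trans (nsq_sqr_le e) _.
    apply: le_trans (ler_wpM2l (ltW N0) G1) _.
    by apply: ler_of_eq; ring.
  by have := sqr_bound (sqr_ge0 N) h; rewrite ger0_norm // nsq_ge0.
have big1 : 64 ^+ 3 * b ^+ 4 * M <= N.
  have c1 : 64 ^+ 3 <= (4 ^+ 8) ^+ 2 :> R.
    have -> : 64 ^+ 3 = 4 ^+ 9 :> R by ring.
    by rewrite -exprM; apply: ler_weXn2l => //; lra.
  have := monomial_le_N (exprn_ge0 3 (ler0n _ 64)) c1 (isT : (4 <= 12)%N) (isT : (1 <= 6)%N).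
  by apply: le_trans; apply: ler_of_eq; ring.
have goo i : `|e i| <= N / (64 * b) / 4.
  have q0 : 0 <= N / (64 * b) / 4 by rewrite !divr_ge0 ?mulr_ge0 ?ltW.
  rewrite -(@ler_pXn2r _ 4) ?nnegrE // -normrX ger0_norm ?exprn_even_ge0 //.
  apply: le_trans (_ : M * N ^+ 3 <= _).
    apply: le_trans G1; rewrite [leRHS](bigD1 i) //= lerDl sumr_ge0 // => j _.
    by rewrite exprn_even_ge0.
  have -> : (N / (64 * b) / 4) ^+ 4 = (N / (4 ^+ 16 * b ^+ 4)) * N ^+ 3.
    by field; exact: lt0r_neq0.
  apply: ler_wpM2r; first by rewrite exprn_ge0.
  rewrite ler_pdivlMr; last by rewrite mulr_gt0 // exprn_gt0.
  have c0 : 0 <= (4 ^+ 8) ^+ 2 :> R by rewrite sqr_ge0.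
  have := monomial_le_N c0 (lexx _) (isT : (4 <= 12)%N) (isT : (1 <= 6)%N).
  by apply: le_trans; apply: ler_of_eq; ring.
have bc i : be i = be (rep i) by have /rep_Theta0 := be0; exact.
exact: (@restricted_mle R n A be rep b M rep_idem bc n4 b1 nu_lb n2 goo big1).
Qed.

Variable h : 'I_n -> R.
Hypothesis hc : forall i, h i = h (rep i).
Hypothesis h4 : forall i, `|h i| <= 1 / 4.
Hypothesis hmax : forall g, (forall i, g i = g (rep i)) -> loglik A g <= loglik A (shift be h).
Let z := shift be h.
Let g i := grad A z i.
Let m := SP e / rr.
Let lz := lam z i0.
Hypothesis HU : `|lz - lb| <= `|U| + 3 * b ^+ 2 * N * (64 * b ^+ 2 * M) / rr.
Hypothesis U0 : 0 <= U.

Let zT : Theta0 r z.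
Proof.
apply/rep_Theta0 => i; rewrite /z /shift -hc; congr (_ + _).
by have /rep_Theta0 := be0; exact.
Qed.

Lemma z_stationary u : (forall i, P i -> u i = u i0) -> \sum_i g i * u i = 0.
Proof.
move=> uP; apply: max_stationary => t; apply: hmax => i.
have ur : u i = u (rep i) by rewrite /rep; case: ifP => // Pi; exact: uP.
by have /rep_Theta0 zr := zT; rewrite /shift -zr -ur.
Qed.

Lemma g_out i : ~~ P i -> g i = 0.
Proof.
move=> Pi; have := @z_stationary (fun j => (j == i)%:R).
rewrite (bigD1 i) //= eqxx mulr1 big1 ?addr0; last first.
  by move=> j /negbTE ->; rewrite mulr0.
apply=> j Pj; have -> : (j == i) = false by apply: contraNF Pi => /eqP <-.
by have -> : (i0 == i) = false by apply: contraNF Pi => /eqP <-; exact: blk0.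
Qed.

Lemma g_sum : \sum_i g i = 0.
Proof.
have := @z_stationary (fun=> 1) (fun _ _ => erefl).
by under eq_bigr do rewrite mulr1.
Qed.

Lemma sumP_blk (x : R) : SP (fun=> x) = rr * x.
Proof. by rewrite /SP sumr_const mulr_natl card_blk. Qed.

Lemma grad_blk (y : 'I_n -> R) i : Theta0 r y -> P i ->
  grad A y i = degree A i - (\sum_j logistic (y i0 + y j) - logistic (y i0 + y i0)).
Proof. by move=> yT Pi; rewrite /grad sum_neq (blk_const yT Pi). Qed.

(** Inside the block the scores at [z] and at the truth differ by a constant independent of the
    node. As [g] sums to zero over the block, this constant is the mean [m]. *)
Lemma g_in i : P i -> g i = e i - m.
Proof.
pose c := (\sum_j logistic (z i0 + z j) - logistic (z i0 + z i0)) -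
          (\sum_j logistic (be i0 + be j) - logistic (be i0 + be i0)).
have gE j : P j -> g j = e j - c.
  by move=> Pj; rewrite /g /e !grad_blk // /c; ring.
have : SP g = 0.
  by rewrite -g_sum [RHS](bigID P) /= [X in _ + X]big1 ?addr0 // => j /g_out.
rewrite /SP (eq_bigr (fun j => e j - c)) // sumrB -/(SP e) -/(SP (fun=> c)) sumP_blk.
move=> /eqP; rewrite subr_eq0 => /eqP eS Pi.
by rewrite gE // /m eS mulrC mulKf // lt0r_neq0.
Qed.

Lemma sumP_out (F : R -> R) : F 0 = 0 -> \sum_i F (g i) = SP (fun i => F (e i - m)).
Proof.
move=> F0; rewrite (bigID P) /= [X in _ + X]big1 ?addr0 => [|i /g_out -> //].
by apply: eq_bigr => i Pi; rewrite g_in.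
Qed.

Lemma m_bound : `|m| <= M * (sn / s).
Proof.
apply: sqr_bound; first by rewrite divr_ge0 // ltW.
have -> : M * (sn / s) ^+ 2 = M * (N / rr).
  by rewrite exprMn exprVn sn_sqr s_sqr.
rewrite /m exprMn exprVn ler_pdivrMr ?exprn_gt0 //.
apply: le_trans G4 _; apply: ler_of_eq; field; exact: lt0r_neq0.
Qed.

Lemma m_sqr : rr * m ^+ 2 <= M * N.
Proof.
have -> : rr * m ^+ 2 = SP e ^+ 2 / rr by rewrite /m; field; exact: lt0r_neq0.
by rewrite ler_pdivrMr //; apply: le_trans G4 _; apply: ler_of_eq; ring.
Qed.

Lemma sumP_sqr : SP (fun i => e i ^+ 2) <= M * (rr * N).
Proof.
have q0 : 0 <= rr * N by rewrite mulr_ge0.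
apply: le_trans (ler_norm _) _; apply: sqr_bound => //.
have cs : SP (fun i => e i ^+ 2) ^+ 2 <= rr * SP (fun i => e i ^+ 4).
  pose x (i : 'I_n) : R := if P i then 1 else 0.
  pose y (i : 'I_n) : R := if P i then e i ^+ 2 else 0.
  have := dot_CS x y.
  have -> : \sum_i x i * y i = SP (fun i => e i ^+ 2).
    rewrite /SP [RHS]big_mkcond; apply: eq_bigr => i _; rewrite /x /y.
    by case: ifP; rewrite ?mul1r ?mul0r.
  have -> : nsq x = rr.
    rewrite -[RHS]mulr1 -sumP_blk /SP [RHS]big_mkcond; apply: eq_bigr => i _; rewrite /x.
    by case: ifP; rewrite ?expr1n ?expr0n.
  have -> : nsq y = SP (fun i => e i ^+ 4).
    rewrite /SP [RHS]big_mkcond; apply: eq_bigr => i _; rewrite /y.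
    by case: ifP; rewrite ?expr0n // -exprM.
  by [].
apply: le_trans cs _; apply: le_trans (ler_wpM2l (ltW r0) G3) _.
by apply: ler_of_eq; ring.
Qed.

Lemma nsq_g : nsq g = SP (fun i => e i ^+ 2) - rr * m ^+ 2.
Proof.
rewrite /nsq (sumP_out (F := fun x => x ^+ 2)) ?expr0n //.
transitivity (SP (fun i => e i ^+ 2 - 2 * m * e i + m ^+ 2)).
  by apply: eq_bigr => i _; ring.
rewrite /SP big_split /= sumrB -mulr_sumr -/(SP e) -/(SP (fun=> m ^+ 2)) sumP_blk.
rewrite -/(SP (fun i => e i ^+ 2)).
have -> : SP e = rr * m by rewrite /m mulrC divfK // lt0r_neq0.
by ring.
Qed.

(** The signed sum of cubes is small by [G5]; the terms produced by centring do not exceed the same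
    order [s * N * sn], because [m] is of order [sn / s]. *)
Lemma sum_g3 : `|\sum_i g i ^+ 3| <= 6 * M ^+ 3 * (s * N * sn).
Proof.
rewrite (sumP_out (F := fun x => x ^+ 3)) ?expr0n //.
have -> : SP (fun i => (e i - m) ^+ 3) =
   SP (fun i => e i ^+ 3) - 3 * m * SP (fun i => e i ^+ 2) + 2 * (rr * m ^+ 3).
  transitivity (SP (fun i => e i ^+ 3 - 3 * m * e i ^+ 2 + 3 * m ^+ 2 * e i - m ^+ 3)).
    by apply: eq_bigr => i _; ring.
  rewrite /SP sumrB -/(SP (fun=> m ^+ 3)) sumP_blk big_split /= sumrB -!mulr_sumr -/(SP e).
  have -> : SP e = rr * m by rewrite /m mulrC divfK // lt0r_neq0.
  by rewrite -/(SP (fun i => e i ^+ 3)) -/(SP (fun i => e i ^+ 2)); ring.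
have M_1 := M1; have m0 := ltW M0.
have W0 : 0 <= s * N * sn by rewrite !mulr_ge0 // ltW.
have t1 : `|SP (fun i => e i ^+ 3)| <= M ^+ 3 * (s * N * sn).
  apply: (@le_trans _ _ (M * (s * N * sn))).
    apply: sqr_bound => //; apply: le_trans G5 _.
    by rewrite !exprMn s_sqr sn_sqr; apply: ler_of_eq; ring.
  rewrite ler_wpM2r // -[leLHS]expr1; apply: ler_weXn2l => //.
have mb := m_bound.
have t2 : `|3 * m * SP (fun i => e i ^+ 2)| <= 3 * (M ^+ 3 * (s * N * sn)).
  rewrite -[3 * m * _]mulrA normrM (ger0_norm (ler0n _ 3)) ler_wpM2l // [`|m * _|]normrM.
  have S0 : 0 <= SP (fun i => e i ^+ 2) by apply: sumr_ge0 => i _; exact: sqr_ge0.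
  rewrite (ger0_norm S0).
  apply: le_trans (ler_pM (normr_ge0 _) S0 mb sumP_sqr) _.
  have -> : M * (sn / s) * (M * (rr * N)) = M ^+ 2 * (s * N * sn).
    by rewrite -s_sqr; field; exact: lt0r_neq0.
  by rewrite ler_wpM2r //; apply: ler_weXn2l.
have t3 : `|2 * (rr * m ^+ 3)| <= 2 * (M ^+ 3 * (s * N * sn)).
  rewrite normrM (ger0_norm (ler0n _ 2)) ler_wpM2l // normrM (ger0_norm (ltW r0)) normrX.
  apply: le_trans (ler_wpM2l (ltW r0) (ler_expn_nneg 3 (normr_ge0 _) mb)) _.
  have -> : rr * (M * (sn / s)) ^+ 3 = M ^+ 3 * (sn ^+ 2 * sn / s).
    by rewrite -s_sqr; field; exact: lt0r_neq0.
  rewrite sn_sqr ler_wpM2l ?exprn_ge0 // ler_pdivrMr //.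
  have -> : s * N * sn * s = (N * sn) * s ^+ 2 by ring.
  apply: ler_peMr; first by rewrite mulr_ge0 // ltW.
  by rewrite s_sqr ler1n; exact: leq_trans r4.
apply: le_trans (ler_normD _ _) _; apply: le_trans (lerD (ler_normB _ _) (lexx _)) _.
apply: le_trans (lerD (lerD t1 t2) t3) _.
by apply: ler_of_eq; ring.
Qed.

Lemma sum_g4 : \sum_i g i ^+ 4 <= 16 * M ^+ 2 * (rr * N ^+ 2).
Proof.
rewrite (sumP_out (F := fun x => x ^+ 4)) ?expr0n //.
have h1 : SP (fun i => (e i - m) ^+ 4) <= SP (fun i => 8 * e i ^+ 4 + 8 * m ^+ 4).
  apply: ler_sum => i _; move: (e i) m => x y.
  have -> : 8 * x ^+ 4 + 8 * y ^+ 4 = (x - y) ^+ 4 +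
    (x + y) ^+ 2 * (7 * x ^+ 2 - 10 * x * y + 7 * y ^+ 2) by ring.
  rewrite lerDl mulr_ge0 ?sqr_ge0 //.
  by have := sqr_ge0 (x - y); have := sqr_ge0 x; have := sqr_ge0 y; nra.
apply: le_trans h1 _; rewrite /SP big_split /= -mulr_sumr -/(SP (fun=> 8 * m ^+ 4)) sumP_blk.
have m4 : rr * (8 * m ^+ 4) <= 8 * (M ^+ 2 * (rr * N ^+ 2)).
  have ms := m_sqr; have mm : 0 <= rr * m ^+ 2 by rewrite mulr_ge0 ?sqr_ge0.
  have h2 := ler_expn_nneg 2 mm ms.
  have -> : rr * (8 * m ^+ 4) = 8 * ((rr * m ^+ 2) ^+ 2 / rr).
    by field; exact: lt0r_neq0.
  rewrite ler_wpM2l // ler_pdivrMr //; apply: le_trans h2 _.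
  have -> : M ^+ 2 * (rr * N ^+ 2) * rr = (M * N) ^+ 2 * rr ^+ 2 by ring.
  apply: ler_peMr; first exact: sqr_ge0.
  by apply: exprn_ege1; rewrite ler1n; exact: leq_trans r4.
have G3' : 8 * SP (fun i => e i ^+ 4) <= 8 * (M ^+ 2 * (rr * N ^+ 2)).
  rewrite ler_wpM2l //; apply: le_trans G3 _; rewrite -[leLHS]mulrA.
  apply: ler_wpM2r; first by rewrite mulr_ge0 ?sqr_ge0.
  by rewrite -[leLHS]expr1; apply: ler_weXn2l.
apply: le_trans (lerD G3' m4) _; by apply: ler_of_eq; ring.
Qed.

Let nu_z i j : i != j -> 1 / (2 * b) <= dlogistic (z i + z j).
Proof.
move=> ij; have -> : z i + z j = be i + be j + (h i + h j) by rewrite /z /shift addrACA.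
apply: le_trans (dlogistic_half (be i + be j) _ _); last first.
  by apply: le_trans (ler_normD _ _) _; have := h4 i; have := h4 j; lra.
have := nu_lb ij; have -> : 1 / (2 * b) = 1 / b / 2 by field; exact: lt0r_neq0.
lra.
Qed.

Lemma lz_lb : N / (4 * b) <= lz.
Proof.
have b_0 := b0; have b_1 := b1; have N_4 := N4.
have := @lam_ge R n z P i0 (2 * b) blk0 (blk_const zT) n4 _ _ nu_z.
rewrite card_blk => /(_ r4 ltac:(lra)); apply: le_trans.
rewrite ler_pdivrMr; last by lra.
have -> : (N - 2) / (2 * b) * (4 * b) = (N - 2) * 2 by field; exact: lt0r_neq0.
lra.
Qed.

Let lz0 : 0 < lz.
Proof. by apply: lt_le_trans lz_lb; rewrite divr_gt0 // mulr_gt0. Qed.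

Let lb0 : 0 < lb.
Proof. by apply: lt_le_trans lam_lb; rewrite divr_gt0 // mulr_gt0. Qed.

Let lzV : lz^-1 <= 4 * b / N.
Proof.
have -> : 4 * b / N = (N / (4 * b))^-1 by rewrite invf_div.
by apply: invr_mono lz_lb; rewrite divr_gt0 // mulr_gt0.
Qed.

Let lbV : lb^-1 <= 2 * b / N.
Proof.
have -> : 2 * b / N = (N / (2 * b))^-1 by rewrite invf_div.
by apply: invr_mono lam_lb; rewrite divr_gt0 // mulr_gt0.
Qed.

Let d i := g i / lz.

Lemma sum_d4 : \sum_i d i ^+ 4 <= 64 ^+ 2 * (b ^+ 4 * M ^+ 2) / N.
Proof.
have -> : \sum_i d i ^+ 4 = (\sum_i g i ^+ 4) * lz^-1 ^+ 4.
  by rewrite mulr_suml; apply: eq_bigr => i _; rewrite exprMn.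
have li0 : 0 <= lz^-1 by rewrite invr_ge0 ltW.
have g0 : 0 <= \sum_i g i ^+ 4 by apply: sumr_ge0 => i _; rewrite exprn_even_ge0.
apply: le_trans (ler_pM g0 (exprn_ge0 4 li0) sum_g4 (ler_expn_nneg 4 li0 lzV)) _.
have -> : 16 * M ^+ 2 * (rr * N ^+ 2) * (4 * b / N) ^+ 4 =
   64 ^+ 2 * (b ^+ 4 * M ^+ 2) / N * (rr / N) by field; exact: lt0r_neq0.
rewrite ler_piMr //; last by rewrite ler_pdivrMr // mul1r.
by rewrite divr_ge0 ?mulr_ge0 ?exprn_ge0 ?ltW.
Qed.

Lemma sum_d3 : N / 12 * `|\sum_i d i ^+ 3| <= 32 * (b ^+ 3 * M ^+ 3).
Proof.
have -> : \sum_i d i ^+ 3 = (\sum_i g i ^+ 3) * lz^-1 ^+ 3.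
  by rewrite mulr_suml; apply: eq_bigr => i _; rewrite exprMn.
have li0 : 0 <= lz^-1 by rewrite invr_ge0 ltW.
rewrite normrM normrX (ger0_norm li0).
have c0 : 0 <= N / 12 by rewrite divr_ge0.
apply: le_trans (ler_wpM2l c0 (ler_pM (normr_ge0 _) (exprn_ge0 3 li0) sum_g3
  (ler_expn_nneg 3 li0 lzV))) _.
have -> : N / 12 * (6 * M ^+ 3 * (s * N * sn) * (4 * b / N) ^+ 3) =
   32 * (b ^+ 3 * M ^+ 3) * (s * sn / N) by field; exact: lt0r_neq0.
rewrite ler_piMr //; first by rewrite !mulr_ge0 ?exprn_ge0 ?ltW.
rewrite ler_pdivrMr // mul1r -sn_sqr expr2 ler_wpM2r ?s_le_sn //; exact: ltW.
Qed.

(** Three replacements, each costing a multiple of [b ^+ 6 * M ^+ 3]: the likelihood gain by its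
    Newton value, [lam] at [z] by [lam] at the truth, and centred scores by true ones. In the
    second, [lam] changes by order [N / r], while [nsq g] is of order [r * N] and both values of
    [lam] are of order [N], so the powers of [N] and [r] cancel. *)
Lemma lrt_deterministic : exists gh, (forall y, loglik A y <= loglik A gh) /\
  `|2 * (loglik A gh - loglik A z) - SP (fun i => e i ^+ 2) / lb| <=
  8 * 64 ^+ 2 * (b ^+ 6 * M ^+ 3).
Proof.
have b_0 := b0; have b_1 := b1; have M_1 := M1; have M_0 := M0; have NB := N_big.
have d4c : 64 ^+ 2 * b ^+ 2 * (\sum_i d i ^+ 4) <= 1.
  have q0 : 0 <= 64 ^+ 2 * b ^+ 2 by rewrite mulr_ge0 ?exprn_ge0 ?ltW.
  apply: le_trans (ler_wpM2l q0 sum_d4) _; rewrite [leLHS]mulrA ler_pdivrMr // mul1r.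
  have c1 : 4 ^+ 12 <= (4 ^+ 8) ^+ 2 :> R by rewrite -exprM; apply: ler_weXn2l => //; lra.
  have := monomial_le_N (exprn_ge0 12 (ler0n _ 4)) c1 (isT : (6 <= 12)%N) (isT : (2 <= 6)%N).
  by apply: le_trans; apply: ler_of_eq; ring.
have [gh [ghmax ghv]] := lrt_expansion (blk_const zT) n4 b1 nu_z g_out g_sum lz0 d4c.
exists gh; split => //.
rewrite -/z -/lz -/g -/d in ghv.
have v1 : `|loglik A gh - loglik A z - nsq g / (2 * lz)| <=
    32 * (b ^+ 6 * M ^+ 3) + 3 * 64 ^+ 2 * (b ^+ 6 * M ^+ 3).
  apply: le_trans ghv _; apply: lerD.
    apply: le_trans sum_d3 _; rewrite ler_wpM2l //; exact: pow_le.
  have q0 : 0 <= 3 * b * N by rewrite mulr_ge0 // mulr_ge0 // ltW.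
  apply: le_trans (ler_wpM2l q0 sum_d4) _.
  have -> : 3 * b * N * (64 ^+ 2 * (b ^+ 4 * M ^+ 2) / N) =
    3 * 64 ^+ 2 * (b ^+ 5 * M ^+ 2) by field; exact: lt0r_neq0.
  apply: ler_wpM2l; first by rewrite mulr_ge0 // exprn_ge0.
  exact: pow_le.
have dl : `|lz - lb| <= 193 * (b ^+ 4 * M) * (N / rr).
  apply: le_trans HU _; rewrite (ger0_norm U0).
  have -> : 193 * (b ^+ 4 * M) * (N / rr) = b ^+ 4 * M * N / rr +
    3 * b ^+ 2 * N * (64 * b ^+ 2 * M) / rr by field; exact: lt0r_neq0.
  rewrite lerD2r; apply: le_trans U_small _.
  rewrite ler_pM2r ?invr_gt0 // ler_pM2r // ler_pM2r //.
  by rewrite -[leLHS]expr1; apply: ler_weXn2l.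
have ng0 := nsq_ge0 g.
have ng1 : nsq g <= M * (rr * N).
  apply: le_trans sumP_sqr; rewrite nsq_g gerBl mulr_ge0 ?sqr_ge0 //.
have v2 : `|nsq g / lz - nsq g / lb| <= 1544 * (b ^+ 6 * M ^+ 3).
  have -> : nsq g / lz - nsq g / lb = nsq g * (lb - lz) * (lz^-1 * lb^-1).
    by field; apply/andP; split; exact: lt0r_neq0.
  have li0 : 0 <= lz^-1 by rewrite invr_ge0 ltW.
  have li1 : 0 <= lb^-1 by rewrite invr_ge0 ltW.
  rewrite normrM (ger0_norm (mulr_ge0 li0 li1)) normrM (ger0_norm ng0) [`|lb - _|]distrC.
  have q1 := ler_pM ng0 (normr_ge0 _) ng1 dl.
  have q2 := ler_pM li0 li1 lzV lbV.
  apply: le_trans (ler_pM (mulr_ge0 ng0 (normr_ge0 _)) (mulr_ge0 li0 li1) q1 q2) _.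
  have -> : M * (rr * N) * (193 * (b ^+ 4 * M) * (N / rr)) * (4 * b / N * (2 * b / N)) =
    1544 * (b ^+ 6 * M ^+ 2) by field; apply/andP; split; exact: lt0r_neq0.
  by apply: ler_wpM2l; [exact: ler0n|exact: pow_le].
have v3 : `|nsq g / lb - SP (fun i => e i ^+ 2) / lb| <= 2 * (b ^+ 6 * M ^+ 3).
  have li1 : 0 <= lb^-1 by rewrite invr_ge0 ltW.
  rewrite nsq_g -mulrBl addrAC subrr add0r normrM normrN (ger0_norm li1).
  have mm : 0 <= rr * m ^+ 2 by rewrite mulr_ge0 ?sqr_ge0.
  rewrite (ger0_norm mm); apply: le_trans (ler_pM mm li1 m_sqr lbV) _.
  have -> : M * N * (2 * b / N) = 2 * (b ^+ 1 * M ^+ 1) by field; exact: lt0r_neq0.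
  by rewrite ler_wpM2l //; exact: pow_le.
have K0 : 0 <= b ^+ 6 * M ^+ 3 by rewrite mulr_ge0 ?exprn_ge0 ?ltW.
have e1 : nsq g / (2 * lz) = nsq g / lz / 2 by field; exact: lt0r_neq0.
rewrite e1 in v1; move: v1 v2 v3 K0.
move: (b ^+ 6 * M ^+ 3) (nsq g / lz) (nsq g / lb) (SP _ / lb) => K x y w v1 v2 v3 K0.
move: (loglik A gh) (loglik A z) v1 => l1 l2 v1.
have -> : 2 * (l1 - l2) - w = 2 * (l1 - l2 - x / 2) + (x - y) + (y - w) by field.
apply: le_trans (ler_normD _ _) _; apply: le_trans (lerD (ler_normD _ _) (lexx _)) _.
rewrite normrM (ger0_norm (ler0n _ 2)).
have c1 : 8 * 64 ^+ 2 * K = 2 * (3 * 64 ^+ 2 * K) + 64 * 128 * K by ring.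
rewrite c1; lra.
Qed.

End Event.
End Assembly.

Lemma markov_ratio (R : realType) (I : finType) (p : I -> R) (f : {ffun I -> bool} -> R)
    (K M c : R) : (forall i, 0 <= p i <= 1) -> (forall w, 0 <= f w) -> 0 < M -> 0 < c ->
  Ex p f <= K * c -> Pr p (fun w => M * c < f w) <= K / M.
Proof.
move=> p01 f0 M0 c0 h; apply: le_trans (markov p01 f0 (mulr_gt0 M0 c0)) _.
rewrite ler_pdivrMr ?mulr_gt0 //; apply: le_trans h _; apply: ler_of_eq; field.
exact: lt0r_neq0.
Qed.

(** * The statistic on a good event, and the probability of that event *)

Section FixedSize.
Context {R : realType} {n : nat}.
Variables (be : 'I_n -> R) (r : nat) (b M : R).
Hypothesis r4 : (4 <= r)%N.
Hypothesis rn : (r <= n)%N.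
Hypothesis be0 : Theta0 r be.
Hypothesis b1 : 1 <= b.
Hypothesis M1 : 1 <= M.
Hypothesis nu_lb : forall i j, i != j -> 1 / b <= dlogistic (be i + be j).
Hypothesis big_r : 4 ^+ 8 * b ^+ 6 * M ^+ 3 <= Num.sqrt (r%:R : R).

Local Notation N := (n%:R : R).
Local Notation rr := (r%:R : R).
Local Notation P := (@blk n r).
Local Notation i0 := (@fst_ord n r r4 rn).
Local Notation p := (eprob be).
Local Notation Om := {ffun 'I_n * 'I_n -> bool}.
Let lb := lam be i0.
Let s := Num.sqrt rr.
Let s2r := Num.sqrt (2 * rr).
(** The factor 2 is there because [qform] counts each unordered pair of edges once:
    [s2r * lrt_qform] is then the off-diagonal part divided by [lb]. *)
Let kap := 2 / (lb * s2r).
Definition lrt_qform (w : Om) : R := qform p (ekern P kap) w.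
Let nu0 := dlogistic (be i0 + be i0).

Let b0 : 0 < b. Proof. by have := b1; lra. Qed.
Let M0 : 0 < M. Proof. by have := M1; lra. Qed.
Let n4 : (4 <= n)%N. Proof. exact: leq_trans r4 rn. Qed.
Let n1 : (1 <= n)%N. Proof. exact: leq_trans n4. Qed.
Let N0 : 0 < N. Proof. by rewrite ltr0n. Qed.
Let r0 : 0 < rr. Proof. by rewrite ltr0n; exact: leq_trans r4. Qed.
Let rN : rr <= N. Proof. by rewrite ler_nat. Qed.
Let P0 : P i0 := blk0 r4 rn.
Let cP : #|P| = r := card_blk rn.
Let s0 : 0 < s. Proof. by rewrite sqrtr_gt0. Qed.
Let s2r0 : 0 < s2r. Proof. by rewrite sqrtr_gt0 mulr_gt0. Qed.
Let s2r_sqr : s2r ^+ 2 = 2 * rr. Proof. by rewrite sqr_sqrtr // mulr_ge0. Qed.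
Let lb_lb : N / (2 * b) <= lb := lam_lb r4 rn be0 b1 nu_lb.
Let lb0 : 0 < lb.
Proof. by apply: lt_le_trans lb_lb; rewrite divr_gt0 // mulr_gt0. Qed.
Let lbV : lb^-1 <= 2 * b / N.
Proof.
have -> : 2 * b / N = (N / (2 * b))^-1 by rewrite invf_div.
by apply: invr_mono lb_lb; rewrite divr_gt0 // mulr_gt0.
Qed.
Let kap0 : 0 <= kap. Proof. by rewrite divr_ge0 ?mulr_ge0 // ltW. Qed.
Let nu00 : 0 <= nu0. Proof. exact/ltW/dlogistic_gt0. Qed.
Let nu04 : nu0 <= 1 / 4. Proof. exact: dlogistic_le. Qed.

Lemma finfo_blk i : P i -> finfo be i = lb + nu0.
Proof.
move=> Pi; rewrite /finfo sum_neq (blk_const r4 rn be0 Pi) /lb /lam -/nu0.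
by ring.
Qed.

Lemma incP_bvar : \sum_e incP P e * bvar p e = rr * (lb + nu0).
Proof.
transitivity (\sum_(i | P i) finfo be i).
  under eq_bigr do rewrite /incP mulr_suml.
  rewrite exchange_big /=; apply: eq_bigr => i _.
  under eq_bigr do rewrite inc_bvar.
  by rewrite (inc_sum (F := fun i j => dlogistic (be i + be j))) // => a c; rewrite addrC.
rewrite (eq_bigr (fun=> lb + nu0)) => [|i Pi]; last exact: finfo_blk.
by rewrite sumr_const cP mulr_natl.
Qed.

Let kap_sqr : kap ^+ 2 = 2 / (lb ^+ 2 * rr).
Proof.
rewrite /kap expr_div_n exprMn s2r_sqr; field.
by rewrite !lt0r_neq0.
Qed.

Let lbV2 : (lb ^+ 2)^-1 <= 4 * b ^+ 2 / N ^+ 2.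
Proof.
have h := ler_expn_nneg 2 (_ : 0 <= lb^-1) lbV; rewrite -exprVn.
apply: le_trans (h _) _; first by rewrite invr_ge0 ltW.
by apply: ler_of_eq; field; exact: lt0r_neq0.
Qed.

Let rho := b ^+ 6 * M ^+ 3 / s.

Lemma rho_bounds : 0 < rho /\ 4 ^+ 8 * rho <= 1.
Proof.
split; first by rewrite divr_gt0 // mulr_gt0 // exprn_gt0.
by rewrite /rho mulrA ler_pdivrMr // mul1r mulrA.
Qed.

Let b4r : b ^+ 4 / rr <= rho ^+ 2.
Proof.
have -> : rho ^+ 2 = b ^+ 12 * M ^+ 6 / rr.
  by rewrite /rho expr_div_n sqr_sqrtr //; congr (_ / _); ring.
rewrite ler_pM2r ?invr_gt0 // -[leLHS]mulr1 -[X in _ * X <= _](expr0 M).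
exact: pow_le.
Qed.

Lemma tr4_lrt : tr4 (ekern P kap) <= 768 * rho ^+ 2.
Proof.
have rP : #|P|%:R <= N by rewrite cP.
apply: le_trans (tr4_ekern kap0 n1 rP) _; rewrite cP.
have -> : 12 * kap ^+ 4 * rr * N ^+ 4 = 48 * (N ^+ 4 / rr) * ((lb ^+ 2)^-1) ^+ 2.
  have -> : kap ^+ 4 = (kap ^+ 2) ^+ 2 by ring.
  by rewrite kap_sqr; field; rewrite !lt0r_neq0.
have l0 : 0 <= (lb ^+ 2)^-1 by rewrite invr_ge0 sqr_ge0.
have c0 : 0 <= 48 * (N ^+ 4 / rr) by rewrite mulr_ge0 // divr_ge0 // exprn_ge0.
apply: le_trans (ler_wpM2l c0 (ler_expn_nneg 2 l0 lbV2)) _.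
have -> : 48 * (N ^+ 4 / rr) * (4 * b ^+ 2 / N ^+ 2) ^+ 2 = 768 * (b ^+ 4 / rr).
  by field; rewrite !lt0r_neq0.
by apply: ler_wpM2l; [exact: ler0n|exact: b4r].
Qed.

(** On the block [finfo] equals [lb + nu0], so the main term of [s2] is [(1 + nu0 / lb) ^+ 2] with
    [nu0 / lb] of order [b / N]; the corrections in [s2_ekern] are of order [b ^+ 2 / r]. *)
Lemma s2_lrt : `|s2 p (ekern P kap) - 1| <= 2 * rho.
Proof.
have /andP[lo hi] := s2_ekern be P kap.
have sf : \sum_(i | P i) finfo be i ^+ 2 = rr * (lb + nu0) ^+ 2.
  rewrite (eq_bigr (fun=> (lb + nu0) ^+ 2)) => [|i Pi]; last by rewrite finfo_blk.
  by rewrite sumr_const cP mulr_natl.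
rewrite sf cP kap_sqr in lo hi.
pose x := nu0 / lb; pose y := (lb ^+ 2)^-1.
have x0 : 0 <= x by rewrite divr_ge0 // ltW.
have x1 : x <= b / (2 * N).
  apply: le_trans (ler_pM nu00 _ nu04 lbV) _; first by rewrite invr_ge0 ltW.
  by apply: ler_of_eq; field; exact: lt0r_neq0.
have y0 : 0 <= y by rewrite invr_ge0 sqr_ge0.
have lo' : 1 + 2 * x + x ^+ 2 - N / 8 * y <= s2 p (ekern P kap).
  rewrite -(@ler_pM2l _ 2) //; apply: le_trans lo; apply: ler_of_eq.
  by rewrite /x /y; field; rewrite !lt0r_neq0.
have hi' : s2 p (ekern P kap) <= 1 + 2 * x + x ^+ 2 + rr / 16 * y.
  rewrite -(@ler_pM2l _ 2) //; apply: le_trans hi _; apply: ler_of_eq.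
  by rewrite /x /y; field; rewrite !lt0r_neq0.
have b_1 := b1; have N4 : 4 <= N by rewrite ler_nat.
have bN : b / N <= b ^+ 2 / rr.
  rewrite ler_pM ?invr_ge0 ?(ltW b0) //; last by apply: invr_mono.
  by rewrite expr2 ler_peMl // ltW.
have xb : x <= b ^+ 2 / rr / 2.
  apply: le_trans x1 _; have -> : b / (2 * N) = b / N / 2 by field; exact: lt0r_neq0.
  by rewrite ler_pM2r.
have x2 : x ^+ 2 <= b ^+ 2 / rr / 4.
  have := ler_expn_nneg 2 x0 x1; move=> /le_trans; apply.
  have -> : (b / (2 * N)) ^+ 2 = b ^+ 2 / 4 * (N ^+ 2)^-1 by field; exact: lt0r_neq0.
  have -> : b ^+ 2 / rr / 4 = b ^+ 2 / 4 * rr^-1 by field; exact: lt0r_neq0.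
  rewrite ler_wpM2l ?divr_ge0 ?sqr_ge0 //; apply: invr_mono => //.
  by apply: le_trans rN _; rewrite expr2 ler_peMl ?ltW //; lra.
have y1 : N / 8 * y <= b ^+ 2 / rr / 2.
  apply: (@le_trans _ _ (b ^+ 2 / N / 2)).
    have c0 : 0 <= N / 8 by rewrite divr_ge0.
    apply: le_trans (ler_wpM2l c0 lbV2) _; apply: ler_of_eq.
    by field; exact: lt0r_neq0.
  rewrite ler_pM2r // ler_wpM2l ?sqr_ge0 //; exact: invr_mono.
have y2 : rr / 16 * y <= b ^+ 2 / rr / 4.
  have : rr / 16 * y <= N / 16 * y by rewrite ler_wpM2r // ler_pM2r.
  move: y1; have -> : N / 8 * y = 2 * (N / 16 * y) by field.
  lra.
have br : b ^+ 2 / rr <= rho.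
  have [rho0 rho1] := rho_bounds; apply: (@le_trans _ _ (rho ^+ 2)).
    apply: le_trans b4r; rewrite ler_pM2r ?invr_gt0 //; exact: ler_weXn2l.
  rewrite expr2 ler_piMl ?(ltW rho0) //; apply: le_trans rho1.
  by rewrite ler_peMl ?(ltW rho0) // exprn_ege1 //; lra.
have q0 : 0 <= b ^+ 2 / rr by rewrite divr_ge0 ?sqr_ge0.
have xx := sqr_ge0 x.
move: lo' hi' xb x2 y1 y2 br q0 x0 xx.
move: (s2 _ _) (b ^+ 2 / rr) (x ^+ 2) (N / 8 * y) (rr / 16 * y) => S B X2 Y1 Y2.
move=> *; rewrite ler_norml; apply/andP; split; lra.
Qed.

Definition lrt_good (w : Om) : Prop := exists gh z : 'I_n -> R,
  [/\ is_max_on (sym_adj w) (fun=> True) gh, is_max_on (sym_adj w) (Theta0 r) z &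
  `|(2 * (loglik (sym_adj w) gh - loglik (sym_adj w) z) - rr) / s2r - lrt_qform w|
   <= 9 * 64 ^+ 2 * rho].

(** The diagonal part divided by [lb] concentrates around [r * (1 + nu0 / lb)], which is where the
    centring by [r] comes from; the excess [r * nu0 / lb] is at most [b / 2]. *)
Lemma lrt_qform_main w (D := \sum_e incP P e * ctr p e w ^+ 2) :
  (D - \sum_e incP P e * bvar p e) ^+ 2 <= M * (rr * N) ->
  `|(\sum_(i | P i) grad (sym_adj w) be i ^+ 2) / lb - rr - s2r * lrt_qform w| <= 3 * (b * M).
Proof.
move=> hD; rewrite incP_bvar in hD.
have b_1 := b1; have M_1 := M1.
have -> : \sum_(i | P i) grad (sym_adj w) be i ^+ 2 = \sum_(i | P i) eps be i w ^+ 2.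
  by apply: eq_bigr => i _; rewrite epsE.
have qE : s2r * lrt_qform w = (\sum_(i | P i) eps be i w ^+ 2 - D) / lb.
  have := qform_ekern be P kap w; rewrite -/(lrt_qform w) -/D => h.
  have -> : lrt_qform w = kap * (\sum_(i | P i) eps be i w ^+ 2 - D) / 2.
    by rewrite -h; field.
  rewrite /kap; field; rewrite !lt0r_neq0 //.
rewrite qE; move: (\sum_(i | P i) _) => S.
have -> : S / lb - rr - (S - D) / lb = (D - rr * (lb + nu0)) / lb + rr * (nu0 / lb).
  by field; exact: lt0r_neq0.
have li0 : 0 <= lb^-1 by rewrite invr_ge0 ltW.
have d1 : `|D - rr * (lb + nu0)| <= M * N.
  apply: (sqr_bound M1) => //; apply: le_trans hD _.
  by apply: ler_wpM2l; [exact: ltW|rewrite expr2 ler_pM2r].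
have d2 : `|(D - rr * (lb + nu0)) / lb| <= 2 * (b * M).
  rewrite normrM (ger0_norm li0).
  apply: le_trans (ler_pM (normr_ge0 _) li0 d1 lbV) _.
  by apply: ler_of_eq; field; exact: lt0r_neq0.
have d3 : `|rr * (nu0 / lb)| <= b / 2.
  have nl : 0 <= nu0 / lb by exact: mulr_ge0.
  rewrite (ger0_norm (mulr_ge0 (ltW r0) nl)).
  apply: le_trans (ler_pM (ltW r0) nl rN (ler_pM nu00 li0 nu04 lbV)) _.
  by apply: ler_of_eq; field; exact: lt0r_neq0.
have d4 : b <= b * M by rewrite ler_peMr // ltW.
apply: le_trans (ler_normD _ _) _; apply: le_trans (lerD d2 d3) _.
have := b0; move: d4; lra.
Qed.

Lemma lrt_good_intro w (u : 'I_n -> R) :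
  (forall (A : adj n) h (H : R), (forall i, P i -> h i = h i0) -> nsq h <= H ->
   (forall u', (forall i, P i -> u' i = u' i0) -> \sum_i grad A (shift be h) i * u' i = 0) ->
   `|lam (shift be h) i0 - lb| <=
     `|\sum_i u i * grad A be i| + 3 * b ^+ 2 * N * H / rr) ->
  \sum_i eps be i w ^+ 4 <= M * N ^+ 3 ->
  (\sum_i u i * eps be i w) ^+ 2 <= M * (b ^+ 2 * N / rr) ->
  \sum_(i | P i) eps be i w ^+ 4 <= M * (rr * N ^+ 2) ->
  (\sum_(i | P i) eps be i w) ^+ 2 <= M * (rr * N) ->
  (\sum_(i | P i) eps be i w ^+ 3) ^+ 2 <= M * (rr * N ^+ 3) ->
  (\sum_e incP P e * ctr p e w ^+ 2 - \sum_e incP P e * bvar p e) ^+ 2 <= M * (rr * N) ->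
  lrt_good w.
Proof.
move=> hu G1 G2 G3 G4 G5 G6; set A := sym_adj w.
have eE (F : R -> R) (Q : pred 'I_n) :
    \sum_(i | Q i) F (eps be i w) = \sum_(i | Q i) F (grad A be i).
  by apply: eq_bigr => i _; rewrite epsE.
rewrite (eE (fun x => x ^+ 4)) in G1; rewrite (eE (fun x => x ^+ 4)) mulrA in G3.
rewrite (eE id) mulrA in G4; rewrite (eE (fun x => x ^+ 3)) mulrA in G5.
have [h [hc h4 hH hmax]] := mle_exists r4 rn be0 b1 M1 nu_lb big_r G1.
have hP i : P i -> h i = h i0 by move/(rep_Theta0 r4 rn): hc => hT Pi; exact: blk_const.
have stat := z_stationary be0 hc hmax.
have hlam := hu A h _ hP hH stat.
set U := `|\sum_i u i * grad A be i| in hlam.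
have U_small : U <= b * M * N / rr.
  have -> : b * M * N / rr = M * (b * N / rr) by field; exact: lt0r_neq0.
  have q0 : 0 <= b * N / rr by rewrite divr_ge0 ?mulr_ge0 // ltW.
  apply: (sqr_bound M1) => //.
  have -> : \sum_i u i * grad A be i = \sum_i u i * eps be i w.
    by apply: eq_bigr => i _; rewrite epsE.
  apply: le_trans G2 _; apply: ler_wpM2l; first exact: ltW.
  have -> : (b * N / rr) ^+ 2 = b ^+ 2 * N / rr * (N / rr) by field; exact: lt0r_neq0.
  apply: ler_peMr; first exact: divr_ge0 (mulr_ge0 (sqr_ge0 b) (ltW N0)) (ltW r0).
  by rewrite ler_pdivlMr // mul1r.
have hlam' : `|lam (shift be h) i0 - lb| <=
    `|U| + 3 * b ^+ 2 * N * (64 * b ^+ 2 * M) / rr by rewrite normr_id.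
have [gh [ghmax ghv]] := lrt_deterministic be0 b1 M1 nu_lb big_r U_small G3 G4 G5
  hc h4 hmax hlam' (normr_ge0 _).
exists gh, (shift be h); split=> //.
  split=> [|g' /(rep_Theta0 r4 rn) g'r]; last exact: hmax.
  apply/(rep_Theta0 r4 rn) => i; rewrite /shift -hc; congr (_ + _).
  by move/(rep_Theta0 r4 rn): be0; exact.
have v2 := lrt_qform_main G6.
rewrite -/A -/lb in ghv v2 *.
have K1 : b * M <= b ^+ 6 * M ^+ 3.
  by have := @pow_le R b M b1 M1 1 1 6 3 isT isT; rewrite !expr1.
have s2s : s <= s2r by rewrite ler_sqrt ?mulr_ge0 // ler_peMl // ler1n.
have K0 : 0 <= b ^+ 6 * M ^+ 3 by rewrite mulr_ge0 // exprn_ge0 // ltW.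
rewrite /rho; move: (b ^+ 6 * M ^+ 3) ghv K1 K0 => K ghv K1 K0.
move: (loglik A gh) (loglik A (shift be h)) (_ / lb) ghv v2 => l1 l2 S ghv v2.
have -> : (2 * (l1 - l2) - rr) / s2r - lrt_qform w =
  ((2 * (l1 - l2) - S) + (S - rr - s2r * lrt_qform w)) / s2r.
  by field; exact: lt0r_neq0.
have si0 : 0 <= s2r^-1 by rewrite invr_ge0 ltW.
rewrite normrM (ger0_norm si0) [leRHS]mulrA.
apply: (ler_pM (normr_ge0 _) si0); last exact: invr_mono.
apply: le_trans (ler_normD _ _) _; apply: le_trans (lerD ghv v2) _.
have c1 : 9 * 64 ^+ 2 * K = 8 * 64 ^+ 2 * K + 64 * 64 * K by ring.
rewrite c1 lerD2l; lra.
Qed.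

(** Six Markov bounds and a union bound: [461 = 11 + 4 + 11 + 1 + 433 + 1]. *)
Lemma lrt_good_prob : Pr p (fun w => ~ lrt_good w) <= 461 / M.
Proof.
have b_1 := b1; have M_1 := M1.
have p01 := eprob01 be.
have r4' : (4 <= #|P|)%N by rewrite cP.
have [u [nu hu]] := lam_perturb P0 (blk_const r4 rn be0) n4 r4' b1 nu_lb.
rewrite cP in nu hu.
have rP : #|P|%:R <= N by rewrite cP.
have q1 : Pr p (fun w => M * N ^+ 3 < \sum_i eps be i w ^+ 4) <= 11 / M.
  apply: markov_ratio => //; first by move=> w; rewrite sumr_ge0 // => i _; rewrite exprn_even_ge0.
    by rewrite exprn_gt0.
  apply: le_trans (Ex_sum_eps4 be predT) _; rewrite card_ord.
  by apply: ler_of_eq; ring.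
have q2 : Pr p (fun w => M * (b ^+ 2 * N / rr) < (\sum_i u i * eps be i w) ^+ 2) <= 4 / M.
  apply: markov_ratio => //; first by move=> w; exact: sqr_ge0.
    by rewrite divr_gt0 // mulr_gt0 // exprn_gt0.
  apply: le_trans (Ex_dot_eps be u) _.
  have -> : N * nsq u / 2 = N / 2 * nsq u by field.
  have c0 : 0 <= N / 2 by rewrite divr_ge0.
  apply: le_trans (ler_wpM2l c0 nu) _.
  by apply: ler_of_eq; field; exact: lt0r_neq0.
have q3 : Pr p (fun w => M * (rr * N ^+ 2) < \sum_(i | P i) eps be i w ^+ 4) <= 11 / M.
  apply: markov_ratio => //; first by move=> w; rewrite sumr_ge0 // => i _; rewrite exprn_even_ge0.
    by rewrite mulr_gt0 // exprn_gt0.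
  apply: le_trans (Ex_sum_eps4 be P) _; rewrite cP.
  by apply: ler_of_eq; ring.
have q4 : Pr p (fun w => M * (rr * N) < (\sum_(i | P i) eps be i w) ^+ 2) <= 1 / M.
  apply: markov_ratio => //; first by move=> w; exact: sqr_ge0.
    by rewrite mulr_gt0.
  by apply: le_trans (Ex_sum_eps2 be P) _; rewrite cP mul1r.
have q5 : Pr p (fun w => M * (rr * N ^+ 3) < (\sum_(i | P i) eps be i w ^+ 3) ^+ 2) <= 433 / M.
  apply: markov_ratio => //; first by move=> w; exact: sqr_ge0.
    by rewrite mulr_gt0 // exprn_gt0.
  apply: le_trans (Ex_sum_eps3 be n1 rP) _; rewrite cP mulrA.
  exact: lexx.
have q6 : Pr p (fun w => M * (rr * N) <
    (\sum_e incP P e * ctr p e w ^+ 2 - \sum_e incP P e * bvar p e) ^+ 2) <= 1 / M.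
  apply: markov_ratio => //; first by move=> w; exact: sqr_ge0.
    by rewrite mulr_gt0.
  by apply: le_trans (diag_variance be P) _; rewrite cP mul1r.
have -> : 461 / M = 11 / M + (4 / M + (11 / M + (1 / M + (433 / M + 1 / M)))).
  by field; exact: lt0r_neq0.
have orD (E F : Om -> Prop) x y : Pr p E <= x -> Pr p F <= y ->
    Pr p (fun w => E w \/ F w) <= x + y.
  by move=> Ex Fy; apply: le_trans (Pr_or p01 E F) _; exact: lerD.
apply: le_trans (orD _ _ _ _ q1 (orD _ _ _ _ q2 (orD _ _ _ _ q3
  (orD _ _ _ _ q4 (orD _ _ _ _ q5 q6))))).
apply: Pr_le => // w ng; apply: contrapT.
move=> /not_orP[k1 /not_orP[k2 /not_orP[k3 /not_orP[k4 /not_orP[k5 k6]]]]].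
by apply: ng; apply: (lrt_good_intro hu); rewrite leNgt; apply/negP.
Qed.
End FixedSize.

(** * From smoothed test functions to distribution functions *)

Section Smoothing.
Context {R : realType} {I : finType}.
Variables (p : I -> R) (Q : {ffun I -> bool} -> R) (th ep K : R).
Hypothesis p01 : forall i, 0 <= p i <= 1.
Hypothesis ep0 : 0 < ep.
Hypothesis tails : forall t, K <= t -> Phi (- t) <= ep /\ 1 - ep <= Phi t.
Hypothesis Kth : K <= ep * isqrt th.

(** On [Q <= y] the shifted argument divided by the square root of the time is at least
    [ep * isqrt th >= K], so the smoothed indicator is within [ep] of 1. *)
Lemma Pr_le_heat y :
  Pr p (fun w => Q w <= y) <= Ex p (fun w => heat th (y + ep - Q w)) + ep.
Proof.
rewrite -[X in _ <= _ + X](Ex_cst p ep) -ExD; apply: Ex_le => // w /=.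
case: asboolP => [Qy|_] /=; last by rewrite addr_ge0 ?Phi_ge0 // ltW.
have [_ h] := tails Kth; rewrite -lerBlDr; apply: le_trans h _.
apply: Phi_nondecreasing; rewrite ler_wpM2r ?(ltW (isqrt_gt0 _)) //.
by move: Qy; lra.
Qed.

Lemma Pr_ge_heat y :
  Ex p (fun w => heat th (y - ep - Q w)) - ep <= Pr p (fun w => Q w <= y).
Proof.
rewrite lerBlDr -[X in _ <= _ + X](Ex_cst p ep) -ExD; apply: Ex_le => // w /=.
case: asboolP => [_|/negP]; first by rewrite (le_trans (Phi_le1 _)) // lerDl ltW.
rewrite -ltNge add0r => Qy.
have [h _] := tails Kth; apply: le_trans h; apply: Phi_nondecreasing.
by rewrite -mulNr ler_wpM2r ?(ltW (isqrt_gt0 _)) //; move: Qy; lra.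
Qed.
End Smoothing.

Lemma heat1D_Phi (R : realType) (th x x0 : R) : 0 <= th ->
  `|heat (th + 1) x0 - Phi x| <= 32 * (`|x0 - x| + `|x| * th).
Proof.
move=> th0; rewrite /heat [th + 1]addrC.
apply: le_trans (Phi_lipschitz _ _) _; apply: ler_wpM2l => //.
have /andP[l1 l2] := isqrt1D_bound th0; have i0 := ltW (isqrt_gt0 (1 + th)).
have -> : x0 * isqrt (1 + th) - x = (x0 - x) * isqrt (1 + th) + x * (isqrt (1 + th) - 1) by ring.
apply: le_trans (ler_normD _ _) _; rewrite !normrM; apply: lerD.
  by rewrite (ger0_norm i0) ler_piMr.
by rewrite ler_wpM2l // ler_norml; apply/andP; split; lra.
Qed.

Section FixedSizeCDF.
Context {R : realType} {n : nat}.
Variables (be : 'I_n -> R) (r : nat) (b M : R).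
Hypothesis r4 : (4 <= r)%N.
Hypothesis rn : (r <= n)%N.
Hypothesis be0 : Theta0 r be.
Hypothesis b1 : 1 <= b.
Hypothesis M1 : 1 <= M.
Hypothesis nu_lb : forall i j, i != j -> 1 / b <= dlogistic (be i + be j).
Hypothesis big_r : 4 ^+ 8 * b ^+ 6 * M ^+ 3 <= Num.sqrt (r%:R : R).
Local Notation rho := (b ^+ 6 * M ^+ 3 / Num.sqrt (r%:R : R)).
Local Notation p := (eprob be).

Definition mles_exist (A : adj n) : Prop :=
  (exists g : 'I_n -> R, is_max_on A (fun _ => True) g) /\
  (exists g0 : 'I_n -> R, is_max_on A (Theta0 r) g0).

Definition lrt_le (x : R) (A : adj n) : Prop :=
  exists g g0 : 'I_n -> R, is_max_on A (fun _ => True) g /\ is_max_on A (Theta0 r) g0 /\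
    (2 * (loglik A g - loglik A g0) - r%:R) / Num.sqrt (2 * r%:R) <= x.

Local Notation Q := (lrt_qform be r4 rn).
Local Notation good := (lrt_good be b M r4 rn).
Let p01 := eprob01 be.

Lemma mles_exist_prob : 1 - 461 / M <= bmodel_prob be mles_exist.
Proof.
rewrite bmodel_prob_Pr lerBlDr -lerBlDl -Pr_not.
apply: le_trans (lrt_good_prob r4 rn be0 b1 M1 nu_lb big_r).
apply: Pr_le => // w nm [gh [z [mg mz _]]]; apply: nm; split; [by exists gh|by exists z].
Qed.

(** The event allows any pair of maximizers, but all of them share the likelihood values of the pair
    in [lrt_good], so the statistic is the same. *)
Lemma lrt_le_qform w x : good w -> lrt_le x (sym_adj w) -> Q w <= x + 9 * 64 ^+ 2 * rho.
Proof.
move=> [gh [z [[_ mg] [Tz mz]]]] + [g [g0 [[_ mg'] [[Tg0 mg0'] h]]]].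
have -> : loglik (sym_adj w) gh = loglik (sym_adj w) g.
  by apply/eqP; rewrite eq_le mg' // mg.
have -> : loglik (sym_adj w) z = loglik (sym_adj w) g0.
  by apply/eqP; rewrite eq_le mg0' // mz.
move: h; move: (_ / Num.sqrt (2 * _)) => S h.
move: (9 * 64 ^+ 2 * rho) => e; rewrite ler_norml => /andP[h1 _].
by move: h h1; lra.
Qed.

Lemma qform_lrt_le w x : good w -> Q w <= x - 9 * 64 ^+ 2 * rho -> lrt_le x (sym_adj w).
Proof.
move=> [gh [z [mg mz h]]] hx; exists gh, z; split=> //; split=> //.
move: h hx; move: (9 * 64 ^+ 2 * rho) => e; move: (_ / Num.sqrt (2 * _)) => S.
by rewrite ler_norml => /andP[_ h1] hx; move: h1 hx; lra.
Qed.

Variables (th ep K C x : R).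
Hypothesis th0 : 0 < th.
Hypothesis ep0 : 0 < ep.
Hypothesis C0 : 0 <= C.
Hypothesis tails : forall t, K <= t -> Phi (- t) <= ep /\ 1 - ep <= Phi t.
Hypothesis Kth : K <= ep * isqrt th.
Hypothesis rho_ep : 9 * 64 ^+ 2 * rho <= ep.
Hypothesis clt : forall (I : finType) (p : I -> R) (a : I -> I -> R) (x0 al : R),
    (forall i, 0 <= p i <= 1) -> (forall k l, 0 <= a k l) ->
    (forall k l, a k l = a l k) -> 0 < al <= 1 -> s2 p a <= 2 ->
    `|Ex p (fun w => heat th (x0 - qform p a w)) - heat (th + 1) x0| <=
    C * (al + (tr4 a + (s2 p a - 1) ^+ 2) / al).

(** The free parameter of [quadratic_form_clt] is taken to be [rho]; as [tr4] and [(s2 - 1) ^+ 2]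
    are at most [768 * rho ^+ 2] and [4 * rho ^+ 2], the constant is [1 + 768 + 4]. *)
Lemma qform_heat x0 :
  `|Ex p (fun w => heat th (x0 - Q w)) - heat (th + 1) x0| <= 773 * C * rho.
Proof.
have [rho0 rho1] := rho_bounds r4 b1 M1 big_r.
have sb := s2_lrt r4 rn be0 b1 M1 nu_lb big_r.
have tb := tr4_lrt r4 rn be0 b1 M1 nu_lb.
have k0 : 0 <= 2 / (lam be (fst_ord r4 rn) * Num.sqrt (2 * (r%:R : R))).
  have b0 : 0 < b by have := b1; lra.
  have l0 := lam_lb r4 rn be0 b1 nu_lb.
  rewrite divr_ge0 // mulr_ge0 ?sqrtr_ge0 //; apply: le_trans l0.
  by rewrite divr_ge0 // mulr_ge0 // ltW.
have rho11 : 1024 * rho <= 1.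
  apply: le_trans rho1; apply: ler_wpM2r; first exact: ltW.
  have -> : 1024 = 4 ^+ 5 :> R by ring.
  by apply: ler_weXn2l => //; lra.
have a1 : 0 < rho <= 1 by apply/andP; split => //; move: rho11 rho0; lra.
have s22 : s2 p (ekern (blk r) (2 / (lam be (fst_ord r4 rn) * Num.sqrt (2 * (r%:R : R))))) <= 2.
  by move: sb; rewrite ler_norml => /andP[_ h]; move: h rho11 rho0; lra.
have := @clt _ p _ x0 _ p01 (ekern_ge0 (blk r) k0) (@ekern_sym R n (blk r) _) a1 s22.
move=> h; apply: le_trans h _.
have sb2 := ler_expn_nneg 2 (normr_ge0 _) sb.
rewrite real_normK ?num_real // in sb2.
move: (tr4 _) ((s2 _ _ - 1) ^+ 2) tb sb2 => T S tb sb2.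
move: rho rho0 tb sb2 => q q0 tb sb2.
have -> : 773 * C * q = C * (q + (768 * q ^+ 2 + (2 * q) ^+ 2) / q).
  by field; exact: lt0r_neq0.
apply: ler_wpM2l => //.
by rewrite lerD2l ler_pM2r ?invr_gt0 //; apply: lerD.
Qed.

(** The threshold moves by [eta + ep]: [eta] pays for replacing the statistic by the quadratic form,
    [ep] for smoothing the indicator. The Lipschitz bound on [Phi] absorbs the move. *)
Lemma lrt_cdf_bound : `|bmodel_prob be (lrt_le x) - Phi x| <=
  32 * (2 * ep + `|x| * th) + 773 * C * rho + ep + 461 / M.
Proof.
have e0 := ep0; have re := rho_ep.
have gp := lrt_good_prob r4 rn be0 b1 M1 nu_lb big_r.
have [rho0 _] := rho_bounds r4 b1 M1 big_r.
have [eta etaE] : exists e, e = 9 * 64 ^+ 2 * rho by eexists.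
rewrite -etaE in re.
have eta0 : 0 <= eta by rewrite etaE mulr_ge0 ?(ltW rho0) // mulr_ge0 // exprn_ge0.
have d1 : `|x + eta + ep - x| <= 2 * ep.
  have -> : x + eta + ep - x = eta + ep by ring.
  by rewrite ger0_norm; lra.
have d2 : `|x - eta - ep - x| <= 2 * ep.
  have -> : x - eta - ep - x = - (eta + ep) by ring.
  by rewrite normrN ger0_norm; lra.
have up : bmodel_prob be (lrt_le x) <= Pr p (fun w => Q w <= x + eta) + 461 / M.
  rewrite bmodel_prob_Pr; apply: le_trans (lerD (lexx _) gp).
  apply: le_trans (Pr_or p01 _ _); apply: Pr_le => // w h.
  have [g|ng] := pselect (good w); [left; rewrite etaE; exact: lrt_le_qform|by right].
have lo : Pr p (fun w => Q w <= x - eta) <= bmodel_prob be (lrt_le x) + 461 / M.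
  rewrite bmodel_prob_Pr; apply: le_trans (lerD (lexx _) gp).
  apply: le_trans (Pr_or p01 _ _); apply: Pr_le => // w; rewrite etaE => h.
  have [g|ng] := pselect (good w); [left; exact: qform_lrt_le|by right].
have h1 := Pr_le_heat Q p01 ep0 tails Kth (x + eta).
have h2 := Pr_ge_heat Q p01 ep0 tails Kth (x - eta).
have q1 := qform_heat (x + eta + ep); have q2 := qform_heat (x - eta - ep).
have w1 := heat1D_Phi x (x + eta + ep) (ltW th0).
have w2 := heat1D_Phi x (x - eta - ep) (ltW th0).
move: up lo h1 h2 q1 q2 w1 w2 d1 d2 => up lo h1 h2.
move: (Ex p _) h1 (Ex p _) h2 => E1 h1 E2 h2.
move: (773 * C * rho) (461 / M) up lo => c m up lo.
move: (heat _ _) (heat _ _) => H2 H1.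
move: (Pr _ _) (Pr _ _) h1 h2 up lo => P1 P2 h1 h2 up lo.
move: (`|x| * th) (`|x + _ + _ - _|) (`|x - _ - _ - _|) (Phi x) => xt a1 a2 F.
rewrite !ler_norml => /andP[? ?] /andP[? ?] /andP[? ?] /andP[? ?] ? ?.
by apply/andP; split; lra.
Qed.
End FixedSizeCDF.

(** * The limit *)

Section ModelConstants.
Context {R : realType} {n : nat}.
Variable be : 'I_n -> R.
Hypothesis n2 : (2 <= n)%N.

Lemma bc_fun_ge4 (x : R) : 4 <= bc_fun x.
Proof.
have h := dlogistic_le x; have h0 := dlogistic_gt0 x.
rewrite -[bc_fun x]invrK bc_funV -[leLHS]invrK; apply: invr_mono => //.
by move: h; lra.
Qed.

Lemma bc_fun_le_b_n i j : i != j -> bc_fun (be i + be j) <= b_n be.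
Proof.
move=> ij; rewrite /b_n.
exact: (@le_bigmax_cond _ R _ 0 (i, j) (fun q : 'I_n * 'I_n => q.1 != q.2)
  (fun q => bc_fun (be q.1 + be q.2))).
Qed.

Lemma b_n_ge4 : 4 <= b_n be.
Proof.
have n0 : (0 < n)%N by exact: leq_trans n2.
by apply: le_trans (bc_fun_le_b_n (_ : Ordinal n0 != Ordinal n2)); [exact: bc_fun_ge4|].
Qed.

Lemma dlogistic_ge_b_n i j : i != j -> 1 / b_n be <= dlogistic (be i + be j).
Proof.
move=> ij; rewrite div1r -bc_funV; apply: invr_mono; last exact: bc_fun_le_b_n.
exact: lt_le_trans (bc_fun_ge4 _).
Qed.

Lemma c_n_le_b_n : c_n be <= b_n be.
Proof. exact: bigmin_le_id. Qed.

Lemma c_n_gt0 : 0 < c_n be.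
Proof.
apply/bigmin_gtP; split=> [|q _]; first exact: lt_le_trans b_n_ge4.
exact: lt_le_trans (bc_fun_ge4 _).
Qed.

(** The quotient [(b_n / c_n) ^+ 9] is at least 1, so the hypothesis of the theorem controls
    [b_n ^+ 6], the power occurring in all error bounds. *)
Lemma b_n_pow6_le : b_n be ^+ 6 <= b_n be ^+ 15 / c_n be ^+ 9.
Proof.
have b0 : 0 < b_n be by exact: lt_le_trans b_n_ge4.
rewrite ler_pdivlMr ?exprn_gt0 ?c_n_gt0 // -[15%N]/(6 + 9)%N exprD ler_pM2l ?exprn_gt0 //.
by apply: ler_expn_nneg; [exact: ltW c_n_gt0|exact: c_n_le_b_n].
Qed.
End ModelConstants.

Lemma ln_nat_ge (R : realType) (B : R) : \forall n \near \oo, B <= ln (n%:R : R).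
Proof.
near=> n; have h : expR B <= n%:R.
  by near: n; exact: nbhs_infty_ger.
rewrite -[leLHS]expRK ler_ln ?posrE ?expR_gt0 //.
exact: lt_le_trans (expR_gt0 B) h.
Unshelve. all: by end_near. Qed.

Unset Implicit Arguments.

Theorem theorem1 (R : realType) (beta : forall n : nat, 'I_n -> R) (r : nat -> nat)
  (hr : \forall n \near \oo, (2 <= r n <= n)%N)
  (hr_inf : forall M : nat, \forall n \near \oo, (M <= r n)%N)
  (H0 : forall n (i j : 'I_n), (i < r n)%N -> (j < r n)%N -> beta n i = beta n j)
  (hbc : (fun n => b_n (beta n) ^+ 15 / c_n (beta n) ^+ 9
                   * ln (n%:R : R) ^+ 3 / Num.sqrt ((r n)%:R : R)) @ \oo --> (0 : R)) :
  (fun n => bmodel_prob (beta n) (fun A =>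
       (exists g : 'I_n -> R, is_max_on A (fun _ => True) g) /\
       (exists g0 : 'I_n -> R, is_max_on A (Theta0 (r n)) g0))) @ \oo --> (1 : R)
  /\
  forall x : R,
    (fun n => bmodel_prob (beta n) (fun A =>
       exists g g0 : 'I_n -> R, is_max_on A (fun _ => True) g /\ is_max_on A (Theta0 (r n)) g0 /\
         (2 * (loglik A g - loglik A g0) - (r n)%:R) / Num.sqrt (2 * (r n)%:R) <= x))
      @ \oo --> Phi x.
Proof.
(* The Markov level [M] is now [ln n]: it tends to infinity, and its cube is the logarithmic factor
   in [hbc]. *)
pose rho n := b_n (beta n) ^+ 6 * ln (n%:R : R) ^+ 3 / Num.sqrt ((r n)%:R : R).
have rho_small (e : R) : 0 < e -> \forall n \near \oo, rho n <= e.
  move=> e0; near=> n.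
  have /andP[r2 rn] : (2 <= r n <= n)%N by near: n.
  have l0 : 0 <= ln (n%:R : R) by near: n; exact: ln_nat_ge.
  have : `|0 - b_n (beta n) ^+ 15 / c_n (beta n) ^+ 9
            * ln (n%:R : R) ^+ 3 / Num.sqrt ((r n)%:R : R)| <= e.
    by near: n; move/cvgrPdist_le: hbc; apply.
  rewrite sub0r normrN => /(le_trans (ler_norm _)); apply: le_trans.
  rewrite /rho ler_wpM2r ?invr_ge0 ?sqrtr_ge0 // ler_wpM2r ?exprn_ge0 //.
  exact: b_n_pow6_le (leq_trans r2 rn).
have params (e B : R) : 0 < e -> \forall n \near \oo,
    [/\ (4 <= r n)%N, (r n <= n)%N, 1 <= b_n (beta n), 1 <= ln (n%:R : R) & B <= ln (n%:R : R)] /\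
    [/\ forall i j, i != j -> 1 / b_n (beta n) <= dlogistic (beta n i + beta n j),
      4 ^+ 8 * b_n (beta n) ^+ 6 * ln (n%:R : R) ^+ 3 <= Num.sqrt ((r n)%:R : R) &
      rho n <= e].
  move=> e0; near=> n.
  have /andP[r2 rn] : (2 <= r n <= n)%N by near: n.
  have r4 : (4 <= r n)%N by near: n.
  have n2 : (2 <= n)%N by exact: leq_trans rn.
  split; split=> //.
  - by apply: le_trans (b_n_ge4 (beta n) n2); rewrite ler1n.
  - by near: n; exact: ln_nat_ge.
  - by near: n; exact: ln_nat_ge.
  - exact: dlogistic_ge_b_n.
  - have s0 : 0 < Num.sqrt ((r n)%:R : R) by rewrite sqrtr_gt0 ltr0n; exact: leq_trans r2.
    have c0 : 0 < 4 ^+ 8 :> R by rewrite exprn_gt0.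
    have : rho n <= (4 ^+ 8)^-1 by near: n; apply: rho_small; rewrite invr_gt0.
    by rewrite /rho ler_pdivrMr // ler_pdivlMl // mulrA.
  - by near: n; exact: rho_small.
split=> [|x].
  apply/cvgrPdist_le => e e0.
  apply: filterS (params 1 (461 / e) ltr01) => n [[r4 rn b1 M1 Me] [nu_lb big_r _]].
  have := mles_exist_prob r4 rn (H0 n) b1 M1 nu_lb big_r; rewrite /mles_exist.
  set q := bmodel_prob _ _ => h.
  have q1 : q <= 1 by rewrite /q bmodel_prob_Pr; apply: Pr_le1; exact: eprob01.
  have M0 : 0 < ln (n%:R : R) by exact: lt_le_trans M1.
  have : 461 / ln (n%:R : R) <= e by rewrite ler_pdivrMr // mulrC -ler_pdivrMr.
  by rewrite ger0_norm ?subr_ge0 //; move: h; lra.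
apply/cvgrPdist_le => e e0.
(* The error budget: [32 * (2 * ep + ep)] from the moved threshold and the extra time [th], and [ep]
   from each of the other three terms, 99 in all. *)
have [ep ep0 epE] : exists2 ep : R, 0 < ep & e = 99 * ep.
  by exists (e / 99); [rewrite divr_gt0|field].
have [K K0 tails] := Phi_tails ep ep0.
(* The first entry gives [|x| * th <= ep], the second [K <= ep * isqrt th]. The constant [C] depends
   on [th], so it is fixed afterwards, but before [n] grows. *)
pose th := Num.min (ep / (1 + `|x|)) ((ep / K) ^+ 2).
have x1 : 0 < 1 + `|x| by rewrite ltr_wpDr.
have th0 : 0 < th by rewrite lt_min divr_gt0 // exprn_gt0 // divr_gt0.
have xth : `|x| * th <= ep.
  apply: (@le_trans _ _ ((1 + `|x|) * th)); first by rewrite ler_wpM2r ?(ltW th0) // lerDr.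
  by rewrite mulrC -ler_pdivlMr // ge_min lexx.
have Kth : K <= ep * isqrt th.
  have i0 := isqrt_gt0 th.
  rewrite mulrC -ler_pdivrMr //.
  rewrite -(@ler_pXn2r _ 2) ?nnegrE //; [|by rewrite divr_ge0 // ltW|exact: ltW].
  rewrite isqrt_sqr // -[leLHS]invrK; apply: invr_mono => //.
  by rewrite -exprVn invf_div ge_min lexx orbT.
have [C C0 clt] := quadratic_form_clt th0.
(* The entries serve [9 * 64 ^+ 2 * rho n <= ep] and [773 * C * rho n <= ep]; the added 1 guards
   against [C = 0]. *)
pose eta := Num.min (ep / (9 * 64 ^+ 2)) (ep / (1 + 773 * C)).
have k0 : 0 < 9 * 64 ^+ 2 :> R by rewrite mulr_gt0 // exprn_gt0.
have k1 : 0 < 1 + 773 * C := ltr_pwDl ltr01 (mulr_ge0 (ler0n _ _) C0).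
have eta0 : 0 < eta by rewrite lt_min; apply/andP; split; exact: divr_gt0.
apply: filterS (params eta (461 / ep) eta0) => n [[r4 rn b1 M1 Me] [nu_lb big_r re]].
have M0 : 0 < ln (n%:R : R) by exact: lt_le_trans M1.
have m1 : 461 / ln (n%:R : R) <= ep by rewrite ler_pdivrMr // mulrC -ler_pdivrMr.
have re1 : 9 * 64 ^+ 2 * rho n <= ep.
  by rewrite mulrC -ler_pdivlMr //; apply: le_trans re _; rewrite ge_min lexx.
have rho0 : 0 <= rho n.
  by rewrite divr_ge0 ?sqrtr_ge0 // mulr_ge0 // exprn_ge0 ?(ltW M0) // (le_trans _ b1).
have re2 : 773 * C * rho n <= ep.
  apply: (@le_trans _ _ ((1 + 773 * C) * rho n)); first by rewrite ler_wpM2r // lerDr.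
  by rewrite mulrC -ler_pdivlMr //; apply: le_trans re _; rewrite ge_min lexx orbT.
have := lrt_cdf_bound r4 rn (H0 n) b1 M1 nu_lb big_r x th0 ep0 C0 tails Kth re1 clt.
rewrite distrC => /le_trans; apply.
rewrite epE.
move: xth m1 re2; rewrite -/(rho n).
by move: (`|x| * th) (461 / _) (_ * rho n) => a c d ha hc hd; clear -ha hc hd; lra.
Unshelve. all: by end_near. Qed.
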